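(* In the two-sample setting described in the context, assume that the derivative $f^{(1)}$ of $f$ exists and is continuous in a neighborhood of $z_0$, and that $f(z_0)>0$. If $h=o(N^{-1/2})$, or if $A_{1,1}^*=0$ and $h=o(N^{-1/4})$, then as $N\to\infty$ $$\sup_{-\infty < x < \infty} \left| P_0 \left[ V_{1}^{-1/2} (\widetilde{M}-E_1) < x\right] -\Phi(x) \right| = o(1),$$ where $$E_1=\frac{m}{2}\left(1- \frac{1}{m+n}\right),\qquad V_1=\frac{mn}{4(m+n)},$$ and $\Phi$ is the standard normal distribution function.
   Context: Setting: $X_1,\dots,X_m$ are i.i.d. from a distribution function $F$ with density $f$, and, independently, $Y_1,\dots,Y_n$ are i.i.d. from $F(x-\theta)$, where $\theta$ is an unknown location parameter; the null hypothesis is $H_0:\theta=0$. $P_0$ denotes probability under $H_0$. Put $N=m+n$, assumed odd, and $\lambda_N=m/N\to\lambda$ with $0<\lambda<1$; limits are as $N\to\infty$. $Z$ is the sample median of the combined sample $\{X_1,\dots,X_m,Y_1,\dots,Y_n\}$, i.e. its $((N+1)/2)$-th order statistic. $z_0$ is the median of $F$. Smoothed median statistic: $\widetilde{M}=\sum_{i=1}^m K^*\left(\frac{Z-X_i}{h}\right)$, where $K^*(t)=\int_{-\infty}^t k^*(u)\,du$, the kernel $k^*$ (possibly taking negative values) satisfies $\int_0^\infty k^*(t)\,dt=1$ and $k^*(t)=0$ for $t\le 0$, and $h=h_N>0$ is a bandwidth with $h\to0$. Also $A_{i,j}^*=\int_{-\infty}^\infty t^i\,\{k^*(t)\}^j\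,dt$.
   Formalization: The formal theorem additionally assumes that $A^*_{1,1}$ exists (absolutely convergent) when $h=o(N^{-1/2})$, and that $A^*_{2,1}$ exists when $A^*_{1,1}=0$ and $h=o(N^{-1/4})$; heavy-tailed kernels violate the claim otherwise. *)

(* Defs.v *)
From HB Require Import structures.
From mathcomp Require Import all_boot all_order all_algebra.
From mathcomp Require Import all_classical all_reals all_analysis.

Set Implicit Arguments.
Unset Strict Implicit.
Unset Printing Implicit Defensive.

Import Order.TTheory GRing.Theory Num.Theory.
Import numFieldNormedType.Exports.

Local Open Scope classical_set_scope.
Local Open Scope ring_scope.

Definition mutually_independent d (T : measurableType d) (R : realType)
    (P : probability T R) (I : choiceType) (W : I -> {RV P >-> R}) : Prop :=
  forall (s : seq I) (B : I -> set R), uniq s ->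
    (forall i, measurable (B i)) ->
    P (\bigcap_(i in [set` s]) (W i @^-1` B i)) =
    (\prod_(i <- s) P (W i @^-1` B i))%E.

Definition pooled_family d (T : measurableType d) (R : realType)
    (P : probability T R) (X Y : nat -> {RV P >-> R}) (i : nat + nat) :
    {RV P >-> R} :=
  match i with inl a => X a | inr b => Y b end.

Definition location_model d (T : measurableType d) (R : realType)
    (P : probability T R) (F : R -> R) (theta : R)
    (X Y : nat -> {RV P >-> R}) : Prop :=
  [/\ mutually_independent (pooled_family X Y),
      forall i x, cdf (X i) x = (F x)%:E &
      forall j x, cdf (Y j) x = (F (x - theta))%:E].

Definition is_density (R : realType) (F f : R -> R) : Prop :=
  [/\ measurable_fun setT f,
      forall x, 0 <= f x &
      forall x, (F x)%:E =
        (\int[lebesgue_measure]_(t in `]-oo, x]) (f t)%:E)%E].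

Definition C1_near (R : realType) (f : R -> R) (z : R) : Prop :=
  \forall y \near z, derivable f y 1 /\ {for y, continuous (derive1 f)}.

(* The order statistics are ranked from 1. *)
Definition order_statistic (R : realType) (s : seq R) (r : nat) : R :=
  nth 0 (sort <=%R s) r.-1.

Definition pooled_sample d (T : measurableType d) (R : realType)
    (P : probability T R) (X Y : nat -> {RV P >-> R}) (m n : nat) (w : T) :
    seq R :=
  [seq X i w | i <- iota 0 m] ++ [seq Y j w | j <- iota 0 n].

(* This is the sample median because [m + n] is odd wherever it is used. *)
Definition pooled_median d (T : measurableType d) (R : realType)
    (P : probability T R) (X Y : nat -> {RV P >-> R}) (m n : nat) (w : T) : R :=
  order_statistic (pooled_sample X Y m n w) (m + n).+1./2.

(* [k] may take negative values. *)
Definition one_sided_kernel (R : realType) (k : R -> R) : Prop :=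
  [/\ lebesgue_measure.-integrable setT (EFin \o k),
      forall t, t <= 0 -> k t = 0 &
      \int[lebesgue_measure]_(t in `[0, +oo[) k t = 1].

Definition kernel_primitive (R : realType) (k : R -> R) (t : R) : R :=
  \int[lebesgue_measure]_(u in `]-oo, t]) k u.

Definition kernel_moment (R : realType) (k : R -> R) (i j : nat) : R :=
  \int[lebesgue_measure]_(t in setT) (t ^+ i * k t ^+ j).

(* The real-valued Lebesgue integral is total, with value 0 on measurable functions
   that are not integrable,
   so the existence of a moment has to be required separately. *)
Definition has_kernel_moment (R : realType) (k : R -> R) (i j : nat) : Prop :=
  lebesgue_measure.-integrable setT (EFin \o (fun t : R => t ^+ i * k t ^+ j)).

Definition smoothed_median d (T : measurableType d) (R : realType)
    (P : probability T R) (X Y : nat -> {RV P >-> R}) (k : R -> R)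
    (m n : nat) (h : R) (w : T) : R :=
  \sum_(i < m) kernel_primitive k ((pooled_median X Y m n w - X i w) / h).

Definition E1 (R : realType) (m n : nat) : R :=
  m%:R / 2 * (1 - (m + n)%:R^-1).

Definition V1 (R : realType) (m n : nat) : R :=
  (m * n)%:R / (4 * (m + n)%:R).

Definition Phi (R : realType) (x : R) : \bar R := normal_prob 0 1 `]-oo, x].

(* Main.v *)
From HB Require Import structures.
Require Import Defs.
From mathcomp Require Import all_boot all_order all_algebra.
From mathcomp Require Import all_classical all_reals all_analysis.
From mathcomp Require Import measurable_realfun lebesgue_integral ring lra zify.

(** Write [N = m + n = 2r + 1], let [Z] be the pooled median, and split the
    primitive of the kernel into the indicator of the positive half-line and
    an error supported there, [K* t = (0 < t) + e t].  Correspondingly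
<<
    Mtilde = M + D,  M = #{i | X_i < Z},  D = \sum_i e ((Z - X_i) / h),
>>
    and the theorem follows from a central limit theorem for [M] and from the
    negligibility of [D] at the scale [sqrt V1], the normal distribution
    function being Lipschitz ([perturbed_distance]).

    The count [M] is hypergeometric.  Without ties, a set [S] of [r] indices is
    the set of observations below the median exactly when the largest
    observation in [S] is smaller than the smallest one outside
    ([below_median_eq]).  These two extremes are independent, with laws that
    depend on the size of [S] alone, so all sets of [r] indices are equally
    likely ([prob_below_median_eq]); counting those that contain [j] of the
    [X_i] gives the law of [M] ([median_count_law]).

    The hypergeometric weights satisfy a two-term recursion, from which their
    variance follows, and which shows that within [O(sqrt N)] of the mean the
    logarithm of a consecutive ratio agrees with that of a normal density up to
    [O(1/N)] ([hypergeometric_step]).  Multiplied along the [O(sqrt N)] steps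
    of the window these errors stay [O(1/sqrt N)].  Weights and normal
    probabilities of cells are compared through cross products
    [p i * gam j <= e^k * (p j * gam i)] ([cross_ratio_le]): the normalising
    constant cancels, so neither Stirling's formula nor the value of a Gaussian
    integral enters.  Summation gives [local_limit_bound] and then
    [hypergeometric_clt], uniformly in [x] and in [m], [n] of the order of [N].

    For [D], the point is that [e] vanishes on nonpositive numbers.  Hence in a
    product [phi(Z) * e((Z - X_i)/h)] the median may be replaced by the order
    statistic of rank [r] of the other [N - 1] observations, which is
    independent of [X_i]; two observations can be removed in the same way
    ([order_statistic_leave_one]).  Taking for [phi] the indicator of a
    neighbourhood of [z0], the second moment of [D] there is at most
    [m * gamma + m^2 * beta^2], where [beta] and [gamma] bound the mean of
    [e((a - X)/h)] and of its square for [a] near [z0] ([second_moment_sum]).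
    By Fubini these means are controlled by integrals of [k u], or [|k u|],
    against the increments [F a - F (a - h u)] ([integral_tail_integral]), so
    that [gamma = O(h)], and
    [beta = O(h)], or [O(h^2)] when the first moment of [k] is zero.  In both
    cases of the bandwidth hypothesis [N * beta^2] tends to zero, and Chebyshev's
    inequality applies because [V1] is of the order of [N].  That [Z] lies near
    [z0] with probability tending to one is a Chernoff bound for binomial tails
    ([median_localised], [binomial_median_tail_lt], [binomial_median_tail_gt]). *)

Set Implicit Arguments.
Unset Strict Implicit.
Unset Printing Implicit Defensive.

Import Order.TTheory GRing.Theory Num.Theory.
Import numFieldNormedType.Exports.

Local Open Scope classical_set_scope.
Local Open Scope ring_scope.

(** * Order statistics and counts *)

Section order_statistics.
Context {R : realType}.
Implicit Types (s : seq R) (r : nat) (x c : R).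

Lemma order_statistic_perm s s' r : perm_eq s s' ->
  order_statistic s r = order_statistic s' r.
Proof.
move=> ss'; rewrite /order_statistic; congr (nth 0 _ _).
by apply/perm_sort_leP.
Qed.

Lemma count_sort_le (a : pred R) s : count a (sort <=%R s) = count a s.
Proof. by apply/permP; rewrite perm_sort. Qed.

(** Expressing the order of a statistic and a number through a count is what
    brings sums over independent observations into play. *)
Lemma order_statistic_le s r c : (0 < r <= size s)%N ->
  (order_statistic s r <= c) = (r <= count (fun x => x <= c)%R s)%N.
Proof.
move=> /andP[r0 rs]; rewrite /order_statistic -[in RHS]count_sort_le.
have ss : sorted <=%R (sort <=%R s) by apply: sort_le_sorted.
apply/idP/idP => [h|h]; last first.
  by apply: Order.POrderTheory.nth_count_le => //; rewrite prednK.
rewrite leqNgt; apply/negP => hlt.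
have : (c < nth 0 (sort <=%R s) r.-1); last by rewrite ltNge h.
apply: nth_count_gt => //.
by rewrite size_sort -ltnS prednK // hlt.
Qed.

Lemma order_statistic_ge s r c : (0 < r <= size s)%N ->
  (c <= order_statistic s r) = (count (fun x => x < c)%R s < r)%N.
Proof.
move=> /andP[r0 rs]; rewrite /order_statistic -[in RHS]count_sort_le.
have ss : sorted <=%R (sort <=%R s) by apply: sort_le_sorted.
apply/idP/idP => [h|h].
  rewrite ltnNge; apply/negP => hle.
  have : (nth 0 (sort <=%R s) r.-1 < c); last by rewrite ltNge h.
  by apply: Order.POrderTheory.nth_count_lt => //; rewrite prednK.
apply: nth_count_ge => //.
by rewrite size_sort -ltnS prednK // h.
Qed.

Lemma order_statistic_in s r : (0 < r <= size s)%N -> order_statistic s r \in s.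
Proof.
move=> /andP[r0 rs]; rewrite /order_statistic -(mem_sort <=%R).
by rewrite mem_nth // size_sort prednK.
Qed.

(** An extra entry below [c] raises by one both the rank and the number of
    entries below [c]. *)
Lemma order_statistic_cons_le x s r c : (0 < r <= size s)%N -> x <= c ->
  (order_statistic (x :: s) r.+1 <= c) = (order_statistic s r <= c).
Proof.
move=> rs xc; rewrite [in RHS]order_statistic_le // order_statistic_le /= ?xc //.
by case/andP: rs.
Qed.

(** The two statistics lie below the same numbers [c >= x], and one of them
    exceeds [x]; this determines both.  Used to take out of the sample an
    observation that is smaller than the median. *)
Lemma order_statistic_cons_eq x s r : (0 < r <= size s)%N ->
  (x < order_statistic (x :: s) r.+1) || (x < order_statistic s r) ->
  order_statistic (x :: s) r.+1 = order_statistic s r.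
Proof.
move=> rs.
have H c : x <= c -> _ := fun xc => order_statistic_cons_le rs xc.
case/orP => hx; apply/le_anti/andP; split.
(* The comparison is available only above [x], whence the maximum. *)
- have := H (Num.max (order_statistic s r) x); rewrite !le_max !lexx orbT /=.
  by move/(_ isT); rewrite [_ <= x]leNgt hx orbF.
- by rewrite -H ?lexx // ltW.
- by rewrite H ?lexx // ltW.
- have := H (Num.max (order_statistic (x :: s) r.+1) x).
  rewrite !le_max !lexx orbT /= => /(_ isT)/esym.
  by rewrite [order_statistic s r <= x]leNgt hx orbF.
Qed.

End order_statistics.

(** * Independence of pairs *)

Section rays.
Context {R : realType}.

Definition rays : set (set R) := [set B | exists c, B = `]-oo, c]%classic].

(** Complements of the half-lines [`]x, +oo[], which are known to generate. *)
Lemma measurable_rays : @measurable _ R = <<s rays>>.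
Proof.
apply: (etrans (RGenOInfty.measurableE R)).
have <- : [set ~` A | A in @RGenOInfty.G R] = rays.
  rewrite eqEsubset; split => [_ [_ [x ->] <-]|_ [x ->]].
    by exists x; rewrite setCitvr.
  by exists (`]x, +oo[%classic); [exists x|rewrite setCitvr].
rewrite eqEsubset; split; apply: smallest_sub.
- exact: smallest_sigma_algebra.
- move=> _ [x ->]; rewrite -[X in _ X]setCK.
  apply: (@measurableC _ (g_sigma_algebraType _)).
  by apply: sub_sigma_algebra; exists (`]x, +oo[%classic) => //; exists x.
- exact: smallest_sigma_algebra.
- move=> _ [A GA <-]; apply: (@measurableC _ (g_sigma_algebraType _)).
  exact: sub_sigma_algebra.
Qed.

Lemma measurable_fun_rays d (T : measurableType d) (f : T -> R) :
  (forall c, measurable [set w | f w <= c]) -> measurable_fun setT f.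
Proof.
move=> H; apply: (measurability _ measurable_rays) => _ [_ [c ->] <-].
rewrite setTI; suff -> : f @^-1` `]-oo, c] = [set w | f w <= c] by exact: H.
by apply/seteqP; split => w /=; rewrite in_itv.
Qed.

End rays.

Section independence.
Context d (T : measurableType d) (R : realType) (P : probability T R).
Local Open Scope ereal_scope.

Definition independent_pair d1 d2 (T1 : measurableType d1)
    (T2 : measurableType d2) (U : T -> T1) (V : T -> T2) :=
  forall A B, measurable A -> measurable B ->
    P (U @^-1` A `&` V @^-1` B) = P (U @^-1` A) * P (V @^-1` B).

(** As functions of [B] both sides are finite measures, and two finite
    measures that agree on an intersection-stable generator are equal. *)
Lemma independent_generator d2 (T2 : measurableType d2) (G : set (set T2))
    (g : (set T2)^nat) (V : {RV P >-> T2}) (E : set T) :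
  measurable E -> measurable = <<s G>> -> setI_closed G ->
  (forall i, G (g i)) -> \bigcup_i g i = setT ->
  (forall B, G B -> P (E `&` V @^-1` B) = P E * P (V @^-1` B)) ->
  forall B, measurable B -> P (E `&` V @^-1` B) = P E * P (V @^-1` B).
Proof.
move=> mE mG IG Gg gT H B mB.
have PEfin : P E \is a fin_num by exact: fin_num_measure.
pose r := NngNum (fine_ge0 (measure_ge0 P E)).
have := @measure_unique d2 R T2 G g mG IG Gg gT
  (pushforward (mrestr P mE) V) (mscale r (distribution P V)).
rewrite /pushforward /= /mrestr /mscale /= fineK //.
move=> /(_ _ _ _ B mB); rewrite /distribution /pushforward setIC; apply.
- exact: measurable_funPT.
- by move=> C GC; rewrite setIC H.
- move=> k; apply: (le_lt_trans (probability_le1 _ _)); last exact: ltry.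
  apply: measurableI => //; apply: measurable_funPTI.
  by rewrite mG; exact: sub_sigma_algebra.
Qed.

Lemma independent_rays (V : {RV P >-> R}) (E : set T) : measurable E ->
  (forall c, P (E `&` V @^-1` `]-oo, c]) = P E * P (V @^-1` `]-oo, c])) ->
  forall B, measurable B -> P (E `&` V @^-1` B) = P E * P (V @^-1` B).
Proof.
move=> mE H.
apply: (@independent_generator _ _ rays (fun n => `]-oo, n%:R]%classic)) => //.
- exact: measurable_rays.
- move=> _ _ [x ->] [y ->]; exists (Num.min x y).
  by apply/seteqP; split => z /=; rewrite !in_itv /= le_min => /andP.
- by move=> i; exists i%:R.
- rewrite -subTset => x _; exists (Num.truncn x).+1 => //=.
  by rewrite in_itv /= ltW // truncnS_gt.
- by move=> _ [c ->]; exact: H.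
Qed.

Lemma independent_pair_rays (U V : {RV P >-> R}) :
  (forall a b, P (U @^-1` `]-oo, a] `&` V @^-1` `]-oo, b]) =
    P (U @^-1` `]-oo, a]) * P (V @^-1` `]-oo, b])) ->
  independent_pair U V.
Proof.
move=> H A B mA mB.
apply: independent_rays => // [|b]; first exact: measurable_funPTI.
rewrite setIC muleC; apply: independent_rays => // [|a].
  exact: measurable_funPTI.
by rewrite setIC muleC.
Qed.

(** Rectangles generate the product sigma-algebra.  Used with a pair of random
    variables in place of one, to remove two observations from a sample. *)
Lemma independent_pair_rect d1 d2 d3 (T1 : measurableType d1)
    (T2 : measurableType d2) (T3 : measurableType d3)
    (U : {RV P >-> T1}) (V : {RV P >-> (T2 * T3)%type}) :
  (forall A B C, measurable A -> measurable B -> measurable C ->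
    P (V @^-1` (B `*` C) `&` U @^-1` A) = P (V @^-1` (B `*` C)) * P (U @^-1` A)) ->
  independent_pair V U.
Proof.
move=> H D A mD mA; rewrite setIC muleC; move: D mD.
pose G : set (set (T2 * T3)) := [set D | exists2 B, measurable B &
  exists2 C, measurable C & D = B `*` C].
apply: (@independent_generator _ _ G (fun=> setT)) => //.
- exact: measurable_funPTI.
- rewrite measurable_prod_measurableType; congr (<<s _ >>).
  rewrite predeqE => E; split => [[B mB [C mC <-]]|[B mB [C mC ->]]].
    by exists B => //; exists C.
  by exists B => //; exists C.
- move=> _ _ [B mB [C mC ->]] [B' mB' [C' mC' ->]].
  rewrite -setXI; exists (B `&` B'); first exact: measurableI.
  by exists (C `&` C') => //; exact: measurableI.
- by move=> _; exists setT => //; exists setT => //; rewrite setXTT.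
- by rewrite bigcup_const //; exists 0%N.
- by move=> _ [B mB [C mC ->]]; rewrite setIC muleC; exact: H.
Qed.

(** The joint law is the product law, so the second variable can be integrated
    out first by Fubini. *)
Lemma integral_independent_pair d1 d2 (T1 : measurableType d1)
    (T2 : measurableType d2) (U : {RV P >-> T1}) (V : {RV P >-> T2})
    (phi : T1 * T2 -> R) (M : R) :
  independent_pair U V -> measurable_fun setT phi ->
  (forall z, `|phi z| <= M)%R ->
  \int[P]_w (phi (U w, V w))%:E =
  \int[P]_w \int[distribution P V]_v (phi (U w, v))%:E.
Proof.
move=> UV mphi phiM.
have mUV : measurable_fun setT (fun w => (U w, V w)).
  by apply: measurable_fun_pair.
have bnd d0 (S : measurableType d0) (Q : probability S R) (f : S -> R) :
    measurable_fun setT f -> (forall z, `|f z| <= M)%R ->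
    Q.-integrable setT (EFin \o f).
  move=> mf fM; apply: measurable_bounded_integrable => //.
    by apply: (le_lt_trans (probability_le1 Q measurableT)); exact: ltry.
  exists M; split; first exact: num_real.
  by move=> x Mx y _; apply: (le_trans (fM y)); exact: ltW.
pose UVm : {mfun T >-> (T1 * T2)%type} := HB.pack (fun w => (U w, V w))
  (isMeasurableFun.Build _ _ _ _ _ mUV).
transitivity (\int[distribution P UVm]_z (phi z)%:E).
  rewrite integral_distribution //; first exact/measurable_EFinP.
  by apply: bnd => //; exact: measurableT_comp.
transitivity (\int[distribution P U \x distribution P V]_z (phi z)%:E).
  apply/esym/eq_measure_integral => A mA _.
  exact: product_measure_unique.
rewrite -(@integral12_prod_meas1 _ _ _ _ _ (distribution P U) (distribution P V)
  (EFin \o phi)); last first.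
  exact: (bnd _ _ (distribution P U \x distribution P V)%E).
have iphi : (distribution P U \x distribution P V).-integrable setT (EFin \o phi).
  exact: (bnd _ _ (distribution P U \x distribution P V)%E).
have /integrableP[mG iG] := integrable_fubini_F iphi.
rewrite integral_distribution //.
apply/integrableP; split; first exact: measurableT_comp.
move: iG; rewrite ge0_integral_distribution //.
exact: measurableT_comp.
Qed.
End independence.

(** * Order statistics of an independent sample *)

(** The probability of at least [r] successes in [n] trials of parameter [p],
    by conditioning on the first trial; this recursion is the shape of the
    inductions over a sample. *)
Fixpoint binomial_tail (R : realType) (p : R) (n r : nat) : R :=
  match n, r with
  | _, 0 => 1
  | 0, _.+1 => 0
  | n'.+1, r'.+1 => p * binomial_tail p n' r' + (1 - p) * binomial_tail p n' r
  end.

Section iid_order_statistics.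
Context d (T : measurableType d) (R : realType) (P : probability T R).
Context (I : choiceType) (W : I -> {RV P >-> R}) (F : R -> R).
Hypothesis indepW : mutually_independent W.
Hypothesis cdfW : forall i x, cdf (W i) x = (F x)%:E.
Implicit Types (s t : seq I) (r : nat) (c : R).
Local Open Scope ereal_scope.

Definition sample_count_ge s c r : set T :=
  [set w | (r <= count (fun i => W i w <= c)%R s)%N].

Lemma sample_count_ge_cons i s c r : sample_count_ge (i :: s) c r =
  (W i @^-1` `]-oo, c] `&` sample_count_ge s c r.-1) `|`
  (W i @^-1` `]c, +oo[ `&` sample_count_ge s c r).
Proof.
apply/seteqP; split => w; rewrite /sample_count_ge /= !in_itv /= andbT.
  by case: leP => _; rewrite ?add0n ?add1n => h; [left|right]; split=> //; lia.
by case=> -[]; case: leP => // _ _; rewrite ?add0n ?add1n; lia.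
Qed.

Lemma measurable_sample_count_ge s c r : measurable (sample_count_ge s c r).
Proof.
elim: s r => [|i s IH] r.
  have [->|r0] := eqVneq r 0%N.
    rewrite (_ : sample_count_ge _ _ _ = setT) //.
    by rewrite -subTset => w _; rewrite /sample_count_ge /=.
  rewrite (_ : sample_count_ge _ _ _ = set0) //.
  by rewrite -subset0 => w; rewrite /sample_count_ge /=; lia.
rewrite sample_count_ge_cons; apply: measurableU; apply: measurableI => //;
  exact: measurable_funPTI.
Qed.

Lemma prob_W_le i c : P (W i @^-1` `]-oo, c]) = (F c)%:E.
Proof. exact: cdfW. Qed.

Lemma prob_W_gt i c : P (W i @^-1` `]c, +oo[) = (1 - F c)%:E.
Proof.
rewrite -setCitvl -preimage_setC probability_setC; last exact: measurable_funPTI.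
by rewrite prob_W_le.
Qed.

Lemma bigcap_preimage_cons i t (B : I -> set R) (A : set R) : i \notin t ->
  \bigcap_(j in [set` i :: t]) (W j @^-1` (if j == i then A else B j)) =
  W i @^-1` A `&` \bigcap_(j in [set` t]) (W j @^-1` B j).
Proof.
move=> it; rewrite (_ : [set` i :: t] = i |` [set` t]); last first.
  by apply/seteqP; split => j /=; rewrite in_cons => /predU1P.
rewrite bigcap_setU1 eqxx; congr (_ `&` _); apply: eq_bigcapr => j /= jt; case: eqP => // ji.
by move: it; rewrite -ji jt.
Qed.

Lemma prod_preimage_cons i t (B : I -> set R) (A : set R) : i \notin t ->
  \prod_(j <- i :: t) P (W j @^-1` (if j == i then A else B j)) =
  P (W i @^-1` A) * \prod_(j <- t) P (W j @^-1` B j).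
Proof.
move=> it; rewrite big_cons eqxx; congr (_ * _).
apply: eq_big_seq => j jt; case: eqP => // ji.
by move: it; rewrite -ji jt.
Qed.

(** By induction on [s], splitting according to the side of [c] on which its
    first observation lies: that observation moves to [t] with a constraint of
    the form allowed there, and the recursion of [binomial_tail] appears.  The
    events on [t] are also what shows that the count is independent of the
    observations outside [s]. *)
Lemma prob_sample_count_ge s t (B : I -> set R) c r : uniq (t ++ s) ->
  (forall i, measurable (B i)) ->
  P (\bigcap_(i in [set` t]) (W i @^-1` B i) `&` sample_count_ge s c r) =
  (\prod_(i <- t) P (W i @^-1` B i)) * (binomial_tail (F c) (size s) r)%:E.
Proof.
elim: s t B r => [|i s IH] t B r.
  rewrite cats0 => ut mB /=.
  case: r => [|r].
    rewrite (_ : sample_count_ge _ _ _ = setT).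
      by rewrite setIT mule1; exact: indepW.
    by rewrite -subTset => w _; rewrite /sample_count_ge /=.
  rewrite (_ : sample_count_ge _ _ _ = set0).
    by rewrite setI0 measure0 mule0.
  by rewrite -subset0 => w; rewrite /sample_count_ge /=.
move=> uts mB.
have uts' : uniq ((i :: t) ++ s).
  by rewrite (perm_uniq (introT permPl (perm_catCA [:: i] t s))).
have it : i \notin t by move: uts' => /= /andP[]; rewrite mem_cat negb_or => /andP[].
have mA : measurable (\bigcap_(j in [set` t]) (W j @^-1` B j)).
  by apply: fin_bigcap_measurable => // j _; exact: measurable_funPTI.
rewrite sample_count_ge_cons setIUr measureU; first last.
- rewrite -subset0 => w [[_ [Ww _]] [_ [Ww' _]]]; move: Ww Ww' => /=.
  by rewrite !in_itv /= andbT => /le_lt_trans h /h; rewrite ltxx.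
- by apply: measurableI => //; apply: measurableI;
    [exact: measurable_funPTI|exact: measurable_sample_count_ge].
- by apply: measurableI => //; apply: measurableI;
    [exact: measurable_funPTI|exact: measurable_sample_count_ge].
rewrite !setIA ![_ `&` W i @^-1` _]setIC -!bigcap_preimage_cons //.
transitivity (
    \prod_(j <- i :: t) P (W j @^-1` (if j == i then `]-oo, c]%classic else B j)) *
      (binomial_tail (F c) (size s) r.-1)%:E +
    \prod_(j <- i :: t) P (W j @^-1` (if j == i then `]c, +oo[%classic else B j)) *
      (binomial_tail (F c) (size s) r)%:E).
  congr (_ + _).
    by apply: (IH (i :: t) (fun j => if j == i then _ else B j)) => // j; case: ifP.
  by apply: (IH (i :: t) (fun j => if j == i then _ else B j)) => // j; case: ifP.
rewrite !prod_preimage_cons // prob_W_le prob_W_gt.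
have [q ->] : exists q : R, \prod_(j <- t) P (W j @^-1` B j) = q%:E.
  exists (fine (\prod_(j <- t) P (W j @^-1` B j))); rewrite fineK //.
  apply: (big_ind (fun x : \bar R => x \is a fin_num)) => // [x y xf yf|j _].
    exact: fin_numM.
  by apply: fin_num_measure; exact: measurable_funPTI.
rewrite -!EFinM -EFinD; congr EFin; case: r => [|r] /=.
  have H n : binomial_tail (F c) n 0 = 1%R by case: n.
  by rewrite H; ring.
by ring.
Qed.

Lemma sample_order_statistic_le s r c w : (0 < r <= size s)%N ->
  (order_statistic [seq W i w | i <- s] r <= c)%R =
  (r <= count (fun i => W i w <= c)%R s)%N.
Proof. by move=> rs; rewrite order_statistic_le ?size_map // count_map. Qed.

Lemma measurable_sample_order_statistic s r :
  measurable_fun setT (fun w => order_statistic [seq W i w | i <- s] r).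
Proof.
have H r' : (0 < r' <= size s)%N ->
    measurable_fun setT (fun w => order_statistic [seq W i w | i <- s] r').
  move=> rs; apply: measurable_fun_rays => c.
  rewrite (_ : [set w | _] = sample_count_ge s c r').
    exact: measurable_sample_count_ge.
  by apply/seteqP; split => w /=; rewrite /sample_count_ge /= sample_order_statistic_le.
have [rs|] := leqP r (size s); last first.
  move=> sr; rewrite (_ : (fun w => _) = cst 0%R) //.
  apply/funext => w; rewrite /order_statistic nth_default //.
  by rewrite size_sort size_map -ltnS prednK // (leq_ltn_trans _ sr).
case: r rs => [_|r rs]; last exact: H.
case: s H => [_|i s H].
  by rewrite (_ : (fun w => _) = cst 0%R).
exact: (H 1%N).
Qed.

Definition sample_order_statistic s r : {RV P >-> R} :=
  HB.pack (fun w => order_statistic [seq W i w | i <- s] r)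
    (isMeasurableFun.Build _ _ _ _ _ (measurable_sample_order_statistic s r)).

Lemma preimage_sample_order_statistic s r c : (0 < r <= size s)%N ->
  sample_order_statistic s r @^-1` `]-oo, c] = sample_count_ge s c r.
Proof.
move=> rs; apply/seteqP; split => w /=;
by rewrite /sample_count_ge /= in_itv /= sample_order_statistic_le.
Qed.

Lemma prob_sample_order_statistic_le s r c : uniq s -> (0 < r <= size s)%N ->
  P (sample_order_statistic s r @^-1` `]-oo, c]) =
  (binomial_tail (F c) (size s) r)%:E.
Proof.
move=> us rs; rewrite preimage_sample_order_statistic //.
have := @prob_sample_count_ge s [::] (fun=> setT) c r us (fun=> measurableT).
by rewrite big_nil mul1e set_nil bigcap_set0 setTI.
Qed.

Lemma bigcap_preimage1 i (B : I -> set R) :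
  \bigcap_(j in [set` [:: i]]) (W j @^-1` B j) = W i @^-1` B i.
Proof. by rewrite set_cons1 bigcap_set1. Qed.

Lemma independent_order_statistic1 i s r : uniq (i :: s) ->
  (0 < r <= size s)%N -> independent_pair P (sample_order_statistic s r) (W i).
Proof.
move=> uis rs C A mC mA; rewrite setIC muleC.
have us : uniq s by case/andP: uis.
move: C mC; apply: independent_rays => [|c]; first exact: measurable_funPTI.
rewrite prob_sample_order_statistic_le // preimage_sample_order_statistic //.
have := @prob_sample_count_ge s [:: i] (fun=> A) c r uis (fun=> mA).
by rewrite bigcap_preimage1 big_seq1.
Qed.

Lemma independent_W i j A B : i != j -> measurable A -> measurable B ->
  P (W i @^-1` A `&` W j @^-1` B) = P (W i @^-1` A) * P (W j @^-1` B).
Proof.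
move=> ij mA mB; have ni : i \notin [:: j] by rewrite inE.
have := bigcap_preimage_cons (fun=> B) A ni.
rewrite bigcap_preimage1 => <-; rewrite indepW //=; last first.
  by move=> l; case: ifP.
  by rewrite ni.
by rewrite (@prod_preimage_cons i [:: j] (fun=> B)) // big_seq1.
Qed.

(** The event on the left and the two single observations factor jointly, by
    [prob_sample_count_ge] with two observations set apart. *)
Lemma independent_order_statistic2 i j s r : uniq (i :: j :: s) ->
  (0 < r <= size s)%N ->
  forall A B C, measurable A -> measurable B -> measurable C ->
  P (sample_order_statistic s r @^-1` C `&` W j @^-1` B `&` W i @^-1` A) =
  P (sample_order_statistic s r @^-1` C `&` W j @^-1` B) * P (W i @^-1` A).
Proof.
move=> uijs rs A B C mA mB mC.
have /and3P[] := uijs; rewrite inE negb_or => /andP[ij _] js us.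
rewrite independent_order_statistic1 //; last by rewrite /= js.
rewrite -setIA setIC [W j @^-1` B `&` _]setIC muleC muleA.
rewrite -muleA [P _ * P (_ @^-1` B)]muleC muleA -independent_W //.
move: C mC; apply: independent_rays => [|c].
  by apply: measurableI; exact: measurable_funPTI.
rewrite prob_sample_order_statistic_le // preimage_sample_order_statistic //.
have ni : i \notin [:: j] by rewrite inE.
have := bigcap_preimage_cons (fun=> B) A ni.
rewrite bigcap_preimage1 => <-.
rewrite (@prob_sample_count_ge s [:: i; j]) //; last by move=> l; case: ifP.
rewrite indepW //=; last by move=> l; case: ifP.
by rewrite ni.
Qed.

Lemma preimage_sample_max s c : (0 < size s)%N ->
  sample_order_statistic s (size s) @^-1` `]-oo, c] =
  \bigcap_(i in [set` s]) (W i @^-1` `]-oo, c]).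
Proof.
move=> s0; rewrite preimage_sample_order_statistic ?s0 ?leqnn //.
rewrite /sample_count_ge; apply/seteqP; split => w /=.
  move=> h; have : all (fun i => W i w <= c)%R s.
    by rewrite all_count eqn_leq count_size.
  by move=> /allP H i /H; rewrite /= in_itv.
move=> H; rewrite leq_eqVlt eq_sym -all_count; apply/orP; left.
by apply/allP => i /H; rewrite /= in_itv.
Qed.

(** That a maximum is at most [a] is an intersection of events on single
    observations, which [prob_sample_count_ge] lets one add to a count over
    the other observations. *)
Lemma prob_sample_max_min s s' a b : uniq (s ++ s') ->
  (0 < size s)%N -> (0 < size s')%N ->
  P (sample_order_statistic s (size s) @^-1` `]-oo, a] `&`
     sample_order_statistic s' 1 @^-1` `]-oo, b]) =
  P (sample_order_statistic s (size s) @^-1` `]-oo, a]) *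
  P (sample_order_statistic s' 1 @^-1` `]-oo, b]).
Proof.
move=> uss s0 s0'.
rewrite (@prob_sample_order_statistic_le s') ?s0' //; last first.
  by move: uss; rewrite cat_uniq => /and3P[].
rewrite preimage_sample_max // preimage_sample_order_statistic ?s0' //.
rewrite (@prob_sample_count_ge s' s (fun=> `]-oo, a]%classic)) //.
by rewrite indepW //; move: uss; rewrite cat_uniq => /and3P[].
Qed.

End iid_order_statistics.

Section measurable_comparison.
Context d (T : measurableType d) (R : realType).

Lemma measurable_lt_set (f g : T -> R) : measurable_fun setT f ->
  measurable_fun setT g -> measurable [set w | f w < g w].
Proof.
move=> mf mg; have := measurable_fun_ltr mf mg measurableT (I : measurable [set true]).
by rewrite setTI; apply.
Qed.

Lemma measurable_eq_set (f g : T -> R) : measurable_fun setT f ->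
  measurable_fun setT g -> measurable [set w | f w = g w].
Proof.
move=> mf mg.
have := measurable_fun_eqr mf mg measurableT (I : measurable [set true]).
rewrite setTI (_ : _ @^-1` _ = [set w | f w = g w]) //.
by apply/seteqP; split => w /=; [move/eqP|move=> ->; rewrite eqxx].
Qed.

End measurable_comparison.

Section eq_prob_lt.
Context d (T : measurableType d) (R : realType) (P : probability T R).
Local Open Scope ereal_scope.

Lemma distribution_rays (U V : {RV P >-> R}) :
  (forall c, P (U @^-1` `]-oo, c]) = P (V @^-1` `]-oo, c])) ->
  forall A, measurable A -> P (U @^-1` A) = P (V @^-1` A).
Proof.
move=> H A mA.
have := @measure_unique _ R _ rays (fun n => `]-oo, n%:R]%classic)
  measurable_rays _ _ _ (distribution P U) (distribution P V); apply => //.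
- move=> _ _ [x ->] [y ->]; exists (Num.min x y).
  by apply/seteqP; split => z /=; rewrite !in_itv /= le_min => /andP.
- by move=> i; exists i%:R.
- rewrite -subTset => x _; exists (Num.truncn x).+1 => //=.
  by rewrite in_itv /= ltW // truncnS_gt.
- by move=> _ [c ->]; exact: H.
- move=> k; apply: (le_lt_trans (probability_le1 _ _)) => //; exact: ltry.
Qed.

(** The joint laws are products of laws that agree on half-lines. *)
Lemma eq_prob_lt (U1 V1 U2 V2 : {RV P >-> R}) :
  independent_pair P U1 V1 -> independent_pair P U2 V2 ->
  (forall c, P (U1 @^-1` `]-oo, c]) = P (U2 @^-1` `]-oo, c])) ->
  (forall c, P (V1 @^-1` `]-oo, c]) = P (V2 @^-1` `]-oo, c])) ->
  P [set w | U1 w < V1 w]%R = P [set w | U2 w < V2 w]%R.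
Proof.
move=> UV1 UV2 HU HV.
pose D : set (R * R) := [set z | (z.1 < z.2)%R].
have mD : measurable D by exact: (measurable_lt_set measurable_fst measurable_snd).
have mpair (U V : {RV P >-> R}) : measurable_fun setT (fun w => (U w, V w)).
  exact: measurable_fun_pair.
pose pr (U V : {RV P >-> R}) : {mfun T >-> (R * R)%type} := HB.pack (fun w => (U w, V w))
  (isMeasurableFun.Build _ _ _ _ _ (mpair U V)).
transitivity (distribution P (pr U1 V1) D) => //.
transitivity (distribution P (pr U2 V2) D) => //.
transitivity ((distribution P U1 \x distribution P V1) D).
  by apply/esym; apply: product_measure_unique.
apply: product_measure_unique => // A B mA mB.
transitivity (P (U1 @^-1` A) * P (V1 @^-1` B)) => //.
by rewrite (distribution_rays HU) // (distribution_rays HV) // -UV2.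
Qed.

End eq_prob_lt.

Section ties.
Context d (T : measurableType d) (R : realType) (P : probability T R).
Local Open Scope ereal_scope.

(** Given the value of [U], the event is an atom of the law of [V]. *)
Lemma prob_tie (U V : {RV P >-> R}) : independent_pair P U V ->
  (forall x, P (V @^-1` [set x]) = 0) -> P [set w | U w = V w] = 0.
Proof.
move=> UV V0.
pose D : set (R * R) := [set z | z.1 = z.2].
have mD : measurable D.
  exact: (measurable_eq_set measurable_fst measurable_snd).
have mD' : measurable [set w | U w = V w] by exact: measurable_eq_set.
have indicU x z : \1_[set w | U w = V w] z = \1_D (U z, V z) :> R by [].
rewrite -[X in P X]setIT -integral_indic //.
rewrite (@integral_independent_pair _ _ _ P _ _ _ _ U V \1_D 1%R) //.
- apply: integral0_eq => w _.
  rewrite (_ : (fun v => _) = (fun v => (\1_[set U w] v)%:E)).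
    rewrite integral_indic // setIT; exact: V0.
  apply/funext => v; rewrite !indicE; congr ((_ : bool)%:R)%:E.
  by apply/idP/idP; rewrite !inE.
- by move=> z; rewrite indicE; case: (_ \in _); rewrite ?normr1 ?normr0.
Qed.

Lemma prob_atom (V : {RV P >-> R}) (F : R -> R) : (forall x, cdf V x = (F x)%:E) ->
  continuous F -> forall x, P (V @^-1` [set x]) = 0.
Proof.
move=> VF cF x; apply/eqP; rewrite eq_le measure_ge0 andbT.
apply/lee_addgt0Pr => e e0; rewrite add0e.
have /cvgrPdist_le /(_ e e0) H := cF x.
have [dl /= dl0 Hd] := H.
pose y := (x - dl / 2)%R.
have yx : (y < x)%R by rewrite /y; lra.
have Hy : (F x <= F y + e)%R.
  have := Hd y; rewrite /ball_ /= /y opprB addrC subrK => Hy.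
  have /Hy : (`|dl / 2| < dl)%R by rewrite ger0_norm; lra.
  by move=> /ler_normlP[]; rewrite -/y; lra.
have -> : [set x] = `]-oo, x] `\` `]-oo, x[.
  by apply/seteqP; split => z /=; rewrite !in_itv /=; [move=> ->|]; rewrite ?lexx ?ltxx //; case=> zx; case: ltgtP zx.
have mV A : measurable A -> measurable (V @^-1` A).
  by move=> mA; exact: measurable_funPTI.
apply: (@le_trans _ _ (P (V @^-1` (`]-oo, x] `\` `]-oo, y])))).
  apply: le_measure; rewrite ?inE; [| |move=> w /= [Vx Vx']; split => //].
  - by apply: mV; exact: measurableD.
  - by apply: mV; exact: measurableD.
  - move: Vx'; rewrite !in_itv /= => /negP; rewrite -leNgt => xV.
    by apply/negP; rewrite -ltNge; exact: lt_le_trans xV.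
have -> : V @^-1` (`]-oo, x] `\` `]-oo, y]) =
    V @^-1` `]-oo, x] `\` V @^-1` `]-oo, y] by [].
rewrite measureD; [|exact: mV|exact: mV|].
  rewrite setIidr; last first.
    by apply: preimage_subset => z; rewrite /= !in_itv /= => /le_trans; apply; exact: ltW.
  rewrite -[X in X - _ <= _]/(cdf V x) -[X in _ - X <= _]/(cdf V y) !VF.
  by rewrite -EFinB lee_fin lerBlDl.
by apply: (le_lt_trans (probability_le1 _ (mV _ _))) => //; exact: ltry.
Qed.

End ties.

(** * Binomial tails at the median rank *)

Section binomial_tail_bounds.
Context {R : realType}.
Implicit Types (p u : R) (n r l : nat).

Lemma binomial_tail0 p n : binomial_tail p n 0 = 1. Proof. by case: n. Qed.

(** Chernoff's bound: the right-hand side is the mean of [u] raised to the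
    number of successes. *)
Lemma binomial_tail_le p u n r : 0 <= p <= 1 -> 1 <= u ->
  binomial_tail p n r * u ^+ r <= (p * u + (1 - p)) ^+ n.
Proof.
move=> p01 u1; elim: n r => [|n IH] [|r].
- by rewrite /= !expr0 mulr1.
- by rewrite /= mul0r expr0.
- by rewrite binomial_tail0 expr0 mulr1 exprn_ege1 //; nra.
- rewrite [in leRHS]exprS [leRHS]mulrDl /= [leLHS]mulrDl; apply: lerD.
  + rewrite [leLHS](_ : _ = p * u * (binomial_tail p n r * u ^+ r)); last first.
      by rewrite exprS; ring.
    by apply: ler_wpM2l => //; nra.
  + rewrite [leLHS](_ : _ = (1 - p) * (binomial_tail p n r.+1 * u ^+ r.+1)); last first.
      by rewrite exprS; ring.
    by apply: ler_wpM2l => //; lra.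
Qed.

(** Chernoff's bound for the lower tail, hence with [u <= 1]. *)
Lemma binomial_tail_ge p u n r : 0 <= p <= 1 -> 0 < u <= 1 ->
  (1 - binomial_tail p n r.+1) * u ^+ r <= (p * u + (1 - p)) ^+ n.
Proof.
move=> p01 u01; elim: n r => [|n IH] r /=.
  by rewrite subr0 mul1r expr0 exprn_ile1 //; lra.
have Q0 : 0 <= (p * u + (1 - p)) ^+ n by rewrite exprn_ge0 //; nra.
rewrite [in leRHS]exprS [leRHS]mulrDl.
rewrite [leLHS](_ : _ = p * ((1 - binomial_tail p n r) * u ^+ r) +
  (1 - p) * ((1 - binomial_tail p n r.+1) * u ^+ r)); last by ring.
apply: lerD; last by apply: ler_wpM2l => //; lra.
case: r => [|r].
  by rewrite binomial_tail0 subrr mul0r mulr0; apply: mulr_ge0 => //; nra.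
rewrite exprS [leLHS](_ : _ = p * u * ((1 - binomial_tail p n r.+1) * u ^+ r));
  last by ring.
by apply: ler_wpM2l => //; nra.
Qed.

Lemma geometric_le_cvg0 (a : nat -> R) (q : R) : 0 <= q < 1 ->
  (forall l, 0 <= a l <= q ^+ l) -> a l @[l --> \oo] --> 0.
Proof.
move=> q01 aq; apply: (@squeeze_cvgr _ _ _ _ (cst 0) (fun l => q ^+ l)).
- by near=> l; exact: aq.
- exact: cvg_cst.
- by apply: cvg_expr; rewrite ger0_norm; lra.
Unshelve. all: by end_near. Qed.

Lemma binomial_tail_itv p n r : 0 <= p <= 1 -> 0 <= binomial_tail p n r <= 1.
Proof.
move=> p01; elim: n r => [|n IH] [|r] /=; rewrite ?lexx ?ler01 //.
by have := IH r; have := IH r.+1; nra.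
Qed.

(** A majority of successes in [2l + 1] trials with [p < 1/2]: Chernoff's bound
    decays like the powers of [Q^2 / u], where [Q = p u + 1 - p]. *)
Lemma binomial_median_tail_lt p : 0 <= p < 1 / 2 ->
  binomial_tail p l.*2.+1 l.+1 @[l --> \oo] --> 0.
Proof.
(* This [u] makes [Q^2 < u] because [u - Q^2] factors as
   [(1 - 2p)^2 (1 - p) (1 + p)]. *)
move=> p01; pose u : R := 2 - 2 * p; pose Q := p * u + (1 - p).
have p1 : 0 <= p <= 1 by lra.
have u1 : 1 < u by rewrite /u; lra.
have Q0 : 0 < Q by rewrite /Q /u; nra.
have Qu : Q <= u.
  rewrite -subr_ge0 (_ : u - Q = (1 - p) * (1 - 2 * p)); last by rewrite /Q /u; ring.
  by apply: mulr_ge0; lra.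
have Q2 : Q ^+ 2 < u.
  rewrite -subr_gt0 (_ : u - _ = (1 - 2 * p) ^+ 2 * (1 - p) * (1 + p)).
    by rewrite !mulr_gt0 ?exprn_gt0 //; lra.
  by rewrite /Q /u; ring.
apply: (@geometric_le_cvg0 _ (Q ^+ 2 / u)).
  by rewrite divr_ge0 ?sqr_ge0 /= ?ltr_pdivrMr ?mul1r //; lra.
move=> l; have /andP[-> _] := binomial_tail_itv l.*2.+1 l.+1 p1.
have ul : 0 < u ^+ l.+1 by rewrite exprn_gt0 //; lra.
rewrite -(ler_pM2r ul).
apply: (le_trans (binomial_tail_le l.*2.+1 l.+1 p1 (ltW u1))).
have -> : (Q ^+ 2 / u) ^+ l * u ^+ l.+1 = u * (Q ^+ 2) ^+ l.
  rewrite expr_div_n [u ^+ l.+1]exprSr mulrA divfK 1?mulrC // expf_neq0 //; lra.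
rewrite -/Q exprS -muln2 mulnC exprM; apply: ler_wpM2r => //.
by rewrite exprn_ge0 // sqr_ge0.
Qed.

Lemma binomial_median_tail_gt p : 1 / 2 < p <= 1 ->
  1 - binomial_tail p l.*2.+1 l.+1 @[l --> \oo] --> 0.
Proof.
(* Here [u - Q^2 = (p - 1/2)^2 (2 - p^2)]. *)
move=> p01; pose u : R := 3 / 2 - p; pose Q := p * u + (1 - p).
have p1 : 0 <= p <= 1 by lra.
have u1 : 0 < u < 1 by rewrite /u; lra.
have Q0 : 0 <= Q <= 1 by rewrite /Q /u; nra.
have Q2 : Q ^+ 2 < u.
  rewrite -subr_gt0 (_ : u - _ = (p - 1 / 2) * ((p - 1 / 2) * (2 - p ^+ 2))).
    by apply: mulr_gt0; [lra|apply: mulr_gt0; nra].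
  by rewrite /Q /u; field.
apply: (@geometric_le_cvg0 _ (Q ^+ 2 / u)).
  by rewrite divr_ge0 ?sqr_ge0 /= ?ltr_pdivrMr ?mul1r //; lra.
move=> l; have /andP[_] := binomial_tail_itv l.*2.+1 l.+1 p1.
rewrite -subr_ge0 => ->.
have ul : 0 < u ^+ l by rewrite exprn_gt0 //; lra.
rewrite -(ler_pM2r ul); have u1' : 0 < u <= 1 by lra.
apply: (le_trans (binomial_tail_ge l.*2.+1 l p1 u1')).
have -> : (Q ^+ 2 / u) ^+ l * u ^+ l = (Q ^+ 2) ^+ l.
  rewrite expr_div_n divfK // expf_neq0 //; lra.
rewrite -/Q exprS -muln2 mulnC exprM; apply: ler_piMl; last by lra.
by rewrite exprn_ge0 // sqr_ge0.
Qed.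

End binomial_tail_bounds.

(** * The standard normal distribution function *)

Section standard_normal_cdf.
Context {R : realType}.
Implicit Types x y c : R.
Notation mu := (@lebesgue_measure R).

Definition Phir x : R := fine (Phi x).

Lemma PhiE x : Phi x = (Phir x)%:E.
Proof. by rewrite /Phir fineK // /Phi; exact: fin_num_measure. Qed.

Lemma Phir_ge0 x : 0 <= Phir x.
Proof. by rewrite -lee_fin -PhiE; exact: measure_ge0. Qed.

Lemma Phir_le1 x : Phir x <= 1.
Proof. by rewrite -lee_fin -PhiE; exact: probability_le1. Qed.

Lemma le_Phir x y : x <= y -> Phir x <= Phir y.
Proof.
move=> xy; rewrite -lee_fin -!PhiE; apply: le_measure; rewrite ?inE //.
by move=> z /=; rewrite !in_itv /= => /le_trans; apply.
Qed.

Lemma PhirB x y : x <= y ->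
  (Phir y - Phir x)%:E = (\int[mu]_(z in `]x, y]) (normal_pdf 0 1 z)%:E)%E.
Proof.
move=> xy; rewrite EFinB -!PhiE /Phi.
transitivity (normal_prob 0 1 (`]-oo, y] `\` `]-oo, x]) : \bar R).
  rewrite measureD //=; last first.
    by apply: (le_lt_trans (probability_le1 _ _)) => //; exact: ltry.
  rewrite setIidr // => z /=; rewrite !in_itv /= => /le_trans; exact.
rewrite /normal_prob; congr (integral _ _ _).
apply/seteqP; split => z /=; rewrite !in_itv /=.
  by case=> -> /negP; rewrite -ltNge => ->.
by case/andP => xz ->; split => //; apply/negP; rewrite -ltNge.
Qed.

Lemma PhirB_le x y c : x <= y ->
  (forall z, x < z <= y -> normal_pdf 0 1 z <= c) -> Phir y - Phir x <= c * (y - x).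
Proof.
move=> xy H; rewrite -lee_fin PhirB //.
apply: (@le_trans _ _ (\int[mu]_(z in `]x, y]) c%:E)%E).
  apply: ge0_le_integral => //.
  - by move=> z _; rewrite lee_fin normal_pdf_ge0.
  - by apply/measurable_EFinP/measurable_funTS; exact: measurable_normal_pdf.
rewrite integral_cst //= lebesgue_measure_itv /= lte_fin.
case: ifP => [_|/negbT]; first by rewrite -EFinD -EFinM lee_fin.
by rewrite -leNgt => yx; rewrite mule0 (_ : y = x) ?subrr ?mulr0 //; apply/le_anti/andP.
Qed.

Lemma PhirB_ge x y c : x <= y -> 0 <= c ->
  (forall z, x < z <= y -> c <= normal_pdf 0 1 z) -> c * (y - x) <= Phir y - Phir x.
Proof.
move=> xy c0 H; rewrite -lee_fin PhirB //.
apply: (@le_trans _ _ (\int[mu]_(z in `]x, y]) c%:E)%E); last first.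
  apply: ge0_le_integral => //.
  - by apply/measurable_EFinP/measurable_funTS; exact: measurable_normal_pdf.
rewrite integral_cst //= lebesgue_measure_itv /= lte_fin.
case: ifP => [_|/negbT]; first by rewrite -EFinD -EFinM lee_fin.
by rewrite -leNgt => yx; rewrite mule0 (_ : y = x) ?subrr ?mulr0 //; apply/le_anti/andP.
Qed.

Lemma normal_pdf01E z : normal_pdf 0 1 z = normal_peak 1 * expR (- (z ^+ 2 / 2)) :> R.
Proof.
by rewrite normal_pdfE ?oner_neq0 // /normal_fun subr0 expr1n mulNr.
Qed.

Lemma Phir_lipschitz x y : x <= y -> Phir y - Phir x <= normal_peak 1 * (y - x).
Proof.
by move=> xy; apply: PhirB_le => // z _; apply: normal_pdf_ub; exact: oner_neq0.
Qed.

Let idTR : measurableTypeR R -> R := idfun.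

#[local] HB.instance Definition _ :=
  @isMeasurableFun.Build _ _ _ _ idTR (@measurable_id _ _ setT).

(** [Phi] is the cumulative distribution function of the identity under the
    normal law, so it has the limits of such a function at infinity. *)
Lemma Phir_tails (e : R) : 0 < e ->
  exists2 A : R, 0 < A & Phir (- A) <= e /\ 1 - Phir A <= e.
Proof.
move=> e0.
pose Q := [the probability _ _ of (@normal_prob R 0 1)].
pose id_RV : {RV Q >-> R} := idTR.
have cdfE x : cdf id_RV x = (Phir x)%:E.
  by rewrite -PhiE /cdf /distribution /pushforward /=.
have h1 := @cvg_cdfy1 _ _ _ Q id_RV.
have h0 := @cvg_cdfNy0 _ _ _ Q id_RV.
have cdfE' : cdf id_RV = EFin \o Phir by apply/funext => x; exact: cdfE.
rewrite cdfE' in h1 h0.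
have H1 : \forall x \near +oo, 1 - e <= Phir x.
  have /fine_cvgP[_ /cvgrPdist_le /(_ e e0)] := h1.
  apply: filterS => x /=.
  by move=> /(le_trans (ler_norm _)); lra.
have H0 : \forall x \near -oo, Phir x <= e.
  have /fine_cvgP[_ /cvgrPdist_le /(_ e e0)] := h0.
  apply: filterS => x /=; rewrite sub0r normrN.
  exact: le_trans (ler_norm _).
have [M [_ HM]] := H1; have [M' [_ HM']] := H0.
exists (`|M| + `|M'| + 1); first by rewrite ltr_wpDl // addr_ge0.
have MM := ler_norm M; have MM' := ler_norm (- M'); rewrite normrN in MM'.
have := normr_ge0 M; have := normr_ge0 M' => p1 p2.
split; first by apply: HM'; lra.
by rewrite lerBlDr addrC -lerBlDr; apply: HM; lra.
Qed.

End standard_normal_cdf.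

(** * Consecutive ratios of hypergeometric weights *)

Section ratio_estimates.
Context {R : realType}.
Implicit Types (s t a : R).

(** The lower companion of [1 + s <= expR s], from the same inequality applied
    to [- (s / (1 + s))]. *)
Lemma expR_le1D s : `|s| <= 1 / 2 -> expR (s - 2 * s ^+ 2) <= 1 + s.
Proof.
move=> /ler_normlP[s1 s2].
have s0 : 0 < 1 + s by lra.
have H : s - 2 * s ^+ 2 <= s / (1 + s).
  rewrite ler_pdivlMr // -subr_ge0 (_ : _ - _ = s ^+ 2 * (1 + 2 * s)); last by ring.
  by apply: mulr_ge0; [exact: sqr_ge0|lra].
apply: (le_trans (y := expR (s / (1 + s)))); first by rewrite ler_expR.
rewrite -[leRHS]invrK -[expR _]invrK -expRN lef_pV2 ?posrE ?invr_gt0 ?expR_gt0 //.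
apply: le_trans (expR_ge1Dx _).
by rewrite (_ : 1 + - _ = (1 + s)^-1) //; field; lra.
Qed.

(** The relation between [p] and [p'] is the recursion of hypergeometric weights
    centred at the mean, [t] being the distance to it.  Divided by
    [al * be = ga * de] it reads
    [(1 + s3) (1 + s4) p = (1 + s1) (1 + s2) p'] with small [s_i]; replacing
    each [1 + s] by [expR s] costs at most [2 s^2] in the exponent, and
    [S = s1 + s2 - s3 - s4]. *)
Lemma ratio_bound (al be ga de t a p p' : R) :
  0 < a -> a <= al -> a <= be -> a <= ga -> a <= de -> al * be = ga * de ->
  0 <= p -> 0 <= p' -> `|t| + 1 <= a / 2 ->
  (al - t) * (be - t) * p = (ga + t + 1) * (de + t + 1) * p' ->
  let S := t * (al^-1 + be^-1 + ga^-1 + de^-1) + (ga^-1 + de^-1) in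
  let e := 4 * ((`|t| + 1) / a) ^+ 2 in
  p' <= p * expR (- S + e) /\ p <= p' * expR (S + e).
Proof.
move=> a0 aal abe aga ade abgd p0 p'0 ta Hp S e.
pose b := (`|t| + 1) / a.
have b2 : b <= 1 / 2 by rewrite /b ler_pdivrMr //; lra.
have small x u : a <= x -> `|u| <= `|t| + 1 -> `|u / x| <= b.
  move=> ax ut; have x0 : 0 < x by lra.
  rewrite normrM normfV (gtr0_norm x0) /b.
  apply: ler_pM => //; first by rewrite invr_ge0 ltW.
  by rewrite lef_pV2.
have [al0 be0 ga0 de0] : [/\ 0 < al, 0 < be, 0 < ga & 0 < de] by split; lra.
have t1 : `|t + 1| <= `|t| + 1 by rewrite (le_trans (ler_normD _ _)) // normr1.
have t2 : `|- t| <= `|t| + 1 by rewrite normrN lerDl.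
have h1 := small ga (t + 1) aga t1; have h2 := small de (t + 1) ade t1.
have h3 := small al (- t) aal t2; have h4 := small be (- t) abe t2.
set s1 := (t + 1) / ga in h1; set s2 := (t + 1) / de in h2.
set s3 := - t / al in h3; set s4 := - t / be in h4.
have sq s : `|s| <= b -> s ^+ 2 <= b ^+ 2.
  by move=> sb; rewrite -real_normK ?num_real // ler_pXn2r ?nnegrE // (le_trans _ sb).
have pos s : `|s| <= b -> 0 <= 1 + s by move=> /ler_normlP[? ?]; lra.
have lo s : `|s| <= b -> expR (s - 2 * s ^+ 2) <= 1 + s.
  by move=> sb; apply: expR_le1D; lra.
have hi s : 1 + s <= expR s := expR_ge1Dx s.
have E : (1 + s3) * (1 + s4) * p = (1 + s1) * (1 + s2) * p'.
  have -> : (1 + s3) * (1 + s4) * p = (al - t) * (be - t) * p / (al * be).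
    by rewrite /s3 /s4; field; rewrite !gt_eqF.
  by rewrite Hp abgd /s1 /s2; field; rewrite !gt_eqF.
have S_E : S = s1 + s2 - s3 - s4 by rewrite /S /s1 /s2 /s3 /s4; field; rewrite !gt_eqF.
have e_E : e = 4 * b ^+ 2 by [].
have q1 := sq _ h1; have q2 := sq _ h2; have q3 := sq _ h3; have q4 := sq _ h4.
split.
- pose z := (s1 - 2 * s1 ^+ 2) + (s2 - 2 * s2 ^+ 2).
  have : p' * expR z <= p * expR (s3 + s4).
    apply: (le_trans (y := (1 + s1) * (1 + s2) * p')).
      rewrite mulrC ler_wpM2r // /z expRD ler_pM ?expR_ge0 //; exact: lo.
    rewrite -E [leRHS]mulrC ler_wpM2r // expRD ler_pM //; exact: pos.
  rewrite -(ler_pM2r (expR_gt0 (- z))) -!mulrA -!expRD subrr expR0 mulr1.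
  move=> /le_trans; apply; apply: ler_wpM2l => //; rewrite ler_expR S_E e_E /z.
  lra.
- pose z := (s3 - 2 * s3 ^+ 2) + (s4 - 2 * s4 ^+ 2).
  have : p * expR z <= p' * expR (s1 + s2).
    apply: (le_trans (y := (1 + s3) * (1 + s4) * p)).
      rewrite mulrC ler_wpM2r // /z expRD ler_pM ?expR_ge0 //; exact: lo.
    rewrite E [leRHS]mulrC ler_wpM2r // expRD ler_pM //; exact: pos.
  rewrite -(ler_pM2r (expR_gt0 (- z))) -!mulrA -!expRD subrr expR0 mulr1.
  move=> /le_trans; apply; apply: ler_wpM2l => //; rewrite ler_expR S_E e_E /z.
  lra.
Qed.

(** The four inverses are the coefficient of [t] in the exponent [S] of
    [ratio_bound]; that it is almost the inverse variance is why the weights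
    are almost normal. *)
Lemma inverse_sum_eq (m n r N v : R) : 0 < m -> 0 < n -> 0 < r ->
  m = N - n -> N = 2 * r + 1 -> v = m * n / (4 * N) ->
  (m * (r + 1) / N)^-1 + (n * r / N)^-1 + (m * r / N)^-1 + (n * (r + 1) / N)^-1
    - v^-1 = (m * (r + 1) / N)^-1 * n^-1 * r^-1.
Proof.
move=> m0 n0 r0 mE NE ->.
have N0 : 0 < N by lra.
have r1 : 0 < r + 1 by lra.
have -> : (m * (r + 1) / N)^-1 + (n * r / N)^-1 + (m * r / N)^-1 + (n * (r + 1) / N)^-1
  = N * (m + n) * (2 * r + 1) / (m * n * r * (r + 1)).
  by field; rewrite !gt_eqF.
have -> : (m * n / (4 * N))^-1 = N * (4 * r * (r + 1)) / (m * n * r * (r + 1)).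
  by field; rewrite !gt_eqF.
rewrite -mulrBl.
have -> : N * (m + n) * (2 * r + 1) - N * (4 * r * (r + 1)) = N.
  by rewrite mE NE; ring.
by field; rewrite !gt_eqF.
Qed.

Lemma half_step t (v : R) : v != 0 -> (2 * t + 1) / (2 * v) = t * v^-1 + v^-1 / 2.
Proof. by move=> v0; field. Qed.

Lemma le_invr a (x : R) : 1 <= a -> a <= x -> 0 < x^-1 <= a^-1.
Proof. by move=> a1 ax; rewrite invr_gt0 lef_pV2 ?posrE; lra. Qed.

Lemma le_inv3 a (x y z : R) : 1 <= a -> a <= x -> a <= y -> a <= z ->
  0 <= x^-1 * y^-1 * z^-1 <= a^-1 * a^-1 * a^-1.
Proof.
move=> a1 /(le_invr a1)/andP[x0 x1] /(le_invr a1)/andP[y0 y1].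
move=> /(le_invr a1)/andP[z0 z1].
apply/andP; split; first by rewrite !mulr_ge0 ?ltW.
have xy := ler_pM (ltW x0) (ltW y0) x1 y1.
exact: (ler_pM (mulr_ge0 (ltW x0) (ltW y0)) (ltW z0) xy z1).
Qed.

Lemma drift_error t a (D : R) : 1 <= a -> `|t| <= a / 2 ->
  0 <= D <= a^-1 * a^-1 * a^-1 -> `|t * D| <= a^-1 / 2.
Proof.
move=> a1 ta /andP[D0 D1]; rewrite normrM (ger0_norm D0).
have a0 : 0 < a by lra.
apply: (le_trans (y := a / 2 * (a^-1 * a^-1 * a^-1))); first exact: ler_pM.
rewrite (_ : a / 2 * _ = a^-1 / 2 * a^-1); last by field; rewrite gt_eqF.
by rewrite ler_piMr ?divr_ge0 ?invr_ge0 ?invf_le1 // ltW.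
Qed.

(** [S] differs from the exponent [(2 t + 1) / (2 v)] of a ratio of normal
    densities by a multiple of [t] that [inverse_sum_eq] makes small, and by a
    constant of order [1 / a]; the last summand is the quadratic error of
    [ratio_bound]. *)
Lemma local_error t a (B ga de v Q D : R) : 1 <= a -> `|t| + 1 <= B -> B <= a / 2 ->
  a <= ga -> a <= de -> 0 < v -> Q <= 4 * a^-1 -> Q - v^-1 = D ->
  0 <= D <= a^-1 * a^-1 * a^-1 ->
  `|t * Q + (ga^-1 + de^-1) - (2 * t + 1) / (2 * v)| + 4 * ((`|t| + 1) / a) ^+ 2
  <= 3 / a + 4 * (B / a) ^+ 2.
Proof.
move=> a1 tB Ba aga ade v0 Q4 QD D0.
have tD : `|t * D| <= a^-1 / 2 by apply: drift_error => //; lra.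
rewrite half_step ?gt_eqF //.
have -> : t * Q + (ga^-1 + de^-1) - (t * v^-1 + v^-1 / 2) =
  t * D + (ga^-1 + de^-1 - v^-1 / 2) by rewrite -QD; ring.
have iv : 0 < v^-1 by rewrite invr_gt0.
have vQ : v^-1 <= 4 * a^-1 by move: D0; rewrite -QD; lra.
have h2 : `|ga^-1 + de^-1 - v^-1 / 2| <= 2 * a^-1.
  have := le_invr a1 aga; have := le_invr a1 ade => d1 g1.
  by clear -d1 g1 iv vQ; apply/ler_normlP; split; lra.
have h3 := ler_normD (t * D) (ga^-1 + de^-1 - v^-1 / 2).
have h4 : 4 * ((`|t| + 1) / a) ^+ 2 <= 4 * (B / a) ^+ 2.
  have a0 : 0 < a by lra.
  rewrite ler_pM2l // ler_pXn2r ?nnegrE ?divr_ge0 ?addr_ge0 ?ler_pM2r ?invr_gt0 ?(ltW a0) //.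
  by have := normr_ge0 t; clear -tB; lra.
have a0 : 0 < a^-1 by rewrite invr_gt0; lra.
by clear -tD h2 h3 h4 a0; lra.
Qed.

Lemma shift_le1 (x y z e : R) : - (x - y) <= z - e -> - x + e <= - y + z.
Proof. by move=> H; lra. Qed.

Lemma shift_le2 (x y z e : R) : x - y <= z - e -> x + e <= y + z.
Proof. by move=> H; lra. Qed.

End ratio_estimates.

Section hypergeometric.
Context {R : realType} (m n r : nat) (p : nat -> R).
Hypothesis mnr : (m + n = r.*2.+1)%N.
Hypothesis p_ge0 : forall j, 0 <= p j.
Hypothesis p_rec : forall j, (m%:R - j%:R) * (r%:R - j%:R) * p j =
  j.+1%:R * (n%:R - r%:R + j.+1%:R) * p j.+1.
Hypothesis p_sum : \sum_(j < m.+1) p j = 1.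

Variables (N mean var : R).
Hypothesis NdefE : N = (m + n)%:R.
Hypothesis meanE : mean = m%:R * r%:R / N.
Hypothesis varE : var = m%:R * n%:R / (4 * N).

Lemma hypergeometric_NE : N = 2 * r%:R + 1.
Proof. by rewrite NdefE mnr -addn1 natrD -muln2 natrM mulrC. Qed.

Lemma hypergeometric_N_gt0 : 0 < N.
Proof. by rewrite hypergeometric_NE; have := ler0n R r; lra. Qed.

(** Summing the recursion against [phi] and shifting the index; both boundary
    terms vanish.  Choices of [phi] give the moments. *)
Lemma hypergeometric_shift (phi : nat -> R) :
  \sum_(j < m.+1) phi j * ((m%:R - j%:R) * (r%:R - j%:R) * p j) =
  \sum_(j < m.+1) phi j.-1 * (j%:R * (n%:R - r%:R + j%:R) * p j).
Proof.
rewrite big_ord_recr /= subrr !mul0r mulr0 addr0.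
rewrite [RHS]big_ord_recl /= !mul0r mulr0 add0r.
by apply: eq_bigr => j _; rewrite p_rec.
Qed.

Lemma hypergeometric_moment1 : \sum_(j < m.+1) (m%:R * r%:R - N * j%:R) * p j = 0.
Proof.
have /eqP := hypergeometric_shift (fun=> 1); rewrite -subr_eq0 -sumrB => /eqP H; rewrite -[RHS]H.
by apply: eq_bigr => j _; rewrite NdefE natrD; ring.
Qed.

Lemma hypergeometric_moment2 : \sum_(j < m.+1)
  j%:R * (m%:R * r%:R + n%:R - r%:R - (N - 1) * j%:R) * p j = 0.
Proof.
have /eqP := hypergeometric_shift (fun j => j%:R); rewrite -subr_eq0 -sumrB => /eqP H; rewrite -[RHS]H.
apply: eq_bigr => -[[|j] hj] _ /=; first by ring.
by rewrite NdefE natrD -[j.+1]addn1 natrD; ring.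
Qed.

(** [(j - mean)^2] is a combination of the expressions whose means the two
    moment identities give and of a constant.  The exact variance is
    [var * 2 (r + 1) / N], which exceeds [var]; hence the factor 2. *)
Lemma hypergeometric_variance : (0 < r)%N ->
  \sum_(j < m.+1) (j%:R - mean) ^+ 2 * p j <= 2 * var.
Proof.
move=> r0; have N0 := hypergeometric_N_gt0; have NE := hypergeometric_NE.
have r0' : 0 < r%:R :> R by rewrite ltr0n.
(* The coefficients of the combination, for [N - 1] times the square. *)
pose c1 := (2 * (N - 1) * mean - (m%:R * r%:R + n%:R - r%:R)) / N.
pose c0 := (N - 1) * mean ^+ 2 - c1 * (m%:R * r%:R).
have mE : m%:R = 2 * r%:R + 1 - n%:R :> R.
  by move: NE; rewrite NdefE natrD; lra.
have N1 : 0 < N - 1 by lra.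
have E : (N - 1) * (\sum_(j < m.+1) (j%:R - mean) ^+ 2 * p j) = c0.
  transitivity (\sum_(j < m.+1) (
     - (j%:R * (m%:R * r%:R + n%:R - r%:R - (N - 1) * j%:R) * p j) +
     (c1 * ((m%:R * r%:R - N * j%:R) * p j) + c0 * p j))).
    rewrite mulr_sumr; apply: eq_bigr => j _.
    have cN : c1 * N = 2 * (N - 1) * mean - (m%:R * r%:R + n%:R - r%:R).
      by rewrite /c1 divfK // gt_eqF.
    have -> : c1 * ((m%:R * r%:R - N * j%:R) * p j) =
      (c1 * (m%:R * r%:R) - c1 * N * j%:R) * p j by ring.
    by rewrite cN /c0; ring.
  rewrite big_split /= sumrN hypergeometric_moment2 oppr0 add0r big_split /= -!mulr_sumr.
  by rewrite hypergeometric_moment1 p_sum mulr0 add0r mulr1.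
rewrite -(ler_pM2l N1) E.
have -> : c0 = 2 * r%:R * (m%:R * n%:R * (r%:R + 1) / (2 * N ^+ 2)).
  rewrite /c0 /c1 meanE mE NE; field.
  by rewrite -NE gt_eqF.
have -> : N - 1 = 2 * r%:R by rewrite NE; ring.
apply: ler_wpM2l; first by lra.
rewrite varE.
have -> : m%:R * n%:R * (r%:R + 1) / (2 * N ^+ 2) =
  (m%:R * n%:R / (2 * N)) * ((r%:R + 1) / N) by field; rewrite gt_eqF.
have -> : 2 * (m%:R * n%:R / (4 * N)) = (m%:R * n%:R / (2 * N)) :> R.
  by field; rewrite gt_eqF.
apply: ler_piMr; first by rewrite divr_ge0 ?mulr_ge0 //; lra.
by rewrite ler_pdivrMr // mul1r NE; lra.
Qed.

Variables (a B : R).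
Hypothesis a_ge1 : 1 <= a.
Hypothesis B_a : 1 <= B <= a / 2.
Hypothesis a_mr : a <= m%:R * r%:R / N.
Hypothesis a_nr : a <= n%:R * r%:R / N.

Variable err : R.
Hypothesis errE : err = 3 / a + 4 * (B / a) ^+ 2.

Lemma hypergeometric_var_gt0 : 0 < var.
Proof.
have N0 := hypergeometric_N_gt0.
have m0 : 0 < m%:R :> R.
  rewrite lt_def ler0n andbT; apply/eqP => m0; have := le_trans a_ge1 a_mr.
  by rewrite m0 !mul0r ler10.
have n0 : 0 < n%:R :> R.
  rewrite lt_def ler0n andbT; apply/eqP => n0; have := le_trans a_ge1 a_nr.
  by rewrite n0 !mul0r ler10.
by rewrite varE divr_gt0 ?mulr_gt0.
Qed.

(** The recursion in the form needed by the limit theorem: up to [err] in the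
    exponent, consecutive weights have the ratio of the values of a normal
    density of variance [var].  In [ratio_bound] the four parameters are those
    for which the factors of the recursion become [al - t], [be - t],
    [ga + t + 1] and [de + t + 1]. *)
Lemma hypergeometric_step j : `|j%:R - mean| + 1 <= B ->
  let t := j%:R - mean in
  p j.+1 <= p j * expR (- ((2 * t + 1) / (2 * var)) + err) /\
  p j <= p j.+1 * expR ((2 * t + 1) / (2 * var) + err).
Proof.
move=> tB t; have a1 := a_ge1; have Ba := B_a; have N0 := hypergeometric_N_gt0; have NE := hypergeometric_NE.
have v0 := hypergeometric_var_gt0.
have mE : m%:R = N - n%:R :> R by rewrite NdefE natrD; ring.
have r0 := ler0n R r; have n0 := ler0n R n; have m0 := ler0n R m.
pose al : R := m%:R * (r%:R + 1) / N; pose be : R := n%:R * r%:R / N.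
pose ga : R := m%:R * r%:R / N; pose de : R := n%:R * (r%:R + 1) / N.
have iN : 0 < N^-1 by rewrite invr_gt0.
have gaal : ga <= al by rewrite /ga /al ler_pM2r // ler_wpM2l //; lra.
have bede : be <= de by rewrite /be /de ler_pM2r // ler_wpM2l //; lra.
have [aga abe] : a <= ga /\ a <= be by [].
have prod_eq : al * be = ga * de by rewrite /al /be /ga /de; field; rewrite gt_eqF.
have recE : (al - t) * (be - t) * p j = (ga + t + 1) * (de + t + 1) * p j.+1.
  have -> : al - t = m%:R - j%:R.
    by rewrite /al /t meanE mE NE; field; rewrite -NE gt_eqF.
  have -> : be - t = r%:R - j%:R.
    by rewrite /be /t meanE mE NE; field; rewrite -NE gt_eqF.
  have -> : ga + t + 1 = j.+1%:R by rewrite /ga /t meanE -[j.+1]addn1 natrD; ring.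
  have -> : de + t + 1 = n%:R - r%:R + j.+1%:R.
    by rewrite /de /t meanE mE NE -[j.+1]addn1 natrD; field; rewrite -NE gt_eqF.
  exact: p_rec.
have a0 : 0 < a by lra.
have aal := le_trans aga gaal; have ade := le_trans abe bede.
have ta : `|t| + 1 <= a / 2 by rewrite (le_trans tB) //; case/andP: B_a.
have := ratio_bound a0 aal abe aga ade prod_eq (p_ge0 _) (p_ge0 _) ta recE.
set S := _ + _; set e := _ * _ ^+ 2 => /= -[H1 H2].
have ga0 := lt_le_trans a0 aga; have be0 := lt_le_trans a0 abe.
have pos2 x y : 0 <= x -> 0 <= y -> 0 < x * y / N -> 0 < x /\ 0 < y.
  move=> x0 y0; rewrite pmulr_lgt0 // => xy.
  by split; rewrite lt_def ?x0 ?y0 andbT; apply: contraTneq xy => ->;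
    rewrite ?mul0r ?mulr0 ltxx.
have [m1 r0'] := pos2 _ _ m0 r0 ga0.
have [n0' _] := pos2 _ _ n0 r0 be0.
have rN : r%:R <= N by rewrite NE -subr_ge0 (_ : _ - _ = r%:R + 1); [lra|ring].
have na : a <= n%:R by rewrite (le_trans abe) // /be ler_pdivrMr // ler_wpM2l.
have ra : a <= r%:R.
  by rewrite (le_trans aga) // /ga ler_pdivrMr // mulrC ler_wpM2l // mE lerBlDr lerDl.
pose Q := al^-1 + be^-1 + ga^-1 + de^-1.
have QE : Q - var^-1 = al^-1 * n%:R^-1 * r%:R^-1 by exact: inverse_sum_eq.
have Q4 : Q <= 4 * a^-1.
  have /andP[_ h1] := le_invr a1 aal; have /andP[_ h2] := le_invr a1 abe.
  have /andP[_ h3] := le_invr a1 aga; have /andP[_ h4] := le_invr a1 ade.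
  have -> : 4 * a^-1 = a^-1 + a^-1 + a^-1 + a^-1 by ring.
  by rewrite /Q !lerD.
have B2 : B <= a / 2 by case/andP: Ba.
have := local_error a1 tB B2 aga ade v0 Q4 QE (le_inv3 a1 aal na ra).
rewrite -/S -/e -errE => H.
have /ler_normlP[He1 He2] : `|S - (2 * t + 1) / (2 * var)| <= err - e by rewrite lerBrDr.
split.
  apply: (le_trans H1); apply: ler_wpM2l => //; rewrite ler_expR.
  exact: shift_le1 He1.
apply: (le_trans H2); apply: ler_wpM2l => //; rewrite ler_expR.
exact: shift_le2 He2.
Qed.

End hypergeometric.

(** * A normal limit from consecutive ratios *)

(** When [PJ] and [GJ] are nearly one, the cross-multiplied inequality says that
    [q] exceeds [g] by little. *)
Lemma mass_compare (R : realType) (q g PJ GJ e k : R) :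
  0 <= q <= 1 -> 0 <= g <= 1 -> 0 <= e -> 0 <= k ->
  1 - e <= GJ -> 0 <= PJ <= 1 -> q * GJ <= expR k * (PJ * g) ->
  q - g <= e + k.
Proof.
move=> q01 g01 e0 k0 eG P01 H.
have H1 : q * (1 - e) <= expR k * g.
  apply: (le_trans (y := q * GJ)); first by rewrite ler_wpM2l; lra.
  by apply: (le_trans H); rewrite ler_wpM2l ?expR_ge0 // ler_piMl; lra.
have H2 : q * (1 - e) * expR (- k) <= g.
  have := ler_wpM2r (expR_ge0 (- k)) H1.
  by rewrite [leRHS]mulrAC -expRD subrr expR0 mul1r.
have H3 := expR_ge1Dx (- k).
have E1 : expR (- k) <= 1 by rewrite -expR0 ler_expR oppr_le0.
have [e1|e1] := lerP 1 e; first by lra.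
have u0 : (1 - e) * (1 - k) <= (1 - e) * expR (- k) by rewrite ler_wpM2l; lra.
have u1 : (1 - e) * expR (- k) <= 1 by rewrite mulr_ile1 ?expR_ge0 //; lra.
have u2 : q * (1 - (1 - e) * expR (- k)) <= 1 - (1 - e) * expR (- k).
  by rewrite ler_piMl //; lra.
have ek : 0 <= e * k by rewrite mulr_ge0.
by lra.
Qed.

Lemma combine_bounds (R : realType) (PJ out rest q g F eta k c : R) :
  1 - eta <= PJ -> PJ + out = 1 -> 0 <= rest -> rest <= out ->
  q - g <= 2 * eta + k -> g - q <= 2 * eta + k -> g <= F + c ->
  F - 2 * eta <= g -> 0 <= eta -> 0 <= c ->
  `|q + rest - F| <= 4 * eta + k + c.
Proof. by move=> *; apply/ler_normlP; split; lra. Qed.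

Section local_limit.
Context {R : realType} (p : nat -> R) (M : nat) (mean v err A B eta : R).

(** Weights [p] on [0..M] whose consecutive ratios are nearly those of a normal
    density of given mean and variance [v], on the window of [A] standard
    deviations about the mean; [B] is half the length of the window, with room
    for the rounding of its ends, and [eta] bounds what is left outside it, for
    the weights by Chebyshev's inequality and for the normal law by assumption. *)
Record local_limit_setting : Prop := LocalLimitSetting {
  setting_p_ge0 : forall j, 0 <= p j;
  setting_p_sum : \sum_(j < M.+1) p j = 1;
  setting_p_var : \sum_(j < M.+1) (j%:R - mean) ^+ 2 * p j <= 2 * v;
  setting_v_gt0 : 0 < v;
  setting_err_ge0 : 0 <= err;
  setting_A_gt0 : 0 < A;
  setting_BE : B = A * Num.sqrt v + 2;
  setting_p_step : forall j, `|j%:R - mean| + 1 <= B ->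
  p j.+1 <= p j * expR (- ((2 * (j%:R - mean) + 1) / (2 * v)) + err) /\
  p j <= p j.+1 * expR ((2 * (j%:R - mean) + 1) / (2 * v) + err);
  setting_mean_lo : 0 <= mean - A * Num.sqrt v;
  setting_mean_hi : mean + A * Num.sqrt v <= M%:R;
  setting_eta_A : 2 / A ^+ 2 <= eta;
  setting_eta_lo : Phir (- A) <= eta;
  setting_eta_hi : 1 - Phir A <= eta
}.

Hypothesis setting : local_limit_setting.

Lemma local_limit_p_ge0 : forall j, 0 <= p j.
Proof. by case: setting. Qed.

Lemma local_limit_p_sum : \sum_(j < M.+1) p j = 1.
Proof. by case: setting. Qed.

Lemma local_limit_p_var : \sum_(j < M.+1) (j%:R - mean) ^+ 2 * p j <= 2 * v.
Proof. by case: setting. Qed.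

Lemma local_limit_v_gt0 : 0 < v.
Proof. by case: setting. Qed.

Lemma local_limit_err_ge0 : 0 <= err.
Proof. by case: setting. Qed.

Lemma local_limit_A_gt0 : 0 < A.
Proof. by case: setting. Qed.

Lemma local_limit_BE : B = A * Num.sqrt v + 2.
Proof. by case: setting. Qed.

Lemma local_limit_p_step : forall j, `|j%:R - mean| + 1 <= B ->
  p j.+1 <= p j * expR (- ((2 * (j%:R - mean) + 1) / (2 * v)) + err) /\
  p j <= p j.+1 * expR ((2 * (j%:R - mean) + 1) / (2 * v) + err).
Proof. by case: setting. Qed.

Lemma local_limit_mean_lo : 0 <= mean - A * Num.sqrt v.
Proof. by case: setting. Qed.

Lemma local_limit_mean_hi : mean + A * Num.sqrt v <= M%:R.
Proof. by case: setting. Qed.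

Lemma local_limit_eta_A : 2 / A ^+ 2 <= eta.
Proof. by case: setting. Qed.

Lemma local_limit_eta_lo : Phir (- A) <= eta.
Proof. by case: setting. Qed.

Lemma local_limit_eta_hi : 1 - Phir A <= eta.
Proof. by case: setting. Qed.

#[local] Hint Resolve local_limit_v_gt0 local_limit_p_ge0 local_limit_err_ge0 : core.

Let sd := Num.sqrt v.
Let z (j : nat) := (j%:R - mean) / sd.
Let w (j : nat) := p j * expR ((j%:R - mean) ^+ 2 / (2 * v)).
Let gam (j : nat) := Phir (z j.+1) - Phir (z j).
Let lo := Num.truncn (mean - A * sd).
Let hi := (Num.truncn (mean + A * sd)).+1.
Let inJ (j : nat) := (lo <= j < hi)%N.

Lemma sd_gt0 : 0 < sd. Proof. by rewrite sqrtr_gt0. Qed.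
Lemma sd_sq : sd ^+ 2 = v. Proof. by rewrite sqr_sqrtr // ltW. Qed.

(** [w] is the quotient of [p] by the normal density, up to a constant, so
    that it varies by a factor [expR err] at each step. *)
Lemma weight_step j : `|j%:R - mean| + 1 <= B ->
  w j.+1 <= w j * expR err /\ w j <= w j.+1 * expR err.
Proof.
move=> /local_limit_p_step[H1 H2]; set t := j%:R - mean in H1 H2 *.
have tS : (j.+1%:R - mean) ^+ 2 / (2 * v) =
    t ^+ 2 / (2 * v) + (2 * t + 1) / (2 * v).
  by rewrite -mulrDl -[j.+1]addn1 natrD /t; congr (_ / _); ring.
rewrite /w tS -/t; set a := t ^+ 2 / (2 * v); set b := (2 * t + 1) / (2 * v) in H1 H2 *.
split.
  apply: (le_trans (ler_wpM2r (expR_ge0 _) H1)).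
  by rewrite -!mulrA -!expRD; rewrite (_ : - b + err + (a + b) = a + err) //; ring.
apply: (le_trans (ler_wpM2r (expR_ge0 _) H2)).
by rewrite -!mulrA -!expRD; rewrite (_ : b + err + a = a + b + err) //; ring.
Qed.

Lemma window_le j : inJ j -> `|j%:R - mean| + 1 <= B.
Proof.
move=> /andP[loj jhi].
have /andP[_ h1] := truncn_itv local_limit_mean_lo.
have As : 0 <= A * sd by rewrite mulr_ge0 // ltW ?local_limit_A_gt0 ?sd_gt0.
have h0 : 0 <= mean + A * sd.
  by rewrite (le_trans local_limit_mean_lo) // lerD2l (le_trans _ As) // oppr_le0.
have /andP[h2 _] := truncn_itv h0.
have j1 : (Num.truncn (mean - A * Num.sqrt v)).+1%:R <= j%:R + 1 :> R.
  by rewrite natr1 ler_nat ltnS.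
have j2 : j%:R <= (Num.truncn (mean + A * sd))%:R :> R by rewrite ler_nat -ltnS.
rewrite local_limit_BE -lerBrDr; apply/ler_normlP; rewrite -/sd in h1 *; split; lra.
Qed.

Lemma window_convex i j k : inJ i -> inJ k -> (i <= j <= k)%N -> inJ j.
Proof. by rewrite /inJ => /andP[? ?] /andP[? ?] /andP[? ?]; lia. Qed.

Lemma weight_chain d j : inJ j -> inJ (j + d) ->
  w (j + d) <= w j * expR (d%:R * err) /\ w j <= w (j + d) * expR (d%:R * err).
Proof.
move=> Jj; elim: d => [|d IH] Jd.
  by rewrite addn0 mul0r expR0 mulr1.
have Jd' : inJ (j + d) by apply: (window_convex Jj Jd); lia.
have [H1 H2] := IH Jd'; have [H3 H4] := weight_step (window_le Jd').
rewrite addnS -[d.+1]addn1 natrD mulrDl mul1r; split.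
  apply: (le_trans H3); rewrite expRD mulrA.
  by apply: ler_wpM2r => //; exact: expR_ge0.
apply: (le_trans H2); rewrite addrC expRD mulrA.
by apply: ler_wpM2r => //; exact: expR_ge0.
Qed.

Lemma weight_ge0 j : 0 <= w j.
Proof. by rewrite mulr_ge0 // expR_ge0. Qed.

Lemma window_diameter i j : inJ i -> inJ j -> `|j%:R - i%:R| <= 2 * B.
Proof.
move=> /window_le Hi /window_le Hj.
have := ler_distD mean j%:R i%:R; rewrite (distrC mean); lra.
Qed.

Lemma weight_le i j : inJ i -> inJ j -> w i <= w j * expR (2 * B * err).
Proof.
move=> Ji Jj; have sz := window_diameter Ji Jj.
have le_e d : d%:R <= 2 * B -> expR (d%:R * err) <= expR (2 * B * err).
  by move=> dB; rewrite ler_expR ler_wpM2r.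
have [ij|/ltnW ji] := leqP i j.
  have [|_ H] := @weight_chain (j - i) i Ji; first by rewrite subnKC.
  rewrite subnKC // in H; apply: (le_trans H); apply: ler_wpM2l.
    exact: weight_ge0.
  by apply: le_e; rewrite natrB //; exact: le_trans (ler_norm _) sz.
have [|H _] := @weight_chain (i - j) j Jj; first by rewrite subnKC.
rewrite subnKC // in H; apply: (le_trans H); apply: ler_wpM2l.
  exact: weight_ge0.
by apply: le_e; rewrite natrB // -opprB; exact: le_trans (ler_norm _) (eq_ind_r (fun x => x <= _) sz (normrN _)).
Qed.

Lemma zscoreS j : z j.+1 = z j + sd^-1.
Proof. by rewrite /z -[j.+1]addn1 natrD; field; rewrite gt_eqF ?sd_gt0. Qed.

Lemma zscore_le j : z j <= z j.+1.
Proof. by rewrite zscoreS lerDl invr_ge0 ltW // sd_gt0. Qed.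

Lemma cell_ge0 j : 0 <= gam j.
Proof. by rewrite subr_ge0 le_Phir // zscore_le. Qed.

Let dens (j : nat) := normal_peak 1 * expR (- ((j%:R - mean) ^+ 2 / (2 * v))) :> R.

(** Between two consecutive points of the lattice the exponent of the density
    moves by at most [B / v]. *)
Lemma cell_pdf_bounds j y : `|j%:R - mean| + 1 <= B -> z j < y <= z j.+1 ->
  dens j * expR (- (B / v)) <= normal_pdf 0 1 y <= dens j * expR (B / v).
Proof.
move=> jB /andP[zy yz]; rewrite normal_pdf01E /dens.
have sd0 := sd_gt0.
pose t := j%:R - mean; pose s := y * sd - t.
have s01 : 0 <= s <= 1.
  move: zy yz; rewrite zscoreS -(ltr_pM2r sd0) -(ler_pM2r sd0) mulrDl mulVf ?gt_eqF //.
  rewrite /z divfK ?gt_eqF // /s /t => h1 h2; apply/andP; split; lra.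
have ys : y ^+ 2 / 2 = t ^+ 2 / (2 * v) + (2 * t * s + s ^+ 2) / (2 * v).
  have -> : y = (t + s) / sd by rewrite /s addrC subrK mulfK // gt_eqF.
  by rewrite exprMn exprVn sd_sq; field; rewrite gt_eqF.
have tB : `|t| + 1 <= B by [].
have hb : `|(2 * t * s + s ^+ 2) / (2 * v)| <= B / v.
  have -> : (2 * t * s + s ^+ 2) / (2 * v) = ((2 * t * s + s ^+ 2) / 2) / v.
    by field; rewrite gt_eqF.
  rewrite normrM [`|v^-1|]gtr0_norm ?invr_gt0 // ler_pM2r ?invr_gt0 //.
  have ss : 0 <= s ^+ 2 <= 1 by rewrite sqr_ge0 /= exprn_ile1; case/andP: s01.
  have ts : `|t * s| <= `|t|.
    by rewrite normrM ler_piMr // ger0_norm; case/andP: s01.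
  move: ts => /ler_normlP[ts1 ts2]; apply/ler_normlP; split; lra.
move: hb => /ler_normlP[hb1 hb2].
have pk : 0 <= normal_peak 1 :> R by exact: normal_peak_ge0.
apply/andP; split.
  by rewrite -[leLHS]mulrA -expRD ler_wpM2l // ler_expR ys -/t; lra.
by rewrite -[leRHS]mulrA -expRD ler_wpM2l // ler_expR ys -/t; lra.
Qed.

Lemma cell_bounds j : `|j%:R - mean| + 1 <= B ->
  dens j * expR (- (B / v)) / sd <= gam j <= dens j * expR (B / v) / sd.
Proof.
move=> jB.
have dz : z j.+1 - z j = sd^-1 by rewrite zscoreS addrC addKr.
have d0 : 0 <= dens j * expR (- (B / v)).
  by rewrite !mulr_ge0 ?expR_ge0 // normal_peak_ge0.
apply/andP; split.
  rewrite -dz; apply: PhirB_ge => //; first exact: zscore_le.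
  by move=> y zy; have /andP[] := cell_pdf_bounds jB zy.
rewrite -dz; apply: PhirB_le; first exact: zscore_le.
by move=> y zy; have /andP[] := cell_pdf_bounds jB zy.
Qed.

Let kap := 2 * B * err + 2 * (B / v).

(** [p / dens] is nearly constant by [weight_le], and so is [gam / dens] by
    [cell_bounds].  In cross-multiplied form neither constant has to be known. *)
Lemma cross_ratio_le i j : inJ i -> inJ j -> p i * gam j <= expR kap * (p j * gam i).
Proof.
move=> Ji Jj; have sd0 := sd_gt0.
have /andP[_ gj] := cell_bounds (window_le Jj).
have /andP[gi _] := cell_bounds (window_le Ji).
have wij := weight_le Ji Jj.
pose e k := expR (- ((k%:R - mean) ^+ 2 / (2 * v))).
have pE k : p k = w k * e k.
  by rewrite /w /e -mulrA -expRD subrr expR0 mulr1.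
apply: (le_trans (ler_wpM2l (local_limit_p_ge0 _) gj)).
have -> : p i * (dens j * expR (B / v) / sd) =
  w i * (e i * e j * (normal_peak 1 * expR (B / v) / sd)).
  by rewrite pE /dens -/(e j); ring.
have c0 : 0 <= e i * e j * (normal_peak 1 * expR (B / v) / sd).
  by rewrite !mulr_ge0 ?expR_ge0 ?normal_peak_ge0 // invr_ge0 ltW.
apply: (le_trans (ler_wpM2r c0 wij)).
have -> : expR kap = expR (2 * B * err) * expR (B / v) * expR (B / v).
  by rewrite -!expRD /kap; congr expR; ring.
apply: (le_trans (y := expR (2 * B * err) * expR (B / v) * expR (B / v) *
   (p j * (dens i * expR (- (B / v)) / sd)))); last first.
  by rewrite ler_wpM2l ?mulr_ge0 ?expR_ge0 // ler_wpM2l.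
rewrite pE /dens -/(e i) expRN.
rewrite le_eqVlt; apply/orP; left; apply/eqP.
by field; rewrite !gt_eqF ?expR_gt0.
Qed.
Lemma window_hi_le : (hi <= M.+1)%N.
Proof.
have As : 0 <= A * sd by rewrite mulr_ge0 // ltW ?local_limit_A_gt0 ?sd_gt0.
have h0 : 0 <= mean + A * sd.
  by rewrite (le_trans local_limit_mean_lo) // lerD2l (le_trans _ As) // oppr_le0.
have /andP[h2 _] := truncn_itv h0.
by rewrite /hi ltnS -(ler_nat R) (le_trans h2) // local_limit_mean_hi.
Qed.

Lemma zscore_hi : A <= z hi.
Proof.
have As : 0 <= A * sd by rewrite mulr_ge0 // ltW ?local_limit_A_gt0 ?sd_gt0.
have h0 : 0 <= mean + A * sd.
  by rewrite (le_trans local_limit_mean_lo) // lerD2l (le_trans _ As) // oppr_le0.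
have /andP[_ h2] := truncn_itv h0.
by rewrite /z ler_pdivlMr ?sd_gt0 // lerBrDl ltW.
Qed.

Lemma zscore_lo : z lo <= - A.
Proof.
have /andP[h1 _] := truncn_itv local_limit_mean_lo.
by rewrite /z ler_pdivrMr ?sd_gt0 // lerBlDl mulNr.
Qed.

(** Chebyshev's inequality. *)
Lemma window_mass : 1 - eta <= \sum_(j < M.+1 | inJ j) p j.
Proof.
have sd0 := sd_gt0.
have c0 : 0 < A ^+ 2 * v by rewrite mulr_gt0 // exprn_gt0 // local_limit_A_gt0.
rewrite lerBlDr -local_limit_p_sum (bigID (fun j : 'I_M.+1 => inJ j)) /= lerD2l.
apply: le_trans local_limit_eta_A.
have -> : 2 / A ^+ 2 = (2 * v) / (A ^+ 2 * v).
  by field; rewrite !gt_eqF // local_limit_A_gt0.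
apply: (le_trans (y := (\sum_(j < M.+1) (j%:R - mean) ^+ 2 * p j) / (A ^+ 2 * v)));
  last by rewrite ler_pM2r ?invr_gt0 // local_limit_p_var.
rewrite mulr_suml [leRHS](bigID (fun j : 'I_M.+1 => inJ j)) /=.
rewrite -[leLHS]add0r; apply: lerD.
  apply: sumr_ge0 => j _; rewrite mulr_ge0 ?invr_ge0 ?(ltW c0) //.
  by rewrite mulr_ge0 ?sqr_ge0.
apply: ler_sum => j nJ; rewrite mulrAC ler_peMl // ler_pdivlMr // mul1r.
have out : A * sd <= `|j%:R - mean|.
  move: nJ; rewrite /inJ negb_and -ltnNge -leqNgt => /orP[jlo|hij].
    have /andP[h1 _] := truncn_itv local_limit_mean_lo.
    have j1 : j%:R <= mean - A * sd.
      by apply: le_trans h1; rewrite ler_nat ltnW.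
    by rewrite distrC (le_trans _ (ler_norm _)) // lerBrDr -lerBrDl.
  have := zscore_hi; rewrite /z ler_pdivlMr // => /le_trans; apply.
  by rewrite (le_trans _ (ler_norm _)) // lerB // ler_nat.
rewrite -sd_sq -exprMn -[leRHS]real_normK ?num_real //.
by rewrite ler_pXn2r ?nnegrE // mulr_ge0 // ltW // local_limit_A_gt0.
Qed.

Let gsum (x : R) (k : nat) := \sum_(j < k | (lo <= j)%N && (z j < x)) gam j.

Lemma cell_sumS x k : gsum x k.+1 =
  gsum x k + (if (lo <= k)%N && (z k < x) then gam k else 0).
Proof. by rewrite /gsum big_mkcond big_ord_recr -big_mkcond. Qed.

(** The sum telescopes; a cell counted because its left end is below [x] may
    reach beyond [x], but not beyond [x + sd^-1]. *)
Lemma cell_sum_le x k : gsum x k <= Phir (Num.min (z k) (x + sd^-1)).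
Proof.
elim: k => [|k IH]; first by rewrite /gsum big_ord0 Phir_ge0.
rewrite cell_sumS; case: ifP => [/andP[_ zx]|_]; last first.
  rewrite addr0 (le_trans IH) // le_Phir // le_min !ge_min zscore_le lexx /=.
  by rewrite orbT.
rewrite (min_l (y := x + sd^-1)); last by rewrite zscoreS lerD2r ltW.
rewrite -lerBrDr opprB addrCA subrr addr0 (le_trans IH) // le_Phir //.
by rewrite ge_min lexx.
Qed.

Lemma cell_sum_ge x k : Phir (Num.min (z k) x) - Phir (z lo) <= gsum x k.
Proof.
have gsum0 i : 0 <= gsum x i by apply: sumr_ge0 => j _; exact: cell_ge0.
have zmono i j : (i <= j)%N -> z i <= z j.
  by move=> ij; rewrite ler_pM2r ?invr_gt0 ?sd_gt0 // lerB // ler_nat.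
elim: k => [|k IH].
  rewrite (le_trans _ (gsum0 _)) // subr_le0 le_Phir // ge_min.
  by rewrite zmono.
have [klo|lok] := leqP k.+1 lo.
  by rewrite (le_trans _ (gsum0 _)) // subr_le0 le_Phir // ge_min zmono.
rewrite cell_sumS -ltnS lok /=; case: ltP => zx.
  rewrite (le_trans _ (lerD IH (lexx _))) // /gam (min_l (ltW zx)).
  rewrite (_ : Phir (z k) - _ + _ = Phir (z k.+1) - Phir (z lo)); last by ring.
  by rewrite lerD2r le_Phir // ge_min lexx.
rewrite addr0 (le_trans _ IH) // lerD2r (min_r zx).
by rewrite le_Phir // ge_min lexx orbT.
Qed.

Lemma cell_sumE x : \sum_(j < M.+1 | inJ j && (z j < x)) gam j = gsum x hi.
Proof.
rewrite /gsum (big_ord_widen_cond M.+1 (fun j => (lo <= j)%N && (z j < x)) gam window_hi_le).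
by apply: eq_bigl => j; rewrite /inJ; case: (lo <= j)%N => //=; rewrite andbC.
Qed.

(** Apart from the two tails of the normal law, the cells of the window cover
    everything. *)
Lemma window_normal_mass : 1 - 2 * eta <= \sum_(j < M.+1 | inJ j) gam j.
Proof.
apply: (le_trans (y := gsum (z hi) hi)).
  apply: le_trans (cell_sum_ge _ _); rewrite minxx.
  have h1 : Phir A <= Phir (z hi) by apply: le_Phir; exact: zscore_hi.
  have h2 : Phir (z lo) <= Phir (- A) by apply: le_Phir; exact: zscore_lo.
  have := local_limit_eta_lo; have := local_limit_eta_hi; lra.
rewrite -cell_sumE big_mkcond [leRHS]big_mkcond /=; apply: ler_sum => j _.
by case: (inJ j) => //=; case: ifP => // _; exact: cell_ge0.
Qed.

(** Sum [cross_ratio_le] over all pairs of points of the window. *)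
Lemma cross_ratio_sum_le (C : pred nat) :
  (\sum_(j < M.+1 | inJ j && C j) p j) * (\sum_(j < M.+1 | inJ j) gam j) <=
  expR kap * ((\sum_(j < M.+1 | inJ j) p j) *
              (\sum_(j < M.+1 | inJ j && C j) gam j)) /\
  (\sum_(j < M.+1 | inJ j && C j) gam j) * (\sum_(j < M.+1 | inJ j) p j) <=
  expR kap * ((\sum_(j < M.+1 | inJ j) gam j) *
              (\sum_(j < M.+1 | inJ j && C j) p j)).
Proof.
split.
  rewrite [X in expR kap * X]mulrC !big_distrlr /= mulr_sumr.
  apply: ler_sum => i /andP[Ji _]; rewrite mulr_sumr; apply: ler_sum => j Jj.
  by rewrite [gam i * _]mulrC cross_ratio_le.
rewrite [X in expR kap * X]mulrC !big_distrlr /= mulr_sumr.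
apply: ler_sum => i /andP[Ji _]; rewrite mulr_sumr; apply: ler_sum => j Jj.
by rewrite mulrC cross_ratio_le.
Qed.

Lemma eta_ge0 : 0 <= eta.
Proof. by apply: le_trans local_limit_eta_A; rewrite divr_ge0 // sqr_ge0. Qed.

Lemma kap_ge0 : 0 <= kap.
Proof.
have B0 : 0 <= B by rewrite local_limit_BE addr_ge0 // mulr_ge0 // ltW ?local_limit_A_gt0 ?sd_gt0.
by rewrite /kap addr_ge0 ?mulr_ge0 // invr_ge0 ltW.
Qed.

(** Both families have nearly full mass on the window, so that [mass_compare]
    turns the cross-multiplied inequalities into a bound on the difference of
    their partial sums; the partial sums of the normal cells are values of the
    normal distribution function, up to one cell. *)
Lemma local_limit_bound x :
  `|\sum_(j < M.+1 | z j < x) p j - Phir x| <=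
  4 * eta + kap + normal_peak 1 / sd.
Proof.
have sd0 := sd_gt0; have e0 := eta_ge0; have k0 := kap_ge0.
pose C j := z j < x.
pose q := \sum_(j < M.+1 | inJ j && C j) p j.
pose g := \sum_(j < M.+1 | inJ j && C j) gam j.
pose PJ := \sum_(j < M.+1 | inJ j) p j.
pose GJ := \sum_(j < M.+1 | inJ j) gam j.
have [HC1 HC2] := cross_ratio_sum_le C; rewrite -/q -/g -/PJ -/GJ in HC1 HC2.
have P1 : 1 - 2 * eta <= PJ by have := window_mass; rewrite -/PJ; lra.
have G1 : 1 - 2 * eta <= GJ by exact: window_normal_mass.
have gE : g = gsum x hi by rewrite -cell_sumE.
have q0 : 0 <= q by apply: sumr_ge0.
have g0 : 0 <= g by apply: sumr_ge0 => j _; exact: cell_ge0.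
have qP : q <= PJ.
  rewrite /q /PJ big_mkcond [leRHS]big_mkcond /=; apply: ler_sum => j _.
  by case: (inJ j) => //=; case: ifP.
have restE : \sum_(j < M.+1 | C j) p j = q + \sum_(j < M.+1 | C j && ~~ inJ j) p j.
  rewrite (bigID (fun j : 'I_M.+1 => inJ j)) /=; congr (_ + _).
  by apply: eq_bigl => j; rewrite andbC.
have PJ0 : 0 <= PJ by apply: sumr_ge0.
have rest0 : 0 <= \sum_(j < M.+1 | C j && ~~ inJ j) p j by apply: sumr_ge0.
have totE : PJ + \sum_(j < M.+1 | ~~ inJ j) p j = 1.
  by rewrite -local_limit_p_sum [RHS](bigID (fun j : 'I_M.+1 => inJ j)).
have rest1 : \sum_(j < M.+1 | C j && ~~ inJ j) p j <= \sum_(j < M.+1 | ~~ inJ j) p j.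
  rewrite big_mkcond [leRHS]big_mkcond /=; apply: ler_sum => j _.
  by case: (inJ j) => //=; rewrite ?andbF //=; case: ifP.
have PJ1 : PJ <= 1.
  by rewrite -totE lerDl; apply: sumr_ge0.
have GJ0 : 0 <= GJ by apply: sumr_ge0 => j _; exact: cell_ge0.
have gsum1 y : gsum y hi <= 1 by apply: (le_trans (cell_sum_le _ _)); exact: Phir_le1.
have gup : g <= Phir x + normal_peak 1 / sd.
  rewrite gE; apply: (le_trans (cell_sum_le _ _)).
  apply: (le_trans (y := Phir (x + sd^-1))); first by rewrite le_Phir // ge_min lexx orbT.
  have xs : x <= x + sd^-1 by rewrite lerDl invr_ge0 ltW.
  by have := Phir_lipschitz xs; rewrite addrAC subrr add0r lerBlDl.
have glo : Phir x - 2 * eta <= g.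
  rewrite gE; have := cell_sum_ge x hi.
  have h2 : Phir (z lo) <= eta.
    by apply: le_trans local_limit_eta_lo; apply: le_Phir; exact: zscore_lo.
  have h1 : Phir x - eta <= Phir (Num.min (z hi) x).
    case: (leP (z hi) x) => _; last by rewrite gerBl.
    have := local_limit_eta_hi; have := le_Phir zscore_hi; have := Phir_le1 x; lra.
  lra.
have GJ1 : GJ <= 1.
  have zM : forall j : 'I_M.+1, inJ j -> z j < z M.+1.
    by move=> j _; rewrite ltr_pM2r ?invr_gt0 // ltrBDr subrK ltr_nat ltn_ord.
  apply: le_trans (gsum1 (z M.+1)); rewrite -cell_sumE le_eqVlt; apply/orP; left.
  apply/eqP; apply: eq_bigl => j; case: (boolP (inJ j)) => //= Jj.
  by rewrite zM.
have g1 : g <= 1 by rewrite gE.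
have q1 : q <= 1 by apply: le_trans PJ1.
have HA : q - g <= 2 * eta + kap.
  by apply: (mass_compare _ _ _ _ G1 _ HC1); rewrite ?q0 ?g0 ?PJ0 ?mulr_ge0.
have HB : g - q <= 2 * eta + kap.
  by apply: (mass_compare _ _ _ _ P1 _ HC2); rewrite ?q0 ?g0 ?GJ0 ?mulr_ge0.
have P1' := window_mass; rewrite -/PJ in P1'.
rewrite restE; move: rest1 rest0; set rest := \sum_(j < _ | _ && _) _.
set out := \sum_(j < _ | _) _ in totE * => rest1 rest0.
have pk : 0 <= normal_peak 1 / sd by rewrite divr_ge0 ?normal_peak_ge0 // ltW.
exact: (combine_bounds P1' totE rest0 rest1 HA HB gup glo e0 pk).
Qed.

End local_limit.

(** * The hypergeometric central limit theorem *)

(** With [y = sqrt N], the standard deviation is of order [y] and [a] of order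
    [y^2], so for fixed [A] the errors of [local_limit_bound] inside the window are
    [O(1 / y)]. *)
Lemma local_error_bounds (R : realType) (c y A B a v sd err : R) :
  0 < c -> c <= 1 -> 0 < A -> 1 <= y -> 8 * (A + 2) / c <= y ->
  a = c * y ^+ 2 / 4 -> c ^+ 2 * y ^+ 2 / 4 <= v -> c * y / 2 <= sd -> sd <= y ->
  B = A * sd + 2 -> err = 3 / a + 4 * (B / a) ^+ 2 ->
  [/\ 1 <= a, B <= a / 2 & 2 * B * err + 2 * (B / v) + normal_peak 1 / sd <=
    (2 * (A + 2) * (12 / c + 64 * (A + 2) ^+ 2 / c ^+ 2) + 8 * (A + 2) / c ^+ 2
      + 2 * normal_peak 1 / c) / y].
Proof.
move=> c0 c1 A0 y1 yc aE vb sdl sdu BE errE.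
have y0 : 0 < y by lra.
set D := A + 2 in yc *.
have D0 : 2 < D by rewrite /D; lra.
have By : B <= D * y.
  by rewrite BE /D mulrDl lerD // ?ler_pM2l //; lra.
have B0 : 0 <= B by rewrite BE addr_ge0 // mulr_ge0 //; nra.
have cy : 8 * D <= y * c by rewrite -ler_pdivrMr.
have a0 : 0 < a by rewrite aE; nra.
have Ba : B <= a / 2.
  apply: (le_trans By).
  rewrite (_ : a / 2 = (y * c) / 8 * y); last by rewrite aE; field.
  by rewrite ler_pM2r //; lra.
have v0 : 0 < v by apply: lt_le_trans vb; rewrite divr_gt0 // mulr_gt0 // exprn_gt0.
have sd0 : 0 < sd by apply: lt_le_trans sdl; rewrite divr_gt0 // mulr_gt0.
split => //; first by rewrite aE; nra.
pose E1 := 12 / c + 64 * D ^+ 2 / c ^+ 2.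
have E1_0 : 0 <= E1 by rewrite addr_ge0 // divr_ge0 ?mulr_ge0 ?sqr_ge0 //; lra.
have h1 : err <= E1 / y ^+ 2.
  rewrite errE (_ : E1 / y ^+ 2 = 3 / a + 4 * (D * y / a) ^+ 2); last first.
    by rewrite /E1 aE; field; rewrite !gt_eqF.
  rewrite lerD2l ler_pM2l // ler_pXn2r ?nnegrE ?divr_ge0 ?ler_pM2r ?invr_gt0 //.
  - exact: ltW.
  - by rewrite mulr_ge0 //; lra.
  - exact: ltW.
have err0 : 0 <= err.
  by rewrite errE addr_ge0 ?mulr_ge0 ?sqr_ge0 // invr_ge0 ltW.
have h2 : 2 * B * err <= 2 * D * E1 / y.
  rewrite (_ : 2 * D * E1 / y = 2 * (D * y) * (E1 / y ^+ 2)); last first.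
    by field; rewrite gt_eqF.
  by rewrite ler_pM ?mulr_ge0 // ler_pM2l.
have h3 : 2 * (B / v) <= 8 * D / c ^+ 2 / y.
  rewrite (_ : _ / y = 2 * ((D * y) / (c ^+ 2 * y ^+ 2 / 4))); last first.
    by field; rewrite !gt_eqF.
  rewrite ler_pM2l // ler_pM ?invr_ge0 ?(ltW v0) // lef_pV2 ?posrE //.
  by rewrite divr_gt0 // mulr_gt0 // exprn_gt0.
have h4 : normal_peak 1 / sd <= 2 * normal_peak 1 / c / y.
  rewrite (_ : _ / y = normal_peak 1 / (c * y / 2)); last by field; rewrite !gt_eqF.
  rewrite ler_wpM2l ?normal_peak_ge0 // lef_pV2 ?posrE //.
  by rewrite divr_gt0 // mulr_gt0.
by rewrite [leRHS]mulrDl [X in _ <= X + _]mulrDl; apply: lerD => //; exact: lerD.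
Qed.

(** The weights ['C(m, j) * 'C(n, r - j) / 'C(m + n, r)], characterised by their
    sum and their consecutive ratios, the form in which the limit theorem uses
    them. *)
Definition hypergeometric_weights (R : realType) (m n r : nat) (p : nat -> R) :=
  [/\ forall j, 0 <= p j, \sum_(j < m.+1) p j = 1 &
    forall j, (m%:R - j%:R) * (r%:R - j%:R) * p j =
      j.+1%:R * (n%:R - r%:R + j.+1%:R) * p j.+1].

(** Choose [A] so large that the tails outside the window are at most
    [eps / 8], then [N] so large that the other errors, bounded by
    [K / sqrt N], are at most [eps / 2]. *)
Theorem hypergeometric_clt (R : realType) (c eps : R) : 0 < c -> c <= 1 -> 0 < eps ->
  exists2 Y : R, 0 < Y & forall (m n r : nat) (p : nat -> R),
    (m + n = r.*2.+1)%N -> hypergeometric_weights m n r p ->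
    c * (m + n)%:R <= m%:R -> c * (m + n)%:R <= n%:R -> Y <= (m + n)%:R ->
    forall x, `|\sum_(j < m.+1 | (j%:R - m%:R * r%:R / (m + n)%:R) /
       Num.sqrt (m%:R * n%:R / (4 * (m + n)%:R)) < x) p j - Phir x| <= eps.
Proof.
move=> c0 c1 e0; pose eta := eps / 8.
have eta0 : 0 < eta by rewrite divr_gt0.
have [A1 A1_0 [A1l A1r]] := Phir_tails eta0.
have i0 : 0 < 2 / eta by rewrite divr_gt0.
(* At least [A1] for the normal tails, and [2 / A^2 <= eta] for
   Chebyshev's inequality. *)
pose A := A1 + 1 + 2 / eta.
have A0 : 0 < A by rewrite /A; lra.
pose K := 2 * (A + 2) * (12 / c + 64 * (A + 2) ^+ 2 / c ^+ 2) + 8 * (A + 2) / c ^+ 2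
      + 2 * normal_peak 1 / c.
pose y0 := 2 + 8 * (A + 2) / c + `|K| * 2 / eps.
have h1 : 0 < 8 * (A + 2) / c by rewrite divr_gt0 // mulr_gt0 //; lra.
have h2 : 0 <= `|K| * 2 / eps by rewrite divr_ge0 ?mulr_ge0 // ltW.
have y00 : 2 < y0 by rewrite /y0; lra.
exists (y0 ^+ 2); first by rewrite exprn_gt0 //; lra.
move=> m n r p mnr [p0 p1 prec] cm cn YN x.
have [N NdefE] : exists N : R, N = (m + n)%:R by exists (m + n)%:R.
rewrite -NdefE in cm cn YN *.
pose y := Num.sqrt N.
have N0 : 0 < N by apply: lt_le_trans YN; rewrite exprn_gt0 //; lra.
have yN : y ^+ 2 = N by rewrite sqr_sqrtr // ltW.
have yy0 : y0 <= y.
  by rewrite -(ler_pXn2r (n := 2)) ?nnegrE ?sqrtr_ge0 ?yN //; lra.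
have y2 : 2 < y by lra.
set mean := m%:R * r%:R / N; set v := m%:R * n%:R / (4 * N).
have m0 : 0 < m%:R :> R by apply: lt_le_trans cm; rewrite mulr_gt0.
have n0 : 0 < n%:R :> R by apply: lt_le_trans cn; rewrite mulr_gt0.
have v0 : 0 < v by rewrite divr_gt0 ?mulr_gt0.
have mnN : m%:R + n%:R = N by rewrite NdefE natrD.
have NE : N = 2 * r%:R + 1 by rewrite NdefE mnr -addn1 natrD -muln2 natrM mulrC.
pose sd := Num.sqrt v.
have vl : c ^+ 2 * y ^+ 2 / 4 <= v.
  rewrite yN /v (_ : c ^+ 2 * N / 4 = (c * N) * (c * N) / (4 * N)); last first.
    by field; rewrite gt_eqF.
  by rewrite ler_pM2r ?invr_gt0 ?mulr_gt0 // ler_pM ?mulr_ge0 ?(ltW c0) ?(ltW N0).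
have vu : v <= y ^+ 2.
  rewrite yN /v ler_pdivrMr ?mulr_gt0 //.
  have -> : m%:R = N - n%:R by rewrite -mnN addrK.
  have nN : n%:R <= N by rewrite -mnN lerDr ltW.
  nra.
have sdu : sd <= y by rewrite -[y]ger0_norm ?sqrtr_ge0 // -sqrtr_sqr ler_wsqrtr.
have sdl : c * y / 2 <= sd.
  have cy0 : 0 <= c * y / 2 by rewrite divr_ge0 // mulr_ge0 ?sqrtr_ge0 // ltW.
  rewrite -[c * y / 2]ger0_norm // -sqrtr_sqr ler_wsqrtr //.
  by rewrite (_ : (c * y / 2) ^+ 2 = c ^+ 2 * y ^+ 2 / 4) //; field.
pose a := c * y ^+ 2 / 4; pose B := A * sd + 2.
pose err := 3 / a + 4 * (B / a) ^+ 2.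
have y1 : 1 <= y by lra.
have yA : 8 * (A + 2) / c <= y by rewrite /y0 in yy0; lra.
have [a1 Ba Kb] := @local_error_bounds R c y A B a v sd err c0 c1 A0 y1 yA
  erefl vl sdl sdu erefl erefl.
have r4 : N / 4 <= r%:R.
  have N2 : 4 < N by rewrite -yN; nra.
  by rewrite ler_pdivrMr //; lra.
have aN u : c * N <= u -> a <= u * r%:R / N.
  move=> cu; rewrite /a yN ler_pdivlMr //.
  rewrite (_ : c * N / 4 * N = c * N * (N / 4)); last by field.
  by rewrite ler_pM ?mulr_ge0 // ?divr_ge0 // ltW.
have am := aN _ cm; have an := aN _ cn.
have sd0 : 0 < sd by rewrite sqrtr_gt0.
have Asd0 : 0 <= A * sd by rewrite mulr_ge0 // ltW.
have B1 : 1 <= B <= a / 2 by rewrite Ba andbT /B; lra.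
have Asd : A * sd <= a by rewrite /B in Ba; lra.
have rgt0 : (0 < r)%N by rewrite -(ltr_nat R) (lt_le_trans _ r4) // divr_gt0.
have setting : local_limit_setting p m mean v err A B eta.
  split => //.
  - exact: (@hypergeometric_variance R m n r p mnr prec p1 N mean v NdefE).
  - have a_ge0 := le_trans ler01 a1.
    by apply: addr_ge0; [exact: divr_ge0|apply: mulr_ge0; rewrite ?sqr_ge0].
  - exact: (@hypergeometric_step R m n r p mnr p0 prec N mean v NdefE erefl erefl a B a1 B1 am an err erefl).
  - by rewrite subr_ge0 (le_trans Asd).
  - rewrite (le_trans (lerD (lexx mean) Asd)) //.
    have amr : a <= m%:R * (r%:R + 1) / N.
      by rewrite (le_trans am) // ler_pM2r ?invr_gt0 // ler_pM2l // lerDl.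
    rewrite (le_trans (lerD (lexx mean) amr)) // /mean -mulrDl -mulrDr.
    rewrite (_ : r%:R + (r%:R + 1) = N); last by rewrite NE; ring.
    by rewrite mulfK // gt_eqF.
  - have A1' : 1 <= A by rewrite /A; lra.
    rewrite ler_pdivrMr ?exprn_gt0 // -ler_pdivrMl // mulrC.
    apply: (le_trans (y := A)); first by rewrite /A; lra.
    by rewrite ler_eXnr.
  - by apply: (le_trans _ A1l); apply: le_Phir; rewrite lerN2 /A; lra.
  - by apply: (le_trans _ A1r); rewrite lerD2l lerN2; apply: le_Phir; rewrite /A; lra.
have := local_limit_bound setting x; rewrite -/sd => /le_trans; apply.
have Ky : K / y <= eps / 2.
  apply: (le_trans (y := `|K| / y)); first by rewrite ler_pM2r ?invr_gt0 ?ler_norm //; lra.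
  rewrite ler_pdivrMr; last by lra.
  rewrite -ler_pdivrMl ?divr_gt0 // invf_div.
  by rewrite mulrC mulrA; apply: le_trans yy0; rewrite /y0; lra.
have e8 : 4 * eta = eps / 2 by rewrite /eta; field.
move: Kb; rewrite -/K => Kb.
have -> : eps = eps / 2 + eps / 2 by field.
by rewrite -addrA lerD ?e8 // (le_trans Kb).
Qed.

(** * The observations below the sample median *)

Lemma measurable_fiber_in d (T : measurableType d) (K : eqType) (f : T -> K) (s : seq K) :
  (forall x, measurable [set w | f w = x]) -> measurable [set w | f w \in s].
Proof.
move=> mf; elim: s => [|x s IH].
  by rewrite (_ : [set w | _] = set0) // -subset0 => w.
rewrite (_ : [set w | _] = [set w | f w = x] `|` [set w | f w \in s]).
  exact: measurableU.
apply/seteqP; split => w /=; rewrite in_cons.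
  by case/predU1P => [->|]; [left|right].
by case=> [->|->]; rewrite ?eqxx ?orbT.
Qed.

Lemma measure_fiber_in d (T : measurableType d) (R : realType)
    (P : {measure set T -> \bar R}) (K : eqType) (f : T -> K) (s : seq K) :
  uniq s -> (forall x, measurable [set w | f w = x]) ->
  P [set w | f w \in s] = (\sum_(x <- s) P [set w | f w = x])%E.
Proof.
move=> us mf; elim: s us => [_|x s IH /= /andP[xs us]].
  by rewrite big_nil (_ : [set w | _] = set0) // -subset0 => w.
rewrite big_cons -IH //.
rewrite (_ : [set w | _] = [set w | f w = x] `|` [set w | f w \in s]); last first.
  apply/seteqP; split => w /=; rewrite in_cons.
    by case/predU1P => [->|]; [left|right].
  by case=> [->|->]; rewrite ?eqxx ?orbT.
rewrite measureU //; first exact: measurable_fiber_in.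
by rewrite -subset0 => w /= [-> h]; move: xs; rewrite h.
Qed.

Lemma count_enum_card (J : finType) (a : pred J) (S : {set J}) :
  count a (enum S) = #|[set j in S | a j]%SET|.
Proof.
rewrite -size_filter cardE; apply: perm_size; apply: uniq_perm.
- by rewrite filter_uniq // enum_uniq.
- exact: enum_uniq.
by move=> j; rewrite mem_filter !mem_enum !inE andbC.
Qed.

(** A set [S] corresponds to the pair of its parts inside and outside [L]. *)
Lemma card_two_color_draws (J : finType) (L : {set J}) (r j : nat) :
  #|[set S : {set J} | (#|S| == r) && (#|S :&: L| == j)]%SET| =
  (if (j <= r)%N then 'C(#|L|, j) * 'C(#|~: L|, r - j) else 0)%N.
Proof.
have split_card (S : {set J}) : (#|S :&: L| + #|S :&: ~: L| = #|S|)%N.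
  by rewrite -finset.setDE cardsID.
have side (A0 B0 : {set J}) : A0 \subset L -> B0 \subset ~: L ->
    ((A0 :|: B0) :&: L = A0)%SET /\ ((A0 :|: B0) :&: ~: L = B0)%SET.
  move=> h1 h2; split.
    rewrite finset.setIUl (finset.setIidPl h1) (_ : B0 :&: L = finset.set0)%SET ?finset.setU0 //.
    by apply/eqP; rewrite finset.setI_eq0 finset.disjoints_subset.
  rewrite finset.setIUl (finset.setIidPl h2) (_ : A0 :&: ~: L = finset.set0)%SET ?finset.set0U //.
  by apply/eqP; rewrite finset.setI_eq0 finset.disjoints_subset finset.setCK.
case: leqP => [jr|rj]; last first.
  apply/eqP; rewrite cards_eq0; apply/eqP/setP => S; rewrite !inE.
  apply/negP => /andP[/eqP Sr /eqP Sj]; have := split_card S; lia.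
rewrite -!cards_draws -cardsX.
rewrite -(card_in_imset (f := fun AB : {set J} * {set J} => AB.1 :|: AB.2)%SET).
  congr #|pred_of_set _|; apply/setP => S; rewrite !inE; apply/idP/imsetP.
    move=> /andP[/eqP Sr /eqP Sj]; exists (S :&: L, S :&: ~: L)%SET => /=; last first.
      by rewrite -finset.setIUr finset.setUCr finset.setIT.
    rewrite !inE /= !subsetIr Sj eqxx /=.
    by apply/eqP; have := split_card S; lia.
  move=> [[A B]]; rewrite !inE /= => /andP[/andP[AL /eqP Aj] /andP[BL /eqP Br]] ->.
  have [AI BI] := side A B AL BL.
  by rewrite AI Aj eqxx andbT; apply/eqP; rewrite -(split_card (A :|: B)) AI BI Aj Br subnKC.
move=> [A B] [A' B']; rewrite !inE /= => /andP[/andP[AL _] /andP[BL _]].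
move=> /andP[/andP[AL' _] /andP[BL' _]] E.
have [a1 b1] := side _ _ AL BL; have [a2 b2] := side _ _ AL' BL'.
by congr pair; [rewrite -a1 -a2 E|rewrite -b1 -b2 E].
Qed.

Lemma bin_stepR (R : realType) (n k : nat) :
  (n%:R - k%:R) * 'C(n, k)%:R = k.+1%:R * 'C(n, k.+1)%:R :> R.
Proof.
have [kn|nk] := leqP k n; first by rewrite -natrB // -!natrM mul_bin_left.
by rewrite !bin_small ?mulr0 // ltnW.
Qed.

Section below_median.
Context d (T : measurableType d) (R : realType) (P : probability T R).
Context (I : choiceType) (W : I -> {RV P >-> R}) (F : R -> R).
Hypothesis indepW : mutually_independent W.
Hypothesis cdfW : forall i x, cdf (W i) x = (F x)%:E.
Hypothesis F_continuous : continuous F.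
Context (J : finType) (e : J -> I) (r : nat).
Hypothesis e_inj : injective e.
Hypothesis card_J : #|J| = r.*2.+1.
Hypothesis r_gt0 : (0 < r)%N.

Implicit Types (S : {set J}) (w : T) (c : R) (k : nat).

Definition subsample (S : {set J}) : seq I := [seq e j | j <- enum S].

Let Z := sample_order_statistic W (subsample [set: J]%SET) r.+1.

Definition below_median (w : T) : {set J} := [set j | W (e j) w < Z w]%SET.

Lemma size_subsample S : size (subsample S) = #|S|.
Proof. by rewrite size_map -cardE. Qed.

Lemma uniq_subsample S : uniq (subsample S).
Proof. by rewrite map_inj_uniq // enum_uniq. Qed.

Lemma count_subsample (a : pred R) S w :
  count a [seq W i w | i <- subsample S] = #|[set j in S | a (W (e j) w)]%SET|.
Proof. by rewrite !count_map -count_enum_card. Qed.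

Lemma subsample_le S k c w : (0 < k <= #|S|)%N ->
  (sample_order_statistic W (subsample S) k w <= c) =
  (k <= #|[set j in S | (W (e j) w <= c)%R]%SET|)%N.
Proof.
by move=> kS; rewrite order_statistic_le ?size_map ?size_subsample -?cardE // count_subsample.
Qed.

Lemma subsample_ge S k c w : (0 < k <= #|S|)%N ->
  (c <= sample_order_statistic W (subsample S) k w) =
  (#|[set j in S | (W (e j) w < c)%R]%SET| < k)%N.
Proof.
by move=> kS; rewrite order_statistic_ge ?size_map ?size_subsample -?cardE // count_subsample.
Qed.

Lemma subsample_in S k w : (0 < k <= #|S|)%N ->
  exists2 j, j \in S & sample_order_statistic W (subsample S) k w = W (e j) w.
Proof.
move=> kS.
have : sample_order_statistic W (subsample S) k w \in [seq W i w | i <- subsample S].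
  by apply: order_statistic_in; rewrite size_map size_subsample.
case/mapP => i /mapP[j]; rewrite mem_enum => jS -> ->; by exists j.
Qed.

Lemma median_rank : (0 < r.+1 <= #|[set: J]%SET|)%N.
Proof. by rewrite cardsT card_J /= ltnS -addnn leq_addr. Qed.

(** The left-hand event concerns all observations at once, the right-hand one
    two independent variables. *)
Lemma below_median_eq (S : {set J}) w : #|S| = r ->
  below_median w = S <->
  sample_order_statistic W (subsample S) r w <
  sample_order_statistic W (subsample (~: S)) 1 w.
Proof.
move=> cS; have rS : (0 < r <= #|S|)%N by rewrite cS leqnn r_gt0.
have cSc : #|~: S| = r.+1 by have := cardsC S; rewrite cS card_J; lia.
have oneS : (0 < 1 <= #|~: S|)%N by rewrite cSc.
have maxP c : (sample_order_statistic W (subsample S) r w <= c) ->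
    forall j, j \in S -> W (e j) w <= c.
  rewrite subsample_le // => h j jS.
  have : [set j in S | (W (e j) w <= c)%R]%SET = S.
    by apply/eqP; rewrite eqEcard cS h andbT; apply/fintype.subsetP => i; rewrite inE => /andP[].
  by move=> /setP/(_ j); rewrite inE jS.
have minP j : j \notin S -> sample_order_statistic W (subsample (~: S)) 1 w <= W (e j) w.
  move=> jS; rewrite subsample_le //; apply/card_gt0P; exists j.
  by rewrite !inE jS lexx.
split => [E|AB].
- have [j jS ->] := subsample_in w rS; have [i iS ->] := subsample_in w oneS.
  move: jS iS; rewrite -E !inE -leNgt => h1 h2; exact: (lt_le_trans h1 h2).
- apply/setP => j; rewrite inE; apply/idP/idP => [|jS].
    apply: contraLR => jS; rewrite -leNgt.
    apply: (le_trans _ (minP j jS)).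
    rewrite subsample_le ?median_rank //.
    have [i iS Bi] := subsample_in w oneS.
    have -> : r.+1 = #|i |: S| by rewrite cardsU1 cS; move: iS; rewrite inE => ->.
    apply/subset_leq_card/fintype.subsetP => l; rewrite !inE => /predU1P[->|lS].
      by rewrite Bi lexx.
    by apply: maxP lS; exact: ltW.
  rewrite ltNge; apply/negP => ZW.
  have : Z w <= sample_order_statistic W (subsample S) r w.
    by apply: (le_trans ZW); apply: (maxP _ (lexx _)).
  rewrite subsample_le ?median_rank // leqNgt => /negP; apply.
  rewrite ltnS -[leqRHS]cS; apply/subset_leq_card/fintype.subsetP => l; rewrite !inE /=.
  apply: contraLR => lS; rewrite -ltNge; exact: (lt_le_trans AB (minP l lS)).
Qed.

Lemma measurable_below_median_eq (S : {set J}) : measurable [set w | below_median w = S].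
Proof.
rewrite (_ : [set w | _] = \bigcap_(j in [set: J])
    (if j \in S then [set w | W (e j) w < Z w] else ~` [set w | W (e j) w < Z w])).
  apply: fin_bigcap_measurable => // j _.
  have mj : measurable [set w | W (e j) w < Z w] by exact: measurable_lt_set.
  by case: ifP => // _; exact: measurableC.
apply/seteqP; split => w /=.
  by move=> <- j _; rewrite inE; case: (boolP (W (e j) w < Z w)) => [//|/negP].
move=> H; apply/setP => j; rewrite inE; have := H j Logic.I.
by case: ifP => _ //= /negP/negbTE.
Qed.

(** By [below_median_eq], both are the probability that one of two independent
    variables is below the other, and the laws of these two variables, a
    maximum of [r] observations and a minimum of [r + 1], do not depend on
    the set. *)
Lemma prob_below_median_eq (S S' : {set J}) : #|S| = r -> #|S'| = r ->
  P [set w | below_median w = S] = P [set w | below_median w = S'].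
Proof.
move=> cS cS'.
have E (S0 : {set J}) : #|S0| = r -> [set w | below_median w = S0] =
    [set w | sample_order_statistic W (subsample S0) r w <
             sample_order_statistic W (subsample (~: S0)) 1 w].
  by move=> c0; apply/seteqP; split => w /=; move/(below_median_eq w c0).
have cC (S0 : {set J}) : #|S0| = r -> #|~: S0| = r.+1.
  by move=> c0; have := cardsC S0; rewrite c0 card_J; lia.
have ind (S0 : {set J}) : #|S0| = r -> independent_pair P
    (sample_order_statistic W (subsample S0) r)
    (sample_order_statistic W (subsample (~: S0)) 1).
  move=> c0; apply: independent_pair_rays => a b.
  rewrite -c0 -size_subsample; apply: (prob_sample_max_min indepW cdfW);
    rewrite ?size_subsample ?c0 ?cC //.
  rewrite cat_uniq !uniq_subsample andbT /=; apply/hasPn => i /mapP[j].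
  rewrite mem_enum inE => jS ->; apply/negP => /mapP[l]; rewrite mem_enum => lS.
  by move=> /e_inj jl; move: jS; rewrite jl lS.
rewrite (E S) // (E S') //; apply: eq_prob_lt; [exact: ind|exact: ind| |].
- move=> c; rewrite !(prob_sample_order_statistic_le indepW cdfW) ?uniq_subsample
    ?size_subsample ?cS ?cS' ?leqnn ?r_gt0 //.
- move=> c; rewrite !(prob_sample_order_statistic_le indepW cdfW) ?uniq_subsample
    ?size_subsample ?cC //.
Qed.

Definition tie_set : set T :=
  \big[setU/set0]_(ij <- [seq ij <- enum {: J * J} | ij.1 != ij.2])
    [set w | W (e ij.1) w = W (e ij.2) w].

Lemma tie_set_null : measurable tie_set /\ P tie_set = 0%E.
Proof.
rewrite /tie_set big_seq.
apply: (big_ind (fun A : set T => measurable A /\ P A = 0%E)).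
- by split => //; rewrite measure0.
- move=> A B [mA PA] [mB PB]; split; first exact: measurableU.
  by rewrite measureU0.
- move=> [i j]; rewrite mem_filter => /andP[/= ij _]; split.
    exact: measurable_eq_set.
  apply: prob_tie => [|x].
    by move=> A B; apply: (independent_W indepW); apply: contraNneq ij => /e_inj ->.
  exact: (prob_atom (cdfW (e j)) F_continuous).
Qed.

(** The median is itself an observation; if no other one is equal to it, exactly
    [r] observations remain below. *)
Lemma card_below_median w : ~ tie_set w -> #|below_median w| = r.
Proof.
move=> nt; have mr := median_rank; apply/eqP; rewrite eqn_leq; apply/andP; split.
  have : Z w <= Z w by []; rewrite subsample_ge // ltnS.
  by rewrite (_ : [set j in _ | _]%SET = below_median w) //; apply/setP => j; rewrite !inE.
have : Z w <= Z w by []; rewrite subsample_le // => h.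
have [j0 _ Zj] := subsample_in w mr.
have : [set j in [set: J]%SET | W (e j) w <= Z w]%SET \subset j0 |: below_median w.
  apply/fintype.subsetP => j; rewrite !inE /= le_eqVlt => /orP[/eqP jZ|->]; last by rewrite orbT.
  apply/orP; left; apply/negPn/negP => jj0; apply: nt.
  rewrite /tie_set -bigcup_seq; exists (j, j0) => /=; last by rewrite jZ.
  by rewrite mem_filter /= jj0 mem_enum.
move=> /subset_leq_card; rewrite cardsU1 => h2; move: (leq_trans h h2).
by case: (_ \notin _); rewrite ?add0n ?add1n ?ltnS // => /ltnW.
Qed.

(** [p0] is the common probability of the sets of size [r]; sets of any other
    size occur only with ties.  The value [1 / 'C(2r + 1, r)] of [p0] is left
    implicit, being determined by the total mass. *)
Lemma prob_below_median_card (L : {set J}) : exists2 p0 : R, 0 <= p0 &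
  forall j, P [set w | #|below_median w :&: L| = j] =
    (p0 * #|[set S : {set J} | (#|S| == r) && (#|S :&: L| == j)]%SET|%:R)%:E.
Proof.
have [mt Pt] := tie_set_null.
have [S0 cS0] : exists S0 : {set J}, #|S0| = r.
  have rJ : (r <= #|J|)%N by rewrite card_J -addnn -addSn leq_addl.
  have : (0 < #|[set S : {set J} | (S \subset [set: J]%SET) && (#|S| == r)]%SET|)%N.
    by rewrite cards_draws cardsT bin_gt0.
  by case/card_gt0P => S0; rewrite inE => /andP[_ /eqP ?]; exists S0.
pose p0 := fine (P [set w | below_median w = S0]).
have p0E : P [set w | below_median w = S0] = p0%:E.
  by rewrite /p0 fineK // fin_num_measure //; exact: measurable_below_median_eq.
have PS S : P [set w | below_median w = S] = (if #|S| == r then p0 else 0)%:E.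
  case: eqP => cS; first by rewrite -p0E; exact: prob_below_median_eq.
  apply/eqP; rewrite eq_le; apply/andP; split; last exact: measure_ge0.
  apply: (@le_trans _ _ (P tie_set)); last by rewrite Pt.
  apply: le_measure; rewrite ?inE //.
    exact: measurable_below_median_eq.
  move=> w /= wS; apply/not_notP => nt; apply: cS.
  by rewrite -wS; exact: card_below_median.
exists p0 => [|j]; first by apply: fine_ge0; exact: measure_ge0.
rewrite (_ : [set w | _] = [set w | below_median w \in
    enum [set S : {set J} | #|S :&: L| == j]%SET]); last first.
  apply/seteqP; split => w /=; rewrite mem_enum inE; first by move=> ->.
  by move/eqP.
rewrite measure_fiber_in ?enum_uniq //; last exact: measurable_below_median_eq.
rewrite (eq_bigr (fun S : {set J} => (if #|S| == r then p0 else 0)%:E)); last by move=> S _; exact: PS.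
rewrite sumEFin big_enum /= -big_mkcondr /= sumr_const mulr_natr.
congr (_ *+ _)%:E; apply: eq_card => S.
by rewrite [RHS]inE unfold_in /= inE andbC.
Qed.

Lemma measurable_below_median_card (L : {set J}) j :
  measurable [set w | #|below_median w :&: L| = j].
Proof.
rewrite (_ : [set w | _] = [set w | below_median w \in
    enum [set S : {set J} | #|S :&: L| == j]%SET]).
  by apply: measurable_fiber_in; exact: measurable_below_median_eq.
apply/seteqP; split => w /=; rewrite mem_enum inE; first by move=> ->.
by move/eqP.
Qed.

Lemma below_median_hypergeometric (L : {set J}) :
  hypergeometric_weights #|L| #|~: L| r
    (fun j => fine (P [set w | #|below_median w :&: L| = j])).
Proof.
have [p0 p00 PE] := prob_below_median_card L.
split.
- by move=> j; apply: fine_ge0; exact: measure_ge0.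
- apply: EFin_inj; rewrite -sumEFin.
  rewrite (eq_bigr (fun j : 'I_#|L|.+1 => P [set w | #|below_median w :&: L| = j])).
    rewrite -(big_mkord xpredT (fun j => P [set w | #|below_median w :&: L| = j])).
    rewrite -measure_fiber_in ?iota_uniq //; last exact: measurable_below_median_card.
    rewrite (_ : [set w | _] = setT); first exact: probability_setT.
    rewrite -subTset => w _ /=.
    by rewrite mem_index_iota /= ltnS subset_leq_card // finset.subsetIr.
  move=> j _; rewrite fineK // fin_num_measure //.
  exact: measurable_below_median_card.
- move=> j; rewrite !PE /= !card_two_color_draws.
  case: (ltngtP j r) => [jr|rj|->].
  + have [k rE] : exists k, r = (j + k.+1)%N by exists (r - j).-1; lia.
    have -> : (r - j = k.+1)%N by lia.
    have -> : (r - j.+1 = k)%N by lia.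
    (* The truncated difference [r - j] in the count of draws is [k + 1]. *)
    have nk : #|~: L|%:R - r%:R + j.+1%:R = #|~: L|%:R - k%:R :> R.
      by rewrite rE natrD -[j.+1]addn1 -[k.+1]addn1 !natrD; ring.
    have rj : r%:R - j%:R = k.+1%:R :> R by rewrite rE natrD; ring.
    have b1 := bin_stepR R #|L| j; have b2 := bin_stepR R #|~: L| k.
    rewrite nk rj !natrM.
    transitivity (p0 * ((#|L|%:R - j%:R) * 'C(#|L|, j)%:R) *
      (k.+1%:R * 'C(#|~: L|, k.+1)%:R)); first by ring.
    by rewrite b1 -b2; ring.
  + by rewrite !mulr0.
  + by rewrite subrr mulr0 mul0r mulr0 mulr0.
Qed.

End below_median.

(** * Second moments by leaving out observations *)

(** If [x] lies below one of the two statistics they coincide, by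
    [order_statistic_cons_eq]; otherwise both arguments of [score] are
    nonpositive. *)
Lemma order_statistic_leave_one (R : realType) (score phi : R -> R) x (s : seq R) r :
  (forall t, t <= 0 -> score t = 0) -> (0 < r <= size s)%N ->
  phi (order_statistic (x :: s) r.+1) * score (order_statistic (x :: s) r.+1 - x) =
  phi (order_statistic s r) * score (order_statistic s r - x).
Proof.
move=> score0 rs.
have [xZ|Zx] := ltP x (order_statistic (x :: s) r.+1).
  by rewrite (order_statistic_cons_eq rs) // xZ.
have [xa|ax] := ltP x (order_statistic s r).
  by rewrite (order_statistic_cons_eq rs) // xa orbT.
by rewrite !score0 ?mulr0 // subr_le0.
Qed.

Section second_moment.
Context d (T : measurableType d) (R : realType) (P : probability T R).
Context (I : choiceType) (W : I -> {RV P >-> R}) (F : R -> R).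
Hypothesis indepW : mutually_independent W.
Hypothesis cdfW : forall i x, cdf (W i) x = (F x)%:E.
Context (score phi : R -> R) (C beta gamma : R).
Hypothesis measurable_score : measurable_fun setT score.
Hypothesis mphi : measurable_fun setT phi.
Hypothesis score_bound : forall t, `|score t| <= C.
Hypothesis score_le0 : forall t, t <= 0 -> score t = 0.
Hypothesis gamma_ge0 : 0 <= gamma.
Hypothesis phi01 : forall a, 0 <= phi a <= 1.

Let G i a : R := (\int[distribution P (W i)]_x score (a - x)).

Hypothesis G_bound : forall i a, phi a != 0 -> `|G i a| <= beta.
Hypothesis G2_bound : forall i a, phi a != 0 ->
  (\int[distribution P (W i)]_x (score (a - x) ^+ 2)%:E <= gamma%:E)%E.

Lemma score_bound_ge0 : 0 <= C. Proof. by apply: le_trans (score_bound 0). Qed.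

Lemma bounded_integrable d0 (S : measurableType d0) (Q : probability S R)
    (f : S -> R) (M : R) : measurable_fun setT f -> (forall z, `|f z| <= M) ->
  Q.-integrable setT (EFin \o f).
Proof.
move=> mf fM; apply: measurable_bounded_integrable => //.
  by apply: (le_lt_trans (probability_le1 Q measurableT)); exact: ltry.
exists M; split; first exact: num_real.
by move=> x Mx y _; apply: (le_trans (fM y)); exact: ltW.
Qed.

Lemma score_meanE i a : (\int[distribution P (W i)]_x (score (a - x))%:E)%E = (G i a)%:E.
Proof.
rewrite /G /Rintegral fineK //; apply: integrable_fin_num => //.
apply: (@bounded_integrable _ _ (distribution P (W i)) (fun x => score (a - x)) C) => //.
by apply: measurableT_comp => //; exact: measurable_funB.
Qed.

Lemma measurable_score_gap : measurable_fun setT (fun z : R * R => score (z.1 - z.2)).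
Proof.
by apply: measurableT_comp => //; apply: measurable_funB;
  [exact: measurable_fst|exact: measurable_snd].
Qed.

Lemma measurable_score_mean i : measurable_fun setT (G i).
Proof.
have := @measurable_fubini_F _ _ _ _ R (distribution P (W i)) (distribution P (W i))
  (EFin \o (fun z : R * R => score (z.1 - z.2))).
rewrite (_ : fubini_F _ _ = EFin \o G i); last by apply/funext => a; exact: score_meanE.
move=> H; apply/measurable_EFinP; apply: H.
refine (@bounded_integrable _ _ (distribution P (W i) \x distribution P (W i))%E
  _ C measurable_score_gap _) => z.
exact: score_bound.
Qed.

Lemma score_mean_bound i a : `|G i a| <= C.
Proof.
rewrite -lee_fin -abse_EFin -score_meanE.
apply: (le_trans (le_abse_integral _ _ _)) => //.
  by apply/measurable_EFinP; apply: measurableT_comp => //; exact: measurable_funB.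
apply: (@le_trans _ _ (\int[distribution P (W i)]_x C%:E)%E).
  apply: ge0_le_integral => //.
  - by apply/measurable_EFinP; apply: measurableT_comp => //;
      apply: measurableT_comp => //; exact: measurable_funB.
  - by move=> x _; rewrite lee_fin.
rewrite integral_cst // -[leRHS]mule1; apply: lee_wpmul2l.
  by rewrite lee_fin score_bound_ge0.
exact: (probability_le1 (distribution P (W i)) measurableT).
Qed.

Lemma integral_le_cst (f : T -> R) (M : R) : measurable_fun setT f ->
  (forall w, f w <= M) -> (exists B, forall w, `|f w| <= B) ->
  (\int[P]_w (f w)%:E <= M%:E)%E.
Proof.
move=> mf fM [B fB].
have cM : (\int[P]_w M%:E = M%:E)%E.
  rewrite integral_cst // -[RHS]mule1; congr (_ * _)%E; exact: probability_setT.
rewrite -[leRHS]cM; apply: le_integral => //.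
- exact: (@bounded_integrable _ _ P f B).
- apply: (@bounded_integrable _ _ P (cst M) `|M|) => // z.
- by move=> w _; rewrite lee_fin.
Qed.

Lemma weighted_sq_bound p u : 0 <= p <= 1 -> `|u| <= C -> `|p * u ^+ 2| <= C ^+ 2.
Proof.
move=> /andP[p0 p1] uC.
rewrite ger0_norm; last by apply: mulr_ge0 => //; exact: sqr_ge0.
have h1 : p * u ^+ 2 <= u ^+ 2 by rewrite ler_piMl ?sqr_ge0.
apply: (le_trans h1); rewrite -real_normK ?num_real //.
by rewrite ler_pXn2r ?nnegrE ?score_bound_ge0.
Qed.

(** After [order_statistic_leave_one] the statistic is independent of [W i], and
    the integral over [W i] with the statistic fixed is at most [gamma] where
    [phi] does not vanish. *)
Lemma second_moment_diag i (s : seq I) r : uniq (i :: s) -> (0 < r <= size s)%N ->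
  forall Z : {RV P >-> R}, Z = sample_order_statistic W (i :: s) r.+1 ->
  (\int[P]_w (phi (Z w) * (score (Z w - W i w)) ^+ 2)%:E <= gamma%:E)%E.
Proof.
move=> uis rs _ ->; set Z := sample_order_statistic _ _ _; pose a := sample_order_statistic W s r.
have rs' w : (0 < r <= size [seq W l w | l <- s])%N by rewrite size_map.
have -> : (fun w => (phi (Z w) * (score (Z w - W i w)) ^+ 2)%:E) =
    (fun w => (phi (a w) * (score (a w - W i w)) ^+ 2)%:E).
  apply/funext => w; congr EFin.
  apply: (@order_statistic_leave_one _ (fun t => score t ^+ 2) phi (W i w) _ r _ (rs' w)).
  by move=> t t0; rewrite score_le0 // expr0n.
pose psi (z : R * R) := phi z.1 * score (z.1 - z.2) ^+ 2.
have mpsi : measurable_fun setT psi.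
  apply: measurable_funM; first by apply: measurableT_comp => //; exact: measurable_fst.
  by apply: measurable_funX; exact: measurable_score_gap.
have := @integral_independent_pair _ _ _ P _ _ _ _ a (W i) psi (C ^+ 2)
  (independent_order_statistic1 indepW cdfW uis rs) mpsi.
rewrite /psi /= => -> //; last by move=> z; exact: weighted_sq_bound.
pose H u : R := \int[distribution P (W i)]_v (psi (u, v)).
have psi_int u : (distribution P (W i)).-integrable setT (EFin \o (fun v => psi (u, v))).
  apply: (@bounded_integrable _ _ (distribution P (W i)) (fun v => psi (u, v)) (C ^+ 2)).
    exact: (measurable_fun_pair2 u mpsi).
  by move=> v; exact: weighted_sq_bound.
have HE u : (\int[distribution P (W i)]_v (psi (u, v))%:E)%E = (H u)%:E.
  by rewrite /H /Rintegral fineK //; exact: (integrable_fin_num _ (psi_int u)).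
have mH : measurable_fun setT H.
  have := @measurable_fubini_F _ _ _ _ R (distribution P (W i)) (distribution P (W i))
    (EFin \o psi).
  rewrite (_ : fubini_F _ _ = EFin \o H); last by apply/funext => u; exact: HE.
  move=> h; apply/measurable_EFinP; apply: h.
  apply: (@bounded_integrable _ _ (distribution P (W i) \x distribution P (W i))%E
    psi (C ^+ 2) mpsi) => z.
  exact: weighted_sq_bound.
have H0 u : 0 <= H u.
  by rewrite -lee_fin -HE; apply: integral_ge0 => v _;
    rewrite lee_fin mulr_ge0 ?sqr_ge0 //; case/andP: (phi01 u).
have Hg u : H u <= gamma.
  rewrite -lee_fin -HE; have [p0|p0] := eqVneq (phi u) 0.
    rewrite integral0_eq ?lee_fin // => v _; by rewrite /psi /= p0 mul0r.
  apply: (le_trans _ (@G2_bound i u p0)); apply: ge0_le_integral => //.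
  - by move=> v _; rewrite lee_fin mulr_ge0 ?sqr_ge0 //; case/andP: (phi01 u).
  - by apply/measurable_EFinP; exact: (measurable_fun_pair2 u mpsi).
  - by apply/measurable_EFinP; apply: measurable_funX;
      apply: measurableT_comp => //; exact: measurable_funB.
  - by move=> v _; rewrite lee_fin ler_piMl ?sqr_ge0 //; case/andP: (phi01 u).
rewrite (eq_integral (fun w => (H (a w))%:E)); last by move=> w _; rewrite -HE.
apply: integral_le_cst => //; first exact: measurableT_comp.
by exists gamma => w; rewrite ger0_norm.
Qed.

(** Removing [W i] and [W j] one after the other leaves a statistic [a] such
    that [a], [W i] and [W j] are independent; integrating out both
    observations gives [phi a * G i a * G j a]. *)
Lemma second_moment_offdiag i j (s : seq I) r : uniq (i :: j :: s) ->
  (0 < r <= size s)%N ->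
  forall Z : {RV P >-> R}, Z = sample_order_statistic W (i :: j :: s) r.+2 ->
  (\int[P]_w (phi (Z w) * score (Z w - W i w) * score (Z w - W j w))%:E
    <= (beta ^+ 2)%:E)%E.
Proof.
move=> uijs rs _ ->; set Z := sample_order_statistic _ _ _; pose a := sample_order_statistic W s r.
have -> : (fun w => (phi (Z w) * score (Z w - W i w) * score (Z w - W j w))%:E) =
    (fun w => (phi (a w) * score (a w - W j w) * score (a w - W i w))%:E).
  apply/funext => w; congr EFin.
  pose x := W i w; pose y := W j w; pose l := [seq W q w | q <- s].
  have rs1 : (0 < r <= size l)%N by rewrite size_map.
  have rs2 : (0 < r.+1 <= size (y :: l))%N by case/andP: rs1.
  have h1 := order_statistic_leave_one (fun z => phi z * score (z - y)) x score_le0 rs2.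
  have h2 := order_statistic_leave_one (fun z => phi z * score (z - x)) y score_le0 rs1.
  transitivity (phi (order_statistic (x :: y :: l) r.+2) *
     score (order_statistic (x :: y :: l) r.+2 - y) *
     score (order_statistic (x :: y :: l) r.+2 - x)); first by rewrite mulrAC.
  by rewrite h1 mulrAC h2 mulrAC.
have mpair : measurable_fun setT (fun w => (a w, W j w)).
  exact: measurable_fun_pair.
pose U : {mfun T >-> (R * R)%type} := HB.pack (fun w => (a w, W j w))
  (isMeasurableFun.Build _ _ _ _ _ mpair).
have indU : independent_pair P U (W i).
  apply: independent_pair_rect => A B D mA mB mD.
  exact: (independent_order_statistic2 indepW cdfW uijs rs mA mD mB).
pose psi (z : (R * R) * R) := phi z.1.1 * score (z.1.1 - z.1.2) * score (z.1.1 - z.2).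
have m11 : measurable_fun setT (fun z : (R * R) * R => z.1.1).
  exact: (measurableT_comp measurable_fst measurable_fst).
have m12 : measurable_fun setT (fun z : (R * R) * R => z.1.2).
  exact: (measurableT_comp measurable_snd measurable_fst).
have mpsi : measurable_fun setT psi.
  apply: measurable_funM.
    apply: measurable_funM; first exact: measurableT_comp.
    by apply: measurableT_comp => //; exact: measurable_funB.
  by apply: measurableT_comp => //; apply: measurable_funB => //; exact: measurable_snd.
have bound3 p u v : 0 <= p <= 1 -> `|u| <= C -> `|v| <= C -> `|p * u * v| <= C ^+ 2.
  move=> /andP[p0 p1] uC vC; rewrite !normrM (ger0_norm p0) expr2.
  by rewrite ler_pM ?mulr_ge0 // -[C]mul1r ler_pM.
have := @integral_independent_pair _ _ _ P _ _ _ _ U (W i) psi (C ^+ 2) indU mpsi.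
rewrite /psi /= => -> //; last by move=> z; exact: bound3.
have inner w : (\int[distribution P (W i)]_v
    (phi (a w) * score (a w - W j w) * score (a w - v))%:E)%E =
    (phi (a w) * G i (a w) * score (a w - W j w))%:E.
  under eq_integral do rewrite EFinM.
  rewrite integralZl //; last first.
    apply: (@bounded_integrable _ _ (distribution P (W i)) (fun x => score (a w - x)) C) => //.
    by apply: measurableT_comp => //; exact: measurable_funB.
  by rewrite score_meanE -EFinM mulrAC.
rewrite (eq_integral (fun w => (phi (a w) * G i (a w) * score (a w - W j w))%:E)); last first.
  by move=> w _; exact: inner.
pose psi2 (z : R * R) := phi z.1 * G i z.1 * score (z.1 - z.2).
have mpsi2 : measurable_fun setT psi2.
  apply: measurable_funM; last exact: measurable_score_gap.
  apply: measurable_funM; apply: measurableT_comp => //; try exact: measurable_fst.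
  exact: measurable_score_mean.
have ujs : uniq (j :: s) by case/andP: uijs.
have := @integral_independent_pair _ _ _ P _ _ _ _ a (W j) psi2 (C ^+ 2)
  (independent_order_statistic1 indepW cdfW ujs rs) mpsi2.
rewrite /psi2 /= => -> //; last by move=> z; apply: bound3 => //; exact: score_mean_bound.
rewrite (eq_integral (fun w => (phi (a w) * G i (a w) * G j (a w))%:E)); last first.
  move=> w _; under eq_integral do rewrite EFinM.
  rewrite integralZl //; last first.
    apply: (@bounded_integrable _ _ (distribution P (W j)) (fun x => score (a w - x)) C) => //.
    by apply: measurableT_comp => //; exact: measurable_funB.
  by rewrite score_meanE -EFinM.
have key w : `|phi (a w) * G i (a w) * G j (a w)| <= beta ^+ 2.
  have [->|p0] := eqVneq (phi (a w)) 0; first by rewrite !mul0r normr0 sqr_ge0.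
  have /andP[q0 q1] := phi01 (a w).
  rewrite !normrM (ger0_norm q0) expr2.
  apply: ler_pM; rewrite ?mulr_ge0 ?G_bound //.
  by rewrite -[beta]mul1r ler_pM ?G_bound.
apply: integral_le_cst.
- apply: measurable_funM; last by apply: measurableT_comp => //; exact: measurable_score_mean.
  by apply: measurable_funM; apply: measurableT_comp => //; exact: measurable_score_mean.
- by move=> w; apply: le_trans (key w); exact: ler_norm.
- by exists (beta ^+ 2).
Qed.

Lemma sum_const_seq (s : seq I) (x : R) : \sum_(i <- s) x = (size s)%:R * x.
Proof. by rewrite big_const_seq count_predT iter_addr_0 mulr_natl. Qed.

Lemma sample_order_statistic_perm (idx idx' : seq I) r : perm_eq idx idx' ->
  forall w, sample_order_statistic W idx r w = sample_order_statistic W idx' r w.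
Proof. by move=> p w; apply: order_statistic_perm; exact: perm_map. Qed.

(** Expand the square: at most [size s] diagonal terms and [size s ^ 2] other
    ones. *)
Lemma second_moment_sum (idx s : seq I) r : uniq idx -> uniq s ->
  {subset s <= idx} -> size idx = r.*2.+1 -> (1 < r)%N ->
  let Z := sample_order_statistic W idx r.+1 in
  ((\int[P]_w (phi (Z w) * (\sum_(i <- s) score (Z w - W i w)) ^+ 2)%:E)
    <= ((size s)%:R * gamma + (size s)%:R ^+ 2 * beta ^+ 2)%:E)%E.
Proof.
move=> uidx us sub szi r1; have r0 : (0 < r)%N by exact: ltnW.
have rr : (r <= r.*2)%N by rewrite -addnn leq_addr.
have rE : r.-1.+2 = r.+1 by rewrite prednK.
have rr2 : (0 < r.-1 <= r.*2.-1)%N.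
  by rewrite -ltnS prednK // r1 -!subn1 leq_sub2r.
cbv zeta; set Z := sample_order_statistic W idx r.+1.
pose f i j w := phi (Z w) * score (Z w - W i w) * score (Z w - W j w).
have mf i j : measurable_fun setT (f i j).
  apply: measurable_funM; last first.
    by apply: measurableT_comp => //; exact: measurable_funB.
  apply: measurable_funM; first exact: measurableT_comp.
  by apply: measurableT_comp => //; exact: measurable_funB.
have fbound i j w : `|f i j w| <= C ^+ 2.
  have /andP[p0 p1] := phi01 (Z w); rewrite /f !normrM (ger0_norm p0) expr2.
  by rewrite ler_pM ?mulr_ge0 // -[C]mul1r ler_pM.
have intf i j : P.-integrable setT (EFin \o f i j).
  exact: (@bounded_integrable _ _ P (f i j) (C ^+ 2)).
have term i j : i \in s -> j \in s ->
    (\int[P]_w (f i j w)%:E <= (if i == j then gamma else beta ^+ 2)%:E)%E.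
  move=> is_ js; have iidx := sub _ is_; have jidx := sub _ js.
  have p1 := perm_to_rem iidx.
  have u1 : uniq (i :: rem i idx) by rewrite -(perm_uniq p1).
  have s1 : size (rem i idx) = r.*2 by rewrite size_rem // szi.
  case: eqVneq => [<-|ij].
    have := @second_moment_diag i (rem i idx) r u1 _ _ erefl.
    rewrite (_ : (fun w => _) = (fun w => (f i i w)%:E)); last first.
      by apply/funext => w; rewrite /f -(sample_order_statistic_perm _ p1) expr2 mulrA.
    by apply; rewrite s1 r0.
  have jr : j \in rem i idx by rewrite (mem_rem_uniq _ uidx) !inE eq_sym ij jidx.
  have p2 : perm_eq idx (i :: j :: rem j (rem i idx)).
    by apply: (perm_trans p1); rewrite perm_cons perm_to_rem.
  have u2 : uniq (i :: j :: rem j (rem i idx)) by rewrite -(perm_uniq p2).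
  have s2 : size (rem j (rem i idx)) = r.*2.-1 by rewrite size_rem // s1.
  have := @second_moment_offdiag i j (rem j (rem i idx)) r.-1 u2 _ _ erefl.
  rewrite (_ : (fun w => _) = (fun w => (f i j w)%:E)); last first.
    by apply/funext => w; rewrite -(sample_order_statistic_perm _ p2) rE.
  by apply; rewrite s2.
rewrite (eq_integral (fun w => \sum_(i <- s) \sum_(j <- s) (f i j w)%:E)%E); last first.
  move=> w _; under [RHS]eq_bigr do rewrite sumEFin.
  rewrite sumEFin expr2 big_distrlr /= mulr_sumr; congr EFin; apply: eq_bigr => i _.
  by rewrite mulr_sumr; apply: eq_bigr => j _; rewrite /f mulrA.
rewrite integral_sum //; last by move=> i; apply: integrable_sum => // j _; exact: intf.
rewrite (eq_bigr (fun i => \sum_(j <- s) \int[P]_w (f i j w)%:E)%E); last first.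
  by move=> i _; rewrite integral_sum //; move=> j; exact: intf.
apply: (@le_trans _ _ (\sum_(i <- s) \sum_(j <- s)
    (if i == j then gamma else beta ^+ 2)%:E)%E).
  rewrite [leLHS]big_seq [leRHS]big_seq; apply: lee_sum => i is_.
  rewrite [leLHS]big_seq [leRHS]big_seq; apply: lee_sum => j js.
  exact: term.
under eq_bigr do rewrite sumEFin.
rewrite sumEFin lee_fin.
apply: (le_trans (y := \sum_(i <- s) (gamma + (size s)%:R * beta ^+ 2))); last first.
  by rewrite sum_const_seq mulrDr expr2 mulrA.
rewrite [leLHS]big_seq [leRHS]big_seq; apply: ler_sum => i is_.
rewrite (bigD1_seq i) //= eqxx lerD2l.
apply: (le_trans (y := \sum_(j <- s) beta ^+ 2)); last first.
  by rewrite sum_const_seq.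
rewrite big_mkcond; apply: ler_sum => j _; rewrite eq_sym.
by case: eqVneq => // _; rewrite sqr_ge0.
Qed.

End second_moment.

(** * The smoothing error of a one-sided kernel *)

Section tail_integral.
Context {R : realType}.
Notation mu := (@lebesgue_measure R).
Implicit Types (kappa : R -> R) (t u : R).

Definition tail_window t u : R := ((0 < t) && (t < u))%:R.

(** The integral of [kappa] over [`]t, +oo[] if [t > 0], and zero otherwise.
    As an integral over the whole line of a function of [t] and [u] it is in
    the form to which Fubini's theorem applies. *)
Definition tail_integral kappa t : R := \int[mu]_u (kappa u * tail_window t u).

Lemma tail_window01 t u : 0 <= tail_window t u <= 1.
Proof. by rewrite /tail_window ler0n lern1 leq_b1. Qed.

Lemma measurable_tail_window d (T : measurableType d) (f g : T -> R) :
  measurable_fun setT f -> measurable_fun setT g ->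
  measurable_fun setT (fun x => tail_window (f x) (g x)).
Proof.
move=> mf mg.
have mD : measurable ([set x | cst 0 x < f x] `&` [set x | f x < g x]).
  by apply: measurableI; exact: measurable_lt_set.
rewrite (_ : (fun x => _) = \1_([set x | cst 0 x < f x] `&` [set x | f x < g x])).
  exact: measurable_indic.
apply/funext => x; rewrite indicE /tail_window; congr (_%:R); congr nat_of_bool.
by apply/andP/idP; rewrite inE.
Qed.

Lemma integrable_tail kappa t : mu.-integrable setT (EFin \o kappa) ->
  mu.-integrable setT (EFin \o (fun u => kappa u * tail_window t u)).
Proof.
move=> ik; have /integrableP[/measurable_EFinP mk _] := ik.
apply: (le_integrable measurableT _ _ ik).
  apply/measurable_EFinP; apply: measurable_funM => //.
  exact: measurable_tail_window.
move=> u _ /=; rewrite lee_fin normrM ler_piMr //.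
by have /andP[w0 w1] := tail_window01 t u; rewrite ger0_norm.
Qed.

Lemma tail_integralE kappa t : mu.-integrable setT (EFin \o kappa) ->
  (tail_integral kappa t)%:E = (\int[mu]_u (kappa u * tail_window t u)%:E)%E.
Proof.
move=> ik; rewrite /tail_integral /Rintegral fineK //.
exact: (integrable_fin_num _ (integrable_tail t ik)).
Qed.

Lemma tail_integral_le0 kappa t : t <= 0 -> tail_integral kappa t = 0.
Proof.
move=> t0; rewrite /tail_integral /Rintegral integral0_eq // => u _.
by rewrite /tail_window ltNge t0 mulr0.
Qed.

Lemma tail_integral_abs kappa t : mu.-integrable setT (EFin \o kappa) ->
  `|tail_integral kappa t| <= tail_integral (fun u => `|kappa u|) t.
Proof.
move=> ik; have it := integrable_tail t ik.
have ia : mu.-integrable setT (EFin \o (fun u => `|kappa u|)).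
  exact: (integrable_norm ik).
have := le_normr_Rintegral measurableT it.
rewrite /tail_integral => /le_trans; apply.
rewrite le_eqVlt; apply/orP; left; apply/eqP; apply: eq_Rintegral => u _.
by rewrite normrM [`|tail_window _ _|]ger0_norm //; case/andP: (tail_window01 t u).
Qed.

Lemma tail_integral_le kappa t : mu.-integrable setT (EFin \o kappa) ->
  `|tail_integral kappa t| <= \int[mu]_u `|kappa u|.
Proof.
move=> ik; apply: (le_trans (tail_integral_abs t ik)).
have ia : mu.-integrable setT (EFin \o (fun u => `|kappa u|)).
  exact: (integrable_norm ik).
apply: le_Rintegral => //; first exact: integrable_tail.
by move=> u _; rewrite ler_piMr //; case/andP: (tail_window01 t u).
Qed.

Section fubini.
Variables (Q : probability R R) (F : R -> R).
Hypothesis QF : forall c, Q `]-oo, c]%classic = (F c)%:E.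
Hypothesis Q0 : forall x, Q [set x] = 0%E.

Lemma prob_open_interval a b : a < b -> Q `]a, b[%classic = (F b - F a)%:E.
Proof.
move=> ab.
have Qco : Q `]-oo, b[%classic = (F b)%:E.
  rewrite -QF; have -> : `]-oo, b]%classic = (`]-oo, b[ `|` [set b])%classic.
    apply/seteqP; split => x /=; rewrite !in_itv /= le_eqVlt.
      by case/orP => [/eqP ->|]; [right|left].
    by case=> [->|->]; rewrite ?orbT ?eqxx.
  by apply/esym; apply: measureU0; [exact: measurable_itv|exact: measurable_set1|exact: Q0].
have Qfin (A : set R) : measurable A -> (Q A < +oo)%E.
  by move=> mA; apply: (le_lt_trans (probability_le1 Q mA)); exact: ltry.
have -> : `]a, b[%classic = (`]-oo, b[ `\` `]-oo, a])%classic.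
  apply/seteqP; split => x /=; rewrite !in_itv /=.
    by case/andP => ax ->; split => //; apply/negP; rewrite -ltNge.
  by case=> -> /negP; rewrite -ltNge => ->.
have E : (`]-oo, b[ `&` `]-oo, a])%classic = `]-oo, a]%classic.
  apply/seteqP; split => x /=; rewrite !in_itv /=; first by case.
  by move=> xa; split => //; exact: le_lt_trans ab.
transitivity (Q `]-oo, b[%classic - Q `]-oo, a]%classic)%E.
  by rewrite measureD ?E //; exact: Qfin.
by rewrite Qco QF.
Qed.

Variables (kappa : R -> R).
Hypothesis ik : mu.-integrable setT (EFin \o kappa).
Hypothesis kappa0 : forall u, u <= 0 -> kappa u = 0.

Let integrable_prod (t : R -> R) : measurable_fun setT t ->
  (Q \x mu)%E.-integrable setT
    (EFin \o (fun z : R * R => kappa z.2 * tail_window (t z.1) z.2)).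
Proof.
move=> mt; have /integrableP[/measurable_EFinP mk kfin] := ik.
have mf : measurable_fun setT (fun z : R * R => kappa z.2 * tail_window (t z.1) z.2).
  apply: measurable_funM; first by apply: measurableT_comp => //; exact: measurable_snd.
  apply: measurable_tail_window; last exact: measurable_snd.
  by apply: measurableT_comp => //; exact: measurable_fst.
have idom : (Q \x mu)%E.-integrable setT (EFin \o (fun z : R * R => kappa z.2)).
  apply/(integrable12ltyP Q mu).
    by apply/measurable_EFinP; apply: measurableT_comp => //; exact: measurable_snd.
  rewrite /= integral_cst // (le_lt_trans _ kfin) //.
  rewrite -[leRHS]mule1; apply: lee_wpmul2l; first exact: integral_ge0.
  exact: (probability_le1 Q measurableT).
apply: (le_integrable measurableT _ _ idom); first exact/measurable_EFinP.
move=> z _ /=; rewrite lee_fin normrM ler_piMr //.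
by have /andP[w0 w1] := tail_window01 (t z.1) z.2; rewrite ger0_norm.
Qed.

(** Measurability of a partial integral, from Fubini's theorem for the product
    with any probability [Q]. *)
Lemma measurable_tail_integral : measurable_fun setT (tail_integral kappa).
Proof.
have := measurable_fubini_F (integrable_prod (@measurable_id _ R setT)).
rewrite (_ : fubini_F _ _ = EFin \o tail_integral kappa).
  by move/measurable_EFinP.
by apply/funext => t; rewrite /= tail_integralE.
Qed.

(** Exchange the integrals: for given [u > 0], the window [0 < (a - x) / h < u]
    is the interval [a - h u < x < a], of mass [F a - F (a - h u)]. *)
Lemma integral_tail_integral (a h : R) : 0 < h ->
  (\int[Q]_x (tail_integral kappa ((a - x) / h))%:E =
   \int[mu]_u (kappa u * (F a - F (a - h * u)))%:E)%E.
Proof.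
move=> h0; pose t x := (a - x) / h.
have mt : measurable_fun setT t.
  by apply: measurable_funM => //; exact: measurable_funB.
have ip := integrable_prod mt.
transitivity (\int[Q]_x \int[mu]_u (kappa u * tail_window (t x) u)%:E)%E.
  by apply: eq_integral => x _; rewrite tail_integralE.
rewrite (Fubini ip) /=; apply: eq_integral => u _.
under eq_integral do rewrite EFinM.
have mw : measurable_fun setT (fun x => tail_window (t x) u).
  exact: measurable_tail_window.
rewrite integralZl //; last first.
  apply: measurable_bounded_integrable => //.
    by apply: (le_lt_trans (probability_le1 Q measurableT)); exact: ltry.
  exists 1; split; first exact: num_real.
  move=> x x1 y _ /=; have /andP[w0 w1] := tail_window01 (t y) u.
  by rewrite ger0_norm // (le_trans w1) // ltW.
have [u0|u0] := leP u 0; first by rewrite kappa0 // mul0e mul0r.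
rewrite EFinM; congr (_ * _)%E.
have ha : a - h * u < a by rewrite gtrBl mulr_gt0.
rewrite -prob_open_interval // -[X in Q X]setIT -integral_indic //.
apply: eq_integral => x _; rewrite /tail_window indicE; congr ((_ : bool)%:R)%:E.
have -> : (0 < t x) = (x < a) by rewrite /t pmulr_lgt0 ?invr_gt0 // subr_gt0.
have -> : (t x < u) = (a - h * u < x) by rewrite /t ltr_pdivrMr // !ltrBlDr [u * h]mulrC [_ + x]addrC.
by apply/idP/idP; rewrite inE /= in_itv /= andbC.
Qed.

End fubini.
End tail_integral.

Lemma RintegralK d (T : measurableType d) (R : realType)
    (m : {measure set T -> \bar R}) (f : T -> R) :
  m.-integrable setT (EFin \o f) ->
  (\int[m]_u f u)%:E = (\int[m]_u (f u)%:E)%E.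
Proof. by move=> i_f; rewrite /Rintegral fineK //; exact: (integrable_fin_num _ i_f). Qed.

Lemma Rintegral_dominated (R : realType) (f g : R -> R) (c : R) :
  measurable_fun setT f ->
  (@lebesgue_measure R).-integrable setT (EFin \o g) -> 0 <= c ->
  (forall u, `|f u| <= c * `|g u|) ->
  (@lebesgue_measure R).-integrable setT (EFin \o f) /\
  `|\int[lebesgue_measure]_u f u| <= c * \int[lebesgue_measure]_u `|g u|.
Proof.
move=> mf ig c0 fg.
have ia : (@lebesgue_measure R).-integrable setT (EFin \o (fun u => `|g u|)).
  exact: (integrable_norm ig).
have ica : (@lebesgue_measure R).-integrable setT (EFin \o (fun u => c * `|g u|)).
  have := integrableZl measurableT c ia.
  by apply: eq_integrable => // u _; rewrite /= EFinM.
have i_f : (@lebesgue_measure R).-integrable setT (EFin \o f).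
  apply: (le_integrable measurableT _ _ ica); first exact/measurable_EFinP.
  by move=> u _ /=; rewrite lee_fin; apply: (le_trans (fg u)); exact: ler_norm.
have E : c * \int[lebesgue_measure]_u `|g u| = \int[lebesgue_measure]_u (c * `|g u|).
  by rewrite (RintegralZl _ measurableT ia).
split; first exact: i_f.
rewrite E; apply: (le_trans (le_normr_Rintegral measurableT i_f)).
by apply: le_Rintegral => //; exact: (integrable_norm i_f).
Qed.

Section kernel.
Context {R : realType} (k : R -> R).
Notation mu := (@lebesgue_measure R).
Hypothesis hk : one_sided_kernel k.

Definition smoothing_error (t : R) : R := kernel_primitive k t - (0 < t)%R%:R.

Lemma kernel_integrable : mu.-integrable setT (EFin \o k).
Proof. by case: hk. Qed.

Lemma kernel_le0 t : t <= 0 -> k t = 0.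
Proof. by case: hk => _ + _; apply. Qed.

Lemma kernel_total : \int[mu]_u k u = 1.
Proof.
case: hk => _ _ <-; rewrite [RHS]Rintegral_mkcond; apply: eq_Rintegral => u _.
rewrite patchE; case: ifP => // /negbT; rewrite notin_setE /= in_itv /= andbT.
by move=> /negP; rewrite -ltNge => u0; rewrite kernel_le0 // ltW.
Qed.

(** Since [k] has total mass one, on the positive side the primitive falls short
    of one by the integral over the tail. *)
Lemma smoothing_errorE t :
  smoothing_error t = tail_integral (fun u => - k u) t.
Proof.
rewrite /smoothing_error; have [t0|t0] := leP t 0.
  rewrite tail_integral_le0 // subr0 /kernel_primitive /Rintegral integral0_eq //.
  move=> u; rewrite /= in_itv /= => ut; rewrite kernel_le0 //; exact: le_trans t0.
have tot : kernel_primitive k t + \int[mu]_(u in `]t, +oo[) k u = 1.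
  rewrite -kernel_total /kernel_primitive.
  have TU : [set: R] = (`]-oo, t] `|` `]t, +oo[)%classic.
    apply/esym; rewrite -subTset => x _ /=; rewrite !in_itv /= andbT.
    by have [xt|xt] := leP x t; [left|right].
  rewrite [in RHS]TU Rintegral_setU //.
  - by rewrite -TU; exact: kernel_integrable.
  - apply/disj_setPRL => x /=; rewrite !in_itv /= andbT => tx.
    by apply/negP; rewrite -ltNge.
have it : mu.-integrable `]t, +oo[ (EFin \o k).
  exact: (integrableS measurableT _ _ kernel_integrable).
rewrite -tot opprD addrA subrr add0r -[LHS]mulN1r -(RintegralZl _ _ it) //.
rewrite Rintegral_mkcond; apply: eq_Rintegral => u _; rewrite patchE /tail_window t0 /=.
case: ifPn; first by rewrite inE /= in_itv /= andbT => ->; rewrite mulr1 mulN1r.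
by rewrite notin_setE /= in_itv /= andbT => /negP/negbTE ->; rewrite mulr0.
Qed.

Let A0 : R := \int[mu]_u `|k u|.

Lemma kernelN_integrable : mu.-integrable setT (EFin \o (fun u => - k u)).
Proof.
have := integrableN kernel_integrable.
by apply: eq_integrable => // u _ /=.
Qed.

Lemma kernelN_le0 u : u <= 0 -> - k u = 0.
Proof. by move=> u0; rewrite kernel_le0 // oppr0. Qed.

Lemma kernel_norm_integrable : mu.-integrable setT (EFin \o (fun u => `|k u|)).
Proof. exact: (integrable_norm kernel_integrable). Qed.

Lemma smoothing_error_le0 t : t <= 0 -> smoothing_error t = 0.
Proof. by move=> t0; rewrite smoothing_errorE tail_integral_le0. Qed.

Lemma smoothing_error_bound t : `|smoothing_error t| <= A0.
Proof.
rewrite smoothing_errorE (le_trans (tail_integral_le t kernelN_integrable)) //.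
rewrite le_eqVlt; apply/orP; left; apply/eqP; apply: eq_Rintegral => u _.
by rewrite normrN.
Qed.

Lemma smoothing_error_tail t :
  `|smoothing_error t| <= tail_integral (fun u => `|k u|) t.
Proof.
rewrite smoothing_errorE (le_trans (tail_integral_abs t kernelN_integrable)) //.
rewrite le_eqVlt; apply/orP; left; apply/eqP; apply: eq_Rintegral => u _.
by rewrite normrN.
Qed.

Section against_law.
Variables (Q : probability R R) (F : R -> R).
Hypothesis QF : forall c, Q `]-oo, c]%classic = (F c)%:E.
Hypothesis Q0 : forall x, Q [set x] = 0%E.
Hypothesis mF : measurable_fun setT F.

Lemma measurable_smoothing_error : measurable_fun setT smoothing_error.
Proof.
rewrite (_ : smoothing_error = tail_integral (fun u => - k u)).
  exact: (measurable_tail_integral Q kernelN_integrable).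
by apply/funext => t; exact: smoothing_errorE.
Qed.

Lemma measurable_cdf_increment (kappa : R -> R) a h :
  mu.-integrable setT (EFin \o kappa) ->
  measurable_fun setT (fun u => kappa u * (F a - F (a - h * u))).
Proof.
move=> /integrableP[/measurable_EFinP mk _]; apply: measurable_funM => //.
apply: measurable_funB => //; apply: measurableT_comp => //.
by apply: measurable_funB => //; exact: measurable_funM.
Qed.

(** One factor of the square is bounded by the integral of [|k|]; the mean of
    the other is of order [h]. *)
Lemma smoothing_error_mean_sq a h C :
  has_kernel_moment k 1 1 -> 0 < h -> 0 <= C ->
  (forall s, 0 <= s -> `|F a - F (a - s)| <= C * s) ->
  (\int[Q]_x (smoothing_error ((a - x) / h) ^+ 2)%:E <=
    (A0 * (C * h * \int[mu]_u `|u ^+ 1 * k u ^+ 1|))%:E)%E.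
Proof.
move=> k1 h0 C0 HF.
have ta0 t : 0 <= tail_integral (fun u => `|k u|) t.
  by apply: (le_trans _ (smoothing_error_tail t)).
have mt : measurable_fun setT (fun x : R => (a - x) / h).
  by apply: measurable_funM => //; exact: measurable_funB.
have mtail := measurable_tail_integral Q kernel_norm_integrable.
apply: (@le_trans _ _ (\int[Q]_x (A0%:E * (tail_integral (fun u => `|k u|) ((a - x) / h))%:E))%E).
  apply: ge0_le_integral => //.
  - by move=> x _; rewrite lee_fin sqr_ge0.
  - apply/measurable_EFinP; apply: measurable_funX; apply: measurableT_comp => //.
    exact: measurable_smoothing_error.
  - apply: measurable_funeM; apply/measurable_EFinP; exact: measurableT_comp.
  - move=> x _; rewrite -EFinM lee_fin -real_normK ?num_real // expr2.
    by apply: ler_pM => //; [exact: smoothing_error_bound|exact: smoothing_error_tail].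
rewrite ge0_integralZl //; last 3 first.
- apply/measurable_EFinP; exact: measurableT_comp.
- by move=> x _; rewrite lee_fin.
- by rewrite lee_fin; apply: Rintegral_ge0.
rewrite EFinM; apply: lee_wpmul2l; first by rewrite lee_fin; apply: Rintegral_ge0.
rewrite (integral_tail_integral QF Q0 kernel_norm_integrable _ a h0); last first.
  by move=> u u0; rewrite kernel_le0 // normr0.
have := @Rintegral_dominated R (fun u => `|k u| * (F a - F (a - h * u)))
  (fun u => u ^+ 1 * k u ^+ 1) (C * h) (measurable_cdf_increment a h kernel_norm_integrable) k1 _ _.
case.
- by rewrite mulr_ge0 // ltW.
- move=> u; have [u0|u0] := leP u 0; first by rewrite kernel_le0 // normr0 mul0r normr0 expr1 mulr0 normr0 mulr0.
  rewrite !normrM normr_id !expr1 (gtr0_norm u0).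
  rewrite [leLHS]mulrC [u * _]mulrC mulrA [leRHS]mulrAC.
  rewrite ler_wpM2r // (le_trans (HF _ _)) ?mulrA // mulr_ge0 // ltW //.
move=> ii Hb; rewrite -(RintegralK ii) lee_fin.
exact: le_trans (ler_norm _) Hb.
Qed.

Lemma smoothing_error_mean a h : 0 < h ->
  \int[Q]_x smoothing_error ((a - x) / h) =
  \int[mu]_u (- k u * (F a - F (a - h * u))).
Proof.
move=> h0.
have := integral_tail_integral QF Q0 kernelN_integrable kernelN_le0 a h0.
move/(congr1 fine); rewrite /Rintegral => <-; congr fine.
by apply: eq_integral => x _; rewrite smoothing_errorE.
Qed.

Lemma smoothing_error_mean1 a h C :
  has_kernel_moment k 1 1 -> 0 < h -> 0 <= C ->
  (forall s, 0 <= s -> `|F a - F (a - s)| <= C * s) ->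
  `|\int[Q]_x smoothing_error ((a - x) / h)| <=
  C * h * \int[mu]_u `|u ^+ 1 * k u ^+ 1|.
Proof.
move=> k1 h0 C0 HF; rewrite smoothing_error_mean //.
apply: (Rintegral_dominated (measurable_cdf_increment a h kernelN_integrable) k1 _ _).2.
  by rewrite mulr_ge0 // ltW.
move=> u; have [u0|u0] := leP u 0.
  by rewrite kernel_le0 // oppr0 mul0r normr0 !expr1 mulr0 normr0 mulr0.
rewrite !normrM normrN !expr1 (gtr0_norm u0).
rewrite [leLHS]mulrC [u * _]mulrC mulrA [leRHS]mulrAC.
by rewrite ler_wpM2r // (le_trans (HF _ _)) ?mulrA // mulr_ge0 // ltW.
Qed.

(** In [smoothing_error_mean] subtract [h * u * fa] from the increment of [F];
    this does not change the integral because the first moment of [k] is zero,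
    and leaves a remainder of order [h^2]. *)
Lemma smoothing_error_mean2 a h C (fa : R) :
  has_kernel_moment k 1 1 -> has_kernel_moment k 2 1 -> kernel_moment k 1 1 = 0 ->
  0 < h -> 0 <= C ->
  (forall s, 0 <= s -> `|F a - F (a - s) - s * fa| <= C * s ^+ 2) ->
  `|\int[Q]_x smoothing_error ((a - x) / h)| <=
  C * h ^+ 2 * \int[mu]_u `|u ^+ 2 * k u ^+ 1|.
Proof.
move=> k1 k2 m0 h0 C0 HF; rewrite smoothing_error_mean //.
have mk : measurable_fun setT k.
  by have /integrableP[/measurable_EFinP] := kernel_integrable.
have mcorr : measurable_fun setT
    (fun u => - k u * (F a - F (a - h * u)) - (- (h * fa)) * (u ^+ 1 * k u ^+ 1)).
  apply: measurable_funB; first exact: measurable_cdf_increment kernelN_integrable.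
  by apply: measurable_funM => //; apply: measurable_funM.
pose corr u := - k u * (F a - F (a - h * u)) - (- (h * fa)) * (u ^+ 1 * k u ^+ 1).
have bnd u : `|corr u| <= C * h ^+ 2 * `|u ^+ 2 * k u ^+ 1|.
  have [u0|u0] := leP u 0.
    by rewrite /corr kernel_le0 // oppr0 mul0r !expr1 !mulr0 subrr !normr0 mulr0.
  have -> : corr u = - k u * (F a - F (a - h * u) - h * u * fa).
    by rewrite /corr !expr1; ring.
  have hu : 0 <= h * u by rewrite mulr_ge0 // ltW.
  rewrite [leLHS]normrM normrN expr1 [X in _ <= _ * X]normrM normrX (gtr0_norm u0).
  have -> : C * h ^+ 2 * (u ^+ 2 * `|k u|) = `|k u| * (C * (h * u) ^+ 2) by ring.
  by rewrite ler_wpM2l // HF.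
have c0 : 0 <= C * h ^+ 2 by rewrite mulr_ge0 // sqr_ge0.
have [ii Hb] := Rintegral_dominated mcorr k2 c0 bnd.
have im : mu.-integrable setT
    (EFin \o (fun u => (- (h * fa)) * (u ^+ 1 * k u ^+ 1))).
  have := integrableZl measurableT (- (h * fa)) k1.
  by apply: eq_integrable => // u _; rewrite /= EFinM.
have -> : \int[mu]_u (- k u * (F a - F (a - h * u))) = \int[mu]_u corr u; last exact: Hb.
transitivity (\int[mu]_u (corr u + (- (h * fa)) * (u ^+ 1 * k u ^+ 1))).
  by apply: eq_Rintegral => u _; rewrite /corr subrK.
rewrite RintegralD // (RintegralZl _ _ k1) //.
by move: m0; rewrite /kernel_moment => ->; rewrite mulr0 addr0.
Qed.

End against_law.

(** [|u| <= 1 + u^2]. *)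
Lemma kernel_moment1_of2 : has_kernel_moment k 2 1 -> has_kernel_moment k 1 1.
Proof.
move=> k2.
have i2 : mu.-integrable setT (EFin \o (fun u : R => `|u ^+ 2 * k u ^+ 1|)).
  exact: (integrable_norm k2).
have := integrableD measurableT kernel_norm_integrable i2.
move=> id; apply: (le_integrable measurableT _ _ id).
  apply/measurable_EFinP; apply: measurable_funM => //.
  by have /integrableP[/measurable_EFinP] := kernel_integrable.
move=> u _; rewrite /= lee_fin.
have -> : `|u ^+ 1 * k u ^+ 1| = `|u| * `|k u| by rewrite !expr1 normrM.
have -> : `|u ^+ 2 * k u ^+ 1| = `|u| ^+ 2 * `|k u|.
  by rewrite expr1 [LHS]normrM normrX.
have := normr_ge0 (k u); have := normr_ge0 u.
set x := `|u|; set y := `|k u| => x0 y0.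
apply: (le_trans _ (ler_norm _)).
rewrite -[X in X + _]mul1r -mulrDl ler_wpM2r //.
by have := sqr_ge0 (x - 1); nra.
Qed.

End kernel.

(** * Local regularity of the distribution function *)

Section density.
Context {R : realType} (F f : R -> R).
Notation mu := (@lebesgue_measure R).
Hypothesis Ff : is_density F f.
Hypothesis F01 : forall x, 0 <= F x <= 1.

Lemma density_increment a b : a <= b ->
  (F b - F a)%:E = (\int[mu]_(t in `]a, b]) (f t)%:E)%E.
Proof.
case: Ff => mf f0 FE ab.
have := FE b.
have -> : `]-oo, b]%classic = (`]-oo, a] `|` `]a, b])%classic.
  apply/seteqP; split => x /=; rewrite !in_itv /=.
    by move=> xb; have [xa|xa] := leP x a; [left|right].
  by case=> [xa|/andP[]//]; exact: le_trans ab.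
rewrite ge0_integral_setU //; first last.
- apply/disj_setPRL => x /=; rewrite !in_itv /= => /andP[ax _].
  by apply/negP; rewrite -ltNge.
- by move=> x _; rewrite lee_fin.
- by apply/measurable_EFinP; exact: measurable_funTS.
rewrite -FE EFinB => ->.
by rewrite addeAC subee // add0e.
Qed.

Lemma density_integrable a b : mu.-integrable `[a, b] (EFin \o f).
Proof.
case: Ff => mf f0 FE.
apply/integrableP; split; first by apply/measurable_EFinP; exact: measurable_funTS.
apply: (@le_lt_trans _ _ (\int[mu]_(t in `]-oo, b]) (f t)%:E)%E); last first.
  by rewrite -FE ltry.
have -> : (\int[mu]_(x in `[a, b]) `|(EFin \o f) x| = \int[mu]_(x in `[a, b]) (f x)%:E)%E.
  by apply: eq_integral => x _ /=; rewrite ger0_norm.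
apply: ge0_subset_integral => //.
- by apply/measurable_EFinP; exact: measurable_funTS.
- by move=> x _; rewrite lee_fin.
- by move=> x /=; rewrite !in_itv /= => /andP[].
Qed.

Lemma density_increment_le a b c : a <= b -> 
  (forall x, a < x <= b -> f x <= c) -> F b - F a <= c * (b - a).
Proof.
case: Ff => mf f0 FE ab H; rewrite -lee_fin density_increment //.
apply: (@le_trans _ _ (\int[mu]_(z in `]a, b]) c%:E)%E).
  apply: ge0_le_integral => //.
  - by move=> z _; rewrite lee_fin.
  - by apply/measurable_EFinP; exact: measurable_funTS.
rewrite integral_cst //= lebesgue_measure_itv /= lte_fin.
case: ifP => [_|/negbT]; first by rewrite -EFinD -EFinM lee_fin.
by rewrite -leNgt => ba; rewrite mule0 (_ : b = a) ?subrr ?mulr0 //; apply/le_anti/andP.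
Qed.

Lemma density_increment_ge a b c : a <= b -> 0 <= c ->
  (forall x, a < x <= b -> c <= f x) -> c * (b - a) <= F b - F a.
Proof.
case: Ff => mf f0 FE ab c0 H; rewrite -lee_fin density_increment //.
apply: (@le_trans _ _ (\int[mu]_(z in `]a, b]) c%:E)%E); last first.
  apply: ge0_le_integral => //.
  - by apply/measurable_EFinP; exact: measurable_funTS.
rewrite integral_cst //= lebesgue_measure_itv /= lte_fin.
case: ifP => [_|/negbT]; first by rewrite -EFinD -EFinM lee_fin.
by rewrite -leNgt => ba; rewrite mule0 (_ : b = a) ?subrr ?mulr0 //; apply/le_anti/andP.
Qed.

Lemma density_continuous : continuous F.
Proof.
move=> x; pose a := x - 1; pose b := x + 1.
have ab : a < b by rewrite /a /b; lra.
have /(continuous_within_itvP _ ab)[H _ _] :=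
  parameterized_integral_continuous (ltW ab) (density_integrable a b).
have xab : x \in `]a, b[ by rewrite in_itv /= /a /b; apply/andP; split; lra.
have Hx := H x xab.
have E y : y \in `]a, b[ -> F y = F a + \int[mu]_(t in `[a, y]) f t.
  rewrite in_itv /= => /andP[ay yb].
  apply/eqP; rewrite addrC -subr_eq; apply/eqP; rewrite /Rintegral.
  by rewrite -integral_itv_obnd_cbnd -?density_increment //;
    [exact: ltW|case: Ff => mf _ _; apply/measurable_EFinP; exact: measurable_funTS].
have : F a + \int[mu]_(t in `[a, y]) f t @[y --> x] --> F a + \int[mu]_(t in `[a, x]) f t.
  by apply: cvgD => //; exact: cvg_cst.
rewrite -E // /continuous_at; apply: cvg_trans; apply: near_eq_cvg.
near=> y; rewrite -E //; near: y.
by apply: near_in_itvoo.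
Unshelve. all: by end_near. Qed.

Lemma density_nondecreasing a b : a <= b -> F a <= F b.
Proof.
move=> ab; have := @density_increment_ge a b 0 ab (lexx _).
by rewrite mul0r subr_ge0; apply; case: Ff => _ f0 _ x _.
Qed.

(** The derivative is bounded near [z], being continuous there. *)
Lemma C1_near_lipschitz z : C1_near f z -> exists rho L : R, [/\ 0 < rho, 0 <= L &
  forall x y, `|x - z| < rho -> `|y - z| < rho -> `|f y - f x| <= L * `|y - x|].
Proof.
move=> C1.
have [_ cz] := nbhs_singleton C1.
have /cvgrPdist_le /(_ 1 ltr01) near1 := cz.
have : \forall y \near z, derivable f y 1 /\ `|derive1 f y| <= `|derive1 f z| + 1.
  near=> y; split; first by have [] : derivable f y 1 /\ {for y, continuous (derive1 f)} by near: y.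
  have h : `|derive1 f z - derive1 f y| <= 1 by near: y.
  rewrite -[X in `|X|](subrK (derive1 f z)) (le_trans (ler_normD _ _)) //.
  by rewrite addrC lerD2l distrC.
move=> /nbhs_ballP[rho /= rho0 Hb].
exists rho, (`|derive1 f z| + 1).
suff HL x y : `|x - z| < rho -> `|y - z| < rho ->
    `|f y - f x| <= (`|derive1 f z| + 1) * `|y - x| by split.
have Hd c : `|c - z| < rho -> derivable f c 1 /\ `|derive1 f c| <= `|derive1 f z| + 1.
  by move=> cz1; apply: Hb; rewrite /ball /= distrC.
suff H x1 y1 : x1 < y1 -> `|x1 - z| < rho -> `|y1 - z| < rho ->
    `|f y1 - f x1| <= (`|derive1 f z| + 1) * `|y1 - x1|.
  move=> xr yr; have [xy|yx|->] := ltgtP x y; first exact: H.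
    by rewrite distrC [`|y - x|]distrC; exact: H.
  by rewrite !subrr normr0 mulr0.
clear x y; move: x1 y1 => x y xy xr yr.
have inr c : x <= c <= y -> `|c - z| < rho.
  move=> /andP[xc cy]; move: xr yr => /ltr_normlP[? ?] /ltr_normlP[? ?].
  by apply/ltr_normlP; split; lra.
have [||c] := @MVT R f (derive1 f) x y xy.
- move=> c; rewrite in_itv /= => /andP[xc cy].
  have [dc _] := Hd c (inr c (introT andP (conj (ltW xc) (ltW cy)))).
  by rewrite derive1E; exact: derivableP.
- apply: derivable_within_continuous => c; rewrite in_itv /= => /inr/Hd.
  by case.
rewrite in_itv /= => /andP[xc cy] ->.
rewrite normrM ler_wpM2r //.
have [] // := Hd c; apply: inr; by rewrite !ltW.
Unshelve. all: by end_near. Qed.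

(** For [s] up to a third of the Lipschitz radius this is Taylor's formula for
    [F], with the Lipschitz constant of [f].  For larger [s] the bounds hold
    because increments of [F] are at most one; having them for all [s >= 0]
    allows the kernel to have unbounded support. *)
Lemma density_local_expansion z : C1_near f z -> exists dl C : R,
  [/\ 0 < dl, 0 <= C & forall a, `|a - z| <= dl -> forall s, 0 <= s ->
    `|F a - F (a - s)| <= C * s /\ `|F a - F (a - s) - s * f a| <= C * s ^+ 2].
Proof.
move=> /C1_near_lipschitz[rho [L [rho0 L0 Lip]]].
have f0 x : 0 <= f x by case: Ff.
pose dl := rho / 3; pose Mf := f z + L * rho.
have dl0 : 0 < dl by rewrite divr_gt0.
have Mf0 : 0 <= Mf by rewrite addr_ge0 // mulr_ge0 // ltW.
have i0 : 0 <= dl^-1 by rewrite invr_ge0 ltW.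
have i2 : 0 <= Mf / dl by rewrite mulr_ge0.
have i3 : 0 <= dl^-1 ^+ 2 by rewrite sqr_ge0.
have C0 : 0 <= Mf + dl^-1 + L + dl^-1 ^+ 2 + Mf / dl by lra.
(* [Mf] bounds [f] near [z]; [Mf] and [L] serve for [s <= dl], the terms in
   [dl^-1] for [s > dl]. *)
exists dl, (Mf + dl^-1 + L + dl^-1 ^+ 2 + Mf / dl); split => // a az s s0.
have az1 : `|a - z| < rho by rewrite (le_lt_trans az) // /dl ltr_pdivrMr //; lra.
have zz : `|z - z| < rho by rewrite subrr normr0.
have le_Mf t : `|t - z| < rho -> f t <= Mf.
  move=> tz; have := Lip z t zz tz => /(le_trans (ler_norm _)).
  rewrite lerBlDl => /le_trans; apply.
  by rewrite lerD2l ler_wpM2l // ltW.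
have inc0 : 0 <= F a - F (a - s).
  by rewrite subr_ge0; apply: density_nondecreasing; rewrite gerBl.
have inc1 : F a - F (a - s) <= 1.
  by have /andP[_ h1] := F01 a; have /andP[h2 _] := F01 (a - s); lra.
have as_ : a - s <= a by rewrite gerBl.
have sE : a - (a - s) = s by rewrite opprB addrCA subrr addr0.
have ss : 0 <= s ^+ 2 by rewrite sqr_ge0.
have [sd|sd] := leP s dl.
  have tz t : a - s < t <= a -> `|t - z| < rho.
    move=> /andP[t1 t2]; move: az => /ler_normlP[a1 a2].
    rewrite /dl in sd a1 a2; apply/ltr_normlP; split; lra.
  have Lt t : a - s < t <= a -> `|f t - f a| <= L * s.
    move=> h; apply: (le_trans (Lip a t az1 (tz t h))); rewrite ler_wpM2l //.
    by move: h => /andP[t1 t2]; apply/ler_normlP; split; lra.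
  have up : F a - F (a - s) <= Mf * s.
    rewrite -[X in _ <= Mf * X]sE; apply: density_increment_le => // t h.
    exact: le_Mf (tz t h).
  have up2 : F a - F (a - s) <= (f a + L * s) * s.
    rewrite -[X in _ <= _ * X]sE; apply: density_increment_le => // t h.
    by have := le_trans (ler_norm _) (Lt t h); rewrite lerBlDl.
  have lo2 : (f a - L * s) * s <= F a - F (a - s).
    have [h|h] := leP 0 (f a - L * s); last first.
      by apply: (le_trans _ inc0); rewrite mulr_le0_ge0 // ltW.
    rewrite -[X in _ * X <= _]sE; apply: density_increment_ge => // t ht.
    by have := Lt t ht; rewrite distrC => /(le_trans (ler_norm _)); lra.
  have b1 : Mf * s <= (Mf + dl^-1 + L + dl^-1 ^+ 2 + Mf / dl) * s.
    by apply: ler_wpM2r => //; lra.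
  have b2 : L * s ^+ 2 <= (Mf + dl^-1 + L + dl^-1 ^+ 2 + Mf / dl) * s ^+ 2.
    by apply: ler_wpM2r => //; lra.
  split; first by rewrite ger0_norm // (le_trans up).
  apply: le_trans b2; apply/ler_normlP; split; nra.
have sdi : 1 <= s / dl by rewrite ler_pdivlMr // mul1r ltW.
have fa : f a <= Mf by exact: le_Mf.
have b1 : dl^-1 * s <= (Mf + dl^-1 + L + dl^-1 ^+ 2 + Mf / dl) * s.
  by apply: ler_wpM2r => //; lra.
have b2 : (dl^-1 ^+ 2 + Mf / dl) * s ^+ 2 <=
    (Mf + dl^-1 + L + dl^-1 ^+ 2 + Mf / dl) * s ^+ 2.
  by apply: ler_wpM2r => //; lra.
split.
  rewrite ger0_norm // (le_trans inc1) // (le_trans sdi) // mulrC; exact: b1.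
apply: (le_trans _ b2).
have e1 : 1 <= dl^-1 ^+ 2 * s ^+ 2.
  by rewrite -exprMn exprn_ege1 // mulrC.
have e2 : s * f a <= Mf / dl * s ^+ 2.
  rewrite (_ : Mf / dl * s ^+ 2 = s * (Mf * (s / dl))); last by field; rewrite gt_eqF.
  by rewrite ler_wpM2l // (le_trans fa) // ler_peMr.
have e3 : 0 <= s * f a by rewrite mulr_ge0.
rewrite mulrDl; apply/ler_normlP; split; lra.
Qed.

(** [f] stays above [f z / 2] on an interval about [z]. *)
Lemma density_cdf_strict z e : C1_near f z -> 0 < f z -> 0 < e ->
  F (z - e) < F z /\ F z < F (z + e).
Proof.
move=> /C1_near_lipschitz[rho [L [rho0 L0 Lip]]] fz e0.
pose q := f z / (2 * (L + 1)).
have L1 : 0 < L + 1 by lra.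
have q0 : 0 < q by rewrite divr_gt0 // mulr_gt0.
pose r := Num.min e (Num.min (rho / 2) q).
have r0 : 0 < r by rewrite !lt_min e0 q0 divr_gt0.
have re : r <= e by rewrite ge_min lexx.
have rr : r <= rho / 2 by rewrite !ge_min lexx orbT.
have rq : r <= q by rewrite !ge_min lexx !orbT.
have lb t : `|t - z| <= r -> f z / 2 <= f t.
  move=> tz; have tz1 : `|t - z| < rho by lra.
  have zz : `|z - z| < rho by rewrite subrr normr0.
  have := Lip z t zz tz1; rewrite distrC => /(le_trans (ler_norm _)) h.
  have h2 : L * `|t - z| <= f z / 2.
    apply: (le_trans (y := (L + 1) * q)).
      by apply: ler_pM => //; lra.
    by rewrite /q le_eqVlt; apply/orP; left; apply/eqP; field; rewrite gt_eqF.
  lra.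
have pos : 0 < f z / 2 * r by rewrite mulr_gt0 // divr_gt0.
have fz2 : 0 <= f z / 2 by lra.
split.
  have h1 : f z / 2 * (z - (z - r)) <= F z - F (z - r).
    apply: density_increment_ge => //; first by lra.
    by move=> x /andP[x1 x2]; apply: lb; apply/ler_normlP; split; lra.
  have h2 : F (z - e) <= F (z - r) by apply: density_nondecreasing; lra.
  have E : z - (z - r) = r by ring.
  rewrite E in h1; lra.
have h1 : f z / 2 * ((z + r) - z) <= F (z + r) - F z.
  apply: density_increment_ge => //; first by lra.
  by move=> x /andP[x1 x2]; apply: lb; apply/ler_normlP; split; lra.
have h2 : F (z + r) <= F (z + e) by apply: density_nondecreasing; lra.
have E : (z + r) - z = r by ring.
rewrite E in h1; lra.
Qed.

End density.

(** * Decomposition of the smoothed median statistic *)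

Section two_sample.
Context d (T : measurableType d) (R : realType) (P : probability T R).
Context (X Y : nat -> {RV P >-> R}) (F k : R -> R).
Let W := pooled_family X Y.
Hypothesis indepW : mutually_independent W.
Hypothesis cdfW : forall i x, cdf (W i) x = (F x)%:E.
Hypothesis F_continuous : continuous F.
Hypothesis hk : one_sided_kernel k.
Context (m n r : nat).
Hypothesis mnr : (m + n = r.*2.+1)%N.
Hypothesis r_gt1 : (1 < r)%N.

Definition pooled_index : seq (nat + nat) :=
  map inl (iota 0 m) ++ map inr (iota 0 n).

Let Z := sample_order_statistic W pooled_index r.+1.

Lemma uniq_pooled_index : uniq pooled_index.
Proof.
rewrite cat_uniq !map_inj_uniq ?iota_uniq; [|by move=> ? ? []|by move=> ? ? []].
rewrite andbT /=; apply/hasPn => i /mapP[j _ ->].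
by apply/negP => /mapP[].
Qed.

Lemma size_pooled_index : size pooled_index = r.*2.+1.
Proof. by rewrite size_cat !size_map !size_iota. Qed.

Lemma pooled_medianE w : pooled_median X Y m n w = Z w.
Proof.
rewrite /pooled_median mnr /= doubleK /Z /sample_order_statistic /=.
by rewrite /pooled_sample /pooled_index map_cat -!map_comp.
Qed.

(** The pooled sample indexed by a finite type, as required for the law of the
    set of observations below the median. *)
Definition pooled_embedding (j : 'I_(m + n)) : nat + nat :=
  if (j < m)%N then inl (j : nat) else inr (j - m)%N.

Definition first_sample : {set 'I_(m + n)} := [set j : 'I_(m + n) | (j < m)%N]%SET.

Lemma pooled_embedding_inj : injective pooled_embedding.
Proof.
move=> i j; rewrite /pooled_embedding; case: ltnP => im; case: ltnP => jm // [] ij;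
  apply: val_inj => //=.
by rewrite -(subnK im) -(subnK jm) ij.
Qed.

Lemma subsample_pooled : subsample pooled_embedding [set: 'I_(m + n)]%SET = pooled_index.
Proof.
pose e (j : nat) : nat + nat := if (j < m)%N then inl j else inr (j - m)%N.
rewrite /subsample enum_setT -enumT.
rewrite (_ : map _ _ = map e (map val (enum 'I_(m + n)))); last by rewrite -map_comp.
rewrite val_enum_ord iotaD map_cat; congr (_ ++ _).
  by apply/eq_in_map => j; rewrite mem_iota /= add0n /e => ->.
rewrite add0n -[m in iota m]addn0 iotaDl -map_comp; apply: eq_map => j /=.
by rewrite /e ltnNge leq_addr /= addKn.
Qed.

Lemma card_first_sample : #|first_sample| = m.
Proof.
rewrite -sum1_card (eq_bigl (fun j : 'I_(m + n) => (j < m)%N)); last first.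
  by move=> j; rewrite inE.
by rewrite -(big_ord_widen _ (fun=> 1%N)) ?leq_addr // sum1_card card_ord.
Qed.

Lemma card_second_sample : #|~: first_sample| = n.
Proof. by have := cardsC first_sample; rewrite card_first_sample card_ord; lia. Qed.

Definition median_count (w : T) : nat :=
  #|below_median W pooled_embedding r w :&: first_sample|.

(** Both samples enter through the median, but only the first is counted. *)
Lemma median_countE w : (median_count w)%:R = \sum_(i < m) (X i w < Z w)%R%:R :> R.
Proof.
rewrite /median_count -sum1_card natr_sum /=.
rewrite (eq_bigl (fun j : 'I_(m + n) => (j < m)%N && (W (pooled_embedding j) w < Z w)));
  last by move=> j; rewrite !inE subsample_pooled andbC.
rewrite big_mkcondr /= [RHS](big_ord_widen (m + n) (fun i => (X i w < Z w)%R%:R)) ?leq_addr //.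
by apply: eq_bigr => j jm; rewrite /pooled_embedding jm /=; case: ifP.
Qed.

Lemma rank_gt0 : (0 < r)%N. Proof. exact: ltnW. Qed.

Lemma card_pooled : #|'I_(m + n)| = r.*2.+1. Proof. by rewrite card_ord. Qed.

Lemma median_count_law :
  hypergeometric_weights m n r (fun j => fine (P [set w | median_count w = j])).
Proof.
have := below_median_hypergeometric indepW cdfW F_continuous pooled_embedding_inj
  card_pooled rank_gt0 first_sample.
by rewrite card_first_sample card_second_sample.
Qed.

Lemma measurable_median_count j : measurable [set w | median_count w = j].
Proof. exact: measurable_below_median_card. Qed.

Lemma prob_median_count (C : pred nat) :
  P [set w | C (median_count w)] =
  (\sum_(j < m.+1 | C j) fine (P [set w | median_count w = j]))%:E.
Proof.
have cm w : (median_count w <= m)%N.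
  by rewrite -card_first_sample subset_leq_card // finset.subsetIr.
have inE' w : (median_count w \in [seq j <- iota 0 m.+1 | C j]) = C (median_count w).
  by rewrite mem_filter mem_iota leq0n add0n ltnS cm !andbT.
rewrite (_ : [set w | C (median_count w)] =
    [set w | median_count w \in [seq j <- iota 0 m.+1 | C j]]); last first.
  by apply/funext => w; rewrite /mkset inE'.
rewrite measure_fiber_in ?filter_uniq ?iota_uniq //; last exact: measurable_median_count.
rewrite -sumEFin big_filter -(big_mkord C (fun j => (fine (P [set w | median_count w = j]))%:E)).
rewrite /index_iota subn0; apply: eq_bigr => j _.
by rewrite fineK // fin_num_measure //; exact: measurable_median_count.
Qed.

(** [Z <= c] means that at least [r + 1] of [2r + 1] observations are at most
    [c], each with probability [F c]. *)
Lemma median_localised (z dl : R) : 0 < dl ->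
  (P [set w | dl < `|Z w - z|]%R <=
   (binomial_tail (F (z - dl)) r.*2.+1 r.+1 +
    (1 - binomial_tail (F (z + dl)) r.*2.+1 r.+1))%:E)%E.
Proof.
move=> dl0.
have rk : (0 < r.+1 <= size pooled_index)%N by rewrite size_pooled_index /= ltnS -addnn leq_addr.
have PZ c : P (Z @^-1` `]-oo, c]) = (binomial_tail (F c) r.*2.+1 r.+1)%:E.
  by rewrite -size_pooled_index (prob_sample_order_statistic_le indepW cdfW) ?uniq_pooled_index.
have mZ A : measurable A -> measurable (Z @^-1` A).
  by move=> mA; exact: measurable_funPTI.
have PZc c : P (~` (Z @^-1` `]-oo, c])) = (1 - binomial_tail (F c) r.*2.+1 r.+1)%:E.
  by rewrite probability_setC ?PZ //; exact: mZ.
rewrite EFinD -PZ -PZc.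
apply: (@le_trans _ _ (P (Z @^-1` `]-oo, z - dl] `|` ~` (Z @^-1` `]-oo, z + dl])))).
  apply: le_measure; rewrite ?inE.
  - apply: measurable_lt_set => //; apply: measurableT_comp => //.
    exact: measurable_funB.
  - by apply: measurableU; [exact: mZ|apply: measurableC; exact: mZ].
  - move=> w; rewrite /setU /setC /preimage /mkset /= !in_itv /=.
    move: (order_statistic _ _) => a.
    have [az _|az h1] := leP a (z - dl); [by left|right].
    by apply/negP; rewrite -ltNge; move: h1; rewrite lter_normr => /orP[|]; lra.
apply: measureU2; first exact: mZ.
by apply: measurableC; exact: mZ.
Qed.

Context (h : R).
Hypothesis h_gt0 : 0 < h.

Let err (t : R) := smoothing_error k (t / h).

Definition median_remainder (w : T) : R :=
  \sum_(i <- [seq inl i | i <- iota 0 m]) err (Z w - W i w).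

Lemma smoothed_medianE w :
  smoothed_median X Y k m n h w = (median_count w)%:R + median_remainder w.
Proof.
rewrite median_countE /median_remainder big_map -[iota 0 m]val_enum_ord big_map big_enum /=.
rewrite -big_split /=; apply: eq_bigr => i _.
rewrite pooled_medianE /err /smoothing_error pmulr_lgt0 ?invr_gt0 // subr_gt0.
by rewrite addrC subrK.
Qed.

Lemma measurable_err : measurable_fun setT err.
Proof.
apply: measurableT_comp; last exact: measurable_funM.
apply: (measurable_smoothing_error hk (distribution P (X 0%N))).
Qed.

Lemma measurable_median_remainder : measurable_fun setT median_remainder.
Proof.
apply: measurable_sum => i; apply: measurableT_comp; first exact: measurable_err.
exact: measurable_funB.
Qed.

(** [second_moment_sum], with the indicator of the neighbourhood of [z] as
    [phi], and Markov's inequality for the square. *)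
Lemma remainder_chebyshev (z dl t beta gamma : R) : 0 < t -> 0 <= gamma ->
  (forall i a, `|a - z| <= dl ->
    `|\int[distribution P (W i)]_x err (a - x)| <= beta) ->
  (forall i a, `|a - z| <= dl ->
    (\int[distribution P (W i)]_x (err (a - x) ^+ 2)%:E <= gamma%:E)%E) ->
  (P ([set w | `|Z w - z| <= dl]%R `&` [set w | t < `|median_remainder w|]%R) <=
   ((m%:R * gamma + m%:R ^+ 2 * beta ^+ 2) / t ^+ 2)%:E)%E.
Proof.
move=> t0 g0 Hb Hg.
pose phi (a : R) : R := \1_[set a : R | `|a - z| <= dl] a.
have mI : measurable [set a : R | `|a - z| <= dl].
  rewrite (_ : [set a | _] = ~` [set a | dl < `|a - z|]).
    apply: measurableC; apply: measurable_lt_set => //; apply: measurableT_comp => //.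
    exact: measurable_funB.
  by apply/seteqP; split => a /=; [move=> ?; apply/negP; rewrite -leNgt|move/negP; rewrite -leNgt].
have mphi : measurable_fun setT phi by exact: measurable_indic.
have phi01 a : 0 <= phi a <= 1 by rewrite /phi indicE ler0n lern1 leq_b1.
have phiI a : phi a != 0 -> `|a - z| <= dl.
  by rewrite /phi indicE pnatr_eq0 eqb0 negbK inE.
have sub : {subset [seq inl i | i <- iota 0 m] <= pooled_index}.
  by move=> i im; rewrite mem_cat im.
have ul : uniq ([seq inl i | i <- iota 0 m] : seq (nat + nat)).
  by rewrite map_inj_uniq ?iota_uniq // => ? ? [].
have e0 u : u <= 0 -> err u = 0.
  by move=> u0; rewrite /err (smoothing_error_le0 hk) // pmulr_lle0 ?invr_gt0.
have H := @second_moment_sum _ _ _ P _ W F indepW cdfW err phi _ beta gamma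
  measurable_err mphi (fun u => smoothing_error_bound hk _) e0 g0 phi01
  (fun i a pa => Hb i a (phiI a pa)) (fun i a pa => Hg i a (phiI a pa))
  pooled_index _ r uniq_pooled_index ul sub size_pooled_index r_gt1.
rewrite size_map size_iota in H.
have t2 : 0 < t ^+ 2 by rewrite exprn_gt0.
rewrite EFinM lee_pdivlMr //.
have mD := measurable_median_remainder.
set A := _ `&` _.
have mA : measurable A.
  apply: measurableI; last first.
    by apply: measurable_lt_set => //; exact: measurableT_comp.
  have -> : [set w | `|Z w - z| <= dl] = Z @^-1` [set a : R | `|a - z| <= dl] by [].
  exact: measurable_funPTI.
have mphiZ : measurable_fun setT (fun w => (phi (Z w) * median_remainder w ^+ 2)%:E).
  apply/measurable_EFinP; apply: measurable_funM; first exact: measurableT_comp.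
  exact: measurable_funX.
have phiZ_ge0 w : (0 <= (phi (Z w) * median_remainder w ^+ 2)%:E)%E.
  by rewrite lee_fin mulr_ge0 ?sqr_ge0 //; have /andP[] := phi01 (Z w).
apply: le_trans H; rewrite muleC -(integral_cst P mA).
apply: (@le_trans _ _ (\int[P]_(w in A) (phi (Z w) * median_remainder w ^+ 2)%:E)%E).
  apply: ge0_le_integral => //.
  - by move=> w _; rewrite lee_fin ltW.
  - exact: measurable_funTS.
  - move=> w [Zw tD]; rewrite lee_fin /phi indicE mem_set // mul1r.
    rewrite -[leRHS]real_normK ?num_real // ler_sqr ?nnegrE ?normr_ge0 ?(ltW t0) //.
    exact: ltW.
exact: ge0_subset_integral.
Qed.
End two_sample.

(** * Distance to the normal law for fixed sample sizes *)

Section perturbation.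
Context d (T : measurableType d) (R : realType) (P : probability T R).

Lemma prob_le_add (A B E : set T) : measurable A -> measurable B -> measurable E ->
  A `<=` B `|` E -> fine (P A) <= fine (P B) + fine (P E).
Proof.
move=> mA mB mE AB; have fP G : measurable G -> P G \is a fin_num.
  by move=> mG; exact: fin_num_measure.
rewrite -lee_fin EFinD !fineK ?fP //.
apply: le_trans (measureU2 _ mB mE).
by apply: le_measure => //; rewrite inE //; exact: measurableU.
Qed.

(** [S + D < x] implies [S < x + eps] unless [eps < |D|], and is implied by
    [S < x - eps] unless [eps < |D|]; the slope of the normal distribution
    function is at most [normal_peak 1]. *)
Lemma perturbed_distance (S D : T -> R) (delta eps : R) :
  measurable_fun setT S -> measurable_fun setT D -> 0 < eps ->
  (forall x, `|fine (P [set w | S w < x]%R) - Phir x| <= delta) ->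
  forall x : R, `|fine (P [set w | S w + D w < x]%R) - Phir x| <=
    delta + normal_peak 1 * eps + fine (P [set w | eps < `|D w|]%R).
Proof.
move=> mS mD e0 HS x.
have mlt (U : T -> R) (y : R) : measurable_fun setT U -> measurable [set w : T | (U w < y)%R].
  by move=> mU; exact: measurable_lt_set.
have mSD : measurable_fun setT (fun w => S w + D w) by exact: measurable_funD.
have mE : measurable [set w | eps < `|D w|]%R.
  by apply: measurable_lt_set => //; exact: measurableT_comp.
have up : fine (P [set w | S w + D w < x]%R) <=
    fine (P [set w | S w < x + eps]%R) + fine (P [set w | eps < `|D w|]%R).
  apply: prob_le_add => //; [exact: mlt|exact: mlt|].
  move=> w /= h1; have [De|De] := leP `|D w| eps; [left|by right].
  by move: De; rewrite ler_norml => /andP[]; lra.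
have lo : fine (P [set w | S w < x - eps]%R) <=
    fine (P [set w | S w + D w < x]%R) + fine (P [set w | eps < `|D w|]%R).
  apply: prob_le_add => //; [exact: mlt|exact: mlt|].
  move=> w /= h1; have [De|De] := leP `|D w| eps; [left|by right].
  by move: De; rewrite ler_norml => /andP[]; lra.
have h1 := HS (x + eps); have h2 := HS (x - eps).
have l1 : Phir (x + eps) - Phir x <= normal_peak 1 * (x + eps - x).
  by apply: Phir_lipschitz; rewrite lerDl ltW.
have l2 : Phir x - Phir (x - eps) <= normal_peak 1 * (x - (x - eps)).
  by apply: Phir_lipschitz; rewrite gerBl ltW.
move: l1 l2; rewrite (_ : x + eps - x = eps); last by rewrite addrAC subrr add0r.
rewrite (_ : x - (x - eps) = eps); last by rewrite opprB addrC subrK.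
move: h1 h2 up lo; rewrite !ler_norml => /andP[a1 a2] /andP[a3 a4] a5 a6 a7 a8.
by apply/andP; split; lra.
Qed.
End perturbation.

Section distance.
Context d (T : measurableType d) (R : realType) (P : probability T R).
Context (X Y : nat -> {RV P >-> R}) (F k : R -> R).
Let W := pooled_family X Y.
Hypothesis indepW : mutually_independent W.
Hypothesis cdfW : forall i x, cdf (W i) x = (F x)%:E.
Hypothesis hk : one_sided_kernel k.
Context (m n r : nat) (h : R).
Hypothesis mnr : (m + n = r.*2.+1)%N.
Hypothesis r_gt1 : (1 < r)%N.
Hypothesis h_gt0 : 0 < h.
Hypothesis m_gt0 : (0 < m)%N.
Hypothesis n_gt0 : (0 < n)%N.

(** The centring is the mean of the hypergeometric law, [r] draws of which a
    fraction [m / N] is expected in the first sample. *)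
Lemma E1_rank : E1 R m n = m%:R * r%:R / (m + n)%:R.
Proof.
rewrite /E1 mnr; have N0 : r.*2.+1%:R != 0 :> R by rewrite pnatr_eq0.
have E : r%:R = (r.*2.+1%:R - 1) / 2 :> R.
  by rewrite -muln2 -addn1 natrD natrM addrK mulfK.
rewrite [in RHS]E; by move: (r.*2.+1%:R : R) N0 => N N0; field.
Qed.

Lemma V1_gt0 : 0 < V1 R m n.
Proof.
by rewrite /V1 divr_gt0 ?mulr_gt0 // ltr0n ?muln_gt0 ?m_gt0 ?addn_gt0 ?m_gt0.
Qed.

Lemma powR_V1 : V1 R m n `^ (- (1 / 2)) = (Num.sqrt (V1 R m n))^-1.
Proof. by rewrite powRN mul1r powR12_sqrt // ltW // V1_gt0. Qed.

Lemma measurable_median_countP (C : pred nat) :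
  measurable [set w | C (median_count X Y m n r w)].
Proof.
rewrite (_ : [set w | _] = \bigcup_(j in [set j | C j]) [set w | median_count X Y m n r w = j]).
  by apply: bigcup_measurable => j _; exact: measurable_median_count.
apply/seteqP; split => [w Cw|w [j Cj cj]]; first by exists (median_count X Y m n r w).
by rewrite /mkset cj.
Qed.

Lemma measurable_median_countR :
  measurable_fun setT (fun w => (median_count X Y m n r w)%:R : R).
Proof.
move=> _ B mB; rewrite setTI.
rewrite (_ : _ @^-1` _ =
    [set w | [pred j : nat | `[< B (j%:R : R) >]] (median_count X Y m n r w)]).
  exact: measurable_median_countP.
by apply/seteqP; split => w /=; [move/asboolP|move=> /asboolP].
Qed.

(** The remainder exceeds [eps] standard deviations either because [Z] is far
    from [z], or by [remainder_chebyshev]. *)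
Lemma smoothed_median_distance (z dl eps beta gamma delta : R) :
  0 < dl -> 0 < eps -> 0 <= gamma ->
  (forall x, `|\sum_(j < m.+1 | (j%:R - m%:R * r%:R / (m + n)%:R) /
      Num.sqrt (m%:R * n%:R / (4 * (m + n)%:R)) < x)
      fine (P [set w | median_count X Y m n r w = j]) - Phir x| <= delta) ->
  (forall i a, `|a - z| <= dl ->
    `|\int[distribution P (W i)]_x smoothing_error k ((a - x) / h)| <= beta) ->
  (forall i a, `|a - z| <= dl ->
    (\int[distribution P (W i)]_x (smoothing_error k ((a - x) / h) ^+ 2)%:E <=
      gamma%:E)%E) ->
  forall x, (`|P [set w | V1 R m n `^ (- (1 / 2)) *
      (smoothed_median X Y k m n h w - E1 R m n) < x]%R - Phi x| <=
    (delta + normal_peak 1 * eps +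
     (binomial_tail (F (z - dl)) r.*2.+1 r.+1 +
      (1 - binomial_tail (F (z + dl)) r.*2.+1 r.+1) +
      (m%:R * gamma + m%:R ^+ 2 * beta ^+ 2) / (eps ^+ 2 * V1 R m n)))%:E)%E.
Proof.
move=> dl0 e0 g0 HS Hb Hg x.
have V0 := V1_gt0.
set sd := Num.sqrt (V1 R m n).
have sd0 : 0 < sd by rewrite sqrtr_gt0.
pose S w := ((median_count X Y m n r w)%:R - E1 R m n) / sd.
pose D w := median_remainder X Y k m n r h w / sd.
have mS : measurable_fun setT S.
  apply: measurable_funM => //; apply: measurable_funB => //.
  exact: measurable_median_countR.
have mR := measurable_median_remainder X Y hk m n r h.
have mD : measurable_fun setT D by exact: measurable_funM.
have -> : [set w | V1 R m n `^ (- (1 / 2)) *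
    (smoothed_median X Y k m n h w - E1 R m n) < x] = [set w | S w + D w < x].
  apply/funext => w; congr (is_true (_ < _)).
  by rewrite powR_V1 (smoothed_medianE X Y k mnr h_gt0) mulrC addrAC mulrDl.
have mSD : measurable [set w | S w + D w < x].
  by apply: measurable_lt_set => //; exact: measurable_funD.
have -> : P [set w | S w + D w < x] = (fine (P [set w | S w + D w < x]))%:E.
  by rewrite fineK // fin_num_measure.
rewrite PhiE -EFinB abse_EFin lee_fin.
have HS' y : `|fine (P [set w | S w < y]) - Phir y| <= delta.
  rewrite (prob_median_count X Y m n r (fun j => (j%:R - E1 R m n) / sd < y)).
  by rewrite E1_rank /sd /V1 natrM; exact: HS.
apply: le_trans (perturbed_distance mS mD e0 HS' x) _.
rewrite lerD2l.
pose Z := sample_order_statistic W (pooled_index m n) r.+1.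
have mZ : measurable_fun setT Z by [].
pose A := [set w | dl < `|Z w - z|]%R.
pose B := [set w | `|Z w - z| <= dl]%R `&`
          [set w | sd * eps < `|median_remainder X Y k m n r h w|]%R.
have mA : measurable A.
  apply: measurable_lt_set => //; apply: measurableT_comp => //.
  exact: measurable_funB.
have mB : measurable B.
  apply: measurableI; last first.
    by apply: measurable_lt_set => //; exact: measurableT_comp.
  rewrite (_ : [set w | _] = ~` A); first exact: measurableC.
  by apply/seteqP; split => w; [move=> h1 /= ; apply/negP; rewrite -leNgt|move/negP; rewrite -leNgt].
have le1 : fine (P [set w | eps < `|D w|]) <= fine (P A) + fine (P B).
  apply: prob_le_add => //.
    by apply: measurable_lt_set => //; exact: measurableT_comp.
  move=> w; rewrite /mkset /D normrM normfV (gtr0_norm sd0) ltr_pdivlMr // mulrC => h1.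
  by have [h2|h2] := leP `|Z w - z| dl; [right|left].
apply: (le_trans le1); apply: lerD.
  rewrite -lee_fin fineK; last exact: fin_num_measure.
  exact: (median_localised indepW cdfW mnr).
rewrite -lee_fin fineK; last exact: fin_num_measure.
have se0 : 0 < sd * eps by exact: mulr_gt0.
apply: le_trans (remainder_chebyshev indepW cdfW hk mnr r_gt1 h_gt0 se0 g0 Hb Hg) _.
rewrite exprMn sqr_sqrtr ?(ltW V0) // [V1 _ _ _ * _]mulrC.
exact: lexx.
Qed.
End distance.

(** * Rates and conclusion *)

Section rates.
Context {R : realType}.
Notation mu := (@lebesgue_measure R).

(** If [h <= e * N ^ (- 1 / p)] then [N * h ^ p <= e ^ p]. *)
Lemma littleo_powR_rate (p : nat) (N : nat -> nat) (h : nat -> R) :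
  (0 < p)%N -> (forall v, (0 < N v)%N) -> (forall v, 0 < h v) ->
  h =o_\oo (fun v => (N v)%:R `^ (- (1 / p%:R))) ->
  (N v)%:R * h v ^+ p @[v --> \oo] --> (0 : R).
Proof.
move=> p0 N0 h0 /eqoP ho; apply/cvgr0Pnorm_le => e e0.
have e10 : 0 < Num.min e 1 by rewrite lt_min e0 ltr01.
have := ho _ e10; apply: filterS => v.
have pN0 : 0 <= (N v)%:R `^ (- (1 / p%:R)) :> R by exact: powR_ge0.
rewrite (ger0_norm pN0) (gtr0_norm (h0 v)) => hv.
have Nv0 : 0 < (N v)%:R :> R by rewrite ltr0n.
have pE : ((N v)%:R `^ (- (1 / p%:R))) ^+ p = (N v)%:R^-1 :> R.
  rewrite -powR_mulrn // -powRrM mulNr mul1r mulVf ?pnatr_eq0 -?lt0n //.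
  by rewrite powRN powRr1 // ltW.
have hp : h v ^+ p <= Num.min e 1 ^+ p * (N v)%:R^-1.
  rewrite -pE -exprMn; apply: lerXn2r; rewrite // nnegrE ?(ltW (h0 v)) //.
  by rewrite mulr_ge0 // ltW.
rewrite ger0_norm; last by rewrite mulr_ge0 ?exprn_ge0 ?(ltW (h0 v)) // ltW.
apply: (@le_trans _ _ (Num.min e 1 ^+ p)).
  by rewrite mulrC -ler_pdivlMr.
apply: (@le_trans _ _ (Num.min e 1)); last by rewrite ge_min lexx.
by rewrite -[leRHS]expr1; apply: ler_wiXn2l => //; [exact: ltW|rewrite ge_min lexx orbT].
Qed.

(** What the two bandwidth hypotheses have in common: near [z] the smoothing
    error has mean [beta = o(N ^ (- 1 / 2))] and mean square [gamma = o(1)].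
    In the first case [beta] is of order [h], in the second of order [h ^ 2]. *)
Lemma smoothing_rates (F f k : R -> R) (z : R) (N : nat -> nat) (h : nat -> R) :
  is_density F f -> (forall x, 0 <= F x <= 1) -> C1_near f z -> one_sided_kernel k ->
  (forall v, (0 < N v)%N) -> (forall v, 0 < h v) -> h v @[v --> \oo] --> 0 ->
  (has_kernel_moment k 1 1 /\ h =o_\oo (fun v => (N v)%:R `^ (- (1 / 2)))) \/
  (has_kernel_moment k 2 1 /\ kernel_moment k 1 1 = 0 /\
   h =o_\oo (fun v => (N v)%:R `^ (- (1 / 4)))) ->
  exists dl, exists beta gamma : nat -> R,
    [/\ 0 < dl, forall v, 0 <= gamma v,
      (N v)%:R * beta v ^+ 2 @[v --> \oo] --> 0, gamma v @[v --> \oo] --> 0 &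
      forall (Q : probability R R) (v : nat) (a : R),
        (forall c, Q `]-oo, c]%classic = (F c)%:E) ->
        (forall x, Q [set x] = 0%E) -> `|a - z| <= dl ->
        `|\int[Q]_x smoothing_error k ((a - x) / h v)| <= beta v /\
        (\int[Q]_x (smoothing_error k ((a - x) / h v) ^+ 2)%:E <= (gamma v)%:E)%E].
Proof.
move=> Ff F01 C1 hk N0 h0 h_0 rate.
have mF : measurable_fun setT F.
  by apply: continuous_measurable_fun; exact: (density_continuous Ff).
have [dl [C [dl0 C0 HF]]] := density_local_expansion Ff F01 C1.
have k1 : has_kernel_moment k 1 1.
  by case: rate => [[]//|[k2 _]]; exact: (kernel_moment1_of2 hk).
pose A := \int[mu]_u `|k u|; pose M1 := \int[mu]_u `|u ^+ 1 * k u ^+ 1|.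
pose M2 := \int[mu]_u `|u ^+ 2 * k u ^+ 1|.
have A0 : 0 <= A by exact: Rintegral_ge0.
have M10 : 0 <= M1 by exact: Rintegral_ge0.
have M20 : 0 <= M2 by exact: Rintegral_ge0.
pose gamma v := A * (C * h v * M1).
have g0 v : 0 <= gamma v by rewrite mulr_ge0 // mulr_ge0 // mulr_ge0 // ltW.
have g_0 : gamma v @[v --> \oo] --> 0.
  rewrite (_ : gamma = fun v => A * C * M1 * h v).
    by rewrite -[X in _ --> X](mulr0 (A * C * M1)); exact: cvgMr.
  by apply/funext => v; rewrite /gamma; ring.
have Hg (Q : probability R R) (v : nat) (a : R) :
    (forall c, Q `]-oo, c]%classic = (F c)%:E) ->
    (forall x, Q [set x] = 0%E) -> `|a - z| <= dl ->
    (\int[Q]_x (smoothing_error k ((a - x) / h v) ^+ 2)%:E <= (gamma v)%:E)%E.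
  move=> QF Q0 az; apply: (smoothing_error_mean_sq hk QF Q0 mF k1 (h0 v) C0).
  by move=> s s0; have [] := HF a az s s0.
case: rate => [[_ ho]|[k2 [km ho]]].
- exists dl, (fun v => C * h v * M1), gamma; split => //.
  + rewrite (_ : (fun v => _) = fun v => (C * M1) ^+ 2 * ((N v)%:R * h v ^+ 2)).
      rewrite -[X in _ --> X](mulr0 ((C * M1) ^+ 2)); apply: cvgMr.
      exact: littleo_powR_rate.
    by apply/funext => v; ring.
  + move=> Q v a QF Q0 az; split; last exact: Hg.
    apply: (smoothing_error_mean1 hk QF Q0 mF k1 (h0 v) C0).
    by move=> s s0; have [] := HF a az s s0.
- exists dl, (fun v => C * h v ^+ 2 * M2), gamma; split => //.
  + rewrite (_ : (fun v => _) = fun v => (C * M2) ^+ 2 * ((N v)%:R * h v ^+ 4)).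
      rewrite -[X in _ --> X](mulr0 ((C * M2) ^+ 2)); apply: cvgMr.
      exact: littleo_powR_rate.
    by apply/funext => v; ring.
  + move=> Q v a QF Q0 az; split; last exact: Hg.
    apply: (smoothing_error_mean2 (fa := f a) hk QF Q0 mF k1 k2 km (h0 v) C0).
    by move=> s s0; have [] := HF a az s s0.
Qed.

(** [V1 = m n / (4 N)] is at least [c ^ 2 N / 4]. *)
Lemma chebyshev_ratio_le (m n : nat) (c e beta gamma : R) : 0 < c -> 0 < e ->
  (0 < m + n)%N -> 0 <= gamma ->
  c * (m + n)%:R <= m%:R -> c * (m + n)%:R <= n%:R ->
  (m%:R * gamma + m%:R ^+ 2 * beta ^+ 2) / (e ^+ 2 * V1 R m n) <=
  4 / (e * c) ^+ 2 * (gamma + (m + n)%:R * beta ^+ 2).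
Proof.
move=> c0 e0 N0 g0 cm cn.
have mN : m%:R <= (m + n)%:R :> R by rewrite ler_nat leq_addr.
have NR : 0 < (m + n)%:R :> R by rewrite ltr0n.
rewrite /V1 natrM; have m0 : 0 <= m%:R :> R by exact: ler0n.
move: (m%:R : R) (n%:R : R) ((m + n)%:R : R) cm cn mN NR m0 => x y t cx cy xt t0 x0.
have x_gt0 : 0 < x by apply: lt_le_trans cx; exact: mulr_gt0.
have y_gt0 : 0 < y by apply: lt_le_trans cy; exact: mulr_gt0.
have b0 : 0 <= beta ^+ 2 by exact: sqr_ge0.
move: (beta ^+ 2) b0 => b b0.
have e2 : 0 < e ^+ 2 by rewrite exprn_gt0.
have c2 : 0 < c ^+ 2 by rewrite exprn_gt0.
have Vle : c ^+ 2 * t / 4 <= x * y / (4 * t).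
  rewrite ler_pdivlMr ?mulr_gt0 // (_ : _ / 4 * _ = c * t * (c * t)); last by field.
  by apply: ler_pM => //; rewrite mulr_ge0 ?ltW.
have num : x * gamma + x ^+ 2 * b <= t * (gamma + t * b).
  rewrite mulrDr mulrA -expr2; apply: lerD; first exact: ler_wpM2r.
  by apply: ler_wpM2r => //; rewrite ler_sqr ?nnegrE ?(ltW t0).
have num0 : 0 <= t * (gamma + t * b).
  by rewrite mulr_ge0 ?(ltW t0) // addr_ge0 // mulr_ge0 // ltW.
have V0 : 0 < x * y / (4 * t) by rewrite divr_gt0 ?mulr_gt0.
have eV0 : 0 < e ^+ 2 * (x * y / (4 * t)) by exact: mulr_gt0.
rewrite ler_pdivrMr //; apply: (le_trans num).
have -> : t * (gamma + t * b) =
    4 / (e * c) ^+ 2 * (gamma + t * b) * (e ^+ 2 * (c ^+ 2 * t / 4)).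
  by field; rewrite (gt_eqF e0) (gt_eqF c0).
apply: ler_wpM2l.
  rewrite mulr_ge0 //; first by rewrite divr_ge0 // sqr_ge0.
  by rewrite addr_ge0 // mulr_ge0 // ltW.
by rewrite ler_pM2l.
Qed.

End rates.

Theorem theorem2 (R : realType) (d : measure_display) (T : measurableType d)
    (P0 : probability T R) (F f : R -> R) (z0 : R)
    (X Y : nat -> {RV P0 >-> R})
    (k : R -> R) (m n : nat -> nat) (lambda : R) (h : nat -> R)
    (hF : is_density F f)
    (* the null hypothesis: location parameter equal to 0 *)
    (hH0 : location_model F 0 X Y)
    (hz0 : F z0 = 1 / 2)
    (hk : one_sided_kernel k)
    (* [v] indexes the samples, of sizes [m v] and [n v], with [N = m v + n v] *)
    (hodd : forall v, odd (m v + n v))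
    (hN : (m v + n v)%N @[v --> \oo] --> \oo)
    (hlambda : (m v)%:R / (m v + n v)%:R @[v --> \oo] --> lambda)
    (hlambda01 : 0 < lambda < 1)
    (hh_gt0 : forall v, 0 < h v)
    (hh0 : h v @[v --> \oo] --> 0)
    (hf1 : C1_near f z0)
    (hfz0 : 0 < f z0)
    (hh : (has_kernel_moment k 1 1 /\
           h =o_\oo (fun v => (m v + n v)%:R `^ (- (1 / 2)))) \/
          (has_kernel_moment k 2 1 /\ kernel_moment k 1 1 = 0 /\
           h =o_\oo (fun v => (m v + n v)%:R `^ (- (1 / 4))))) :
  ereal_sup [set `| P0 [set w |
                       ((V1 R (m v) (n v)) `^ (- (1 / 2)) *
                        (smoothed_median X Y k (m v) (n v) (h v) w
                         - E1 R (m v) (n v)) < x)%R]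
                   - Phi x |%E | x in [set: R]]
    @[v --> \oo] --> 0%E.
Proof.
have [indepW cdfX cdfY] := hH0.
have cdfW i x : cdf (pooled_family X Y i) x = (F x)%:E.
  by case: i => [i|j] /=; rewrite ?cdfX // cdfY subr0.
have F01 x : 0 <= F x <= 1.
  by rewrite -!lee_fin -(cdfX 0%N) measure_ge0 probability_le1.
have F_continuous : continuous F by exact: (density_continuous hF).
pose N v := (m v + n v)%N; pose r v := (N v)./2.
have NE v : (m v + n v)%N = (r v).*2.+1.
  by rewrite -[LHS]odd_double_half hodd.
have N0 v : (0 < N v)%N by rewrite /N NE.
have r_oo : r v @[v --> \oo] --> \oo.
  apply/cvgnyPge => A; move/cvgnyPge: hN => /(_ A.*2.+1); apply: filterS => v.
  by rewrite NE ltnS leq_double.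
have [dl [beta [gamma [dl0 g0 Nb_0 g_0 rates]]]] :=
  smoothing_rates hF F01 hf1 hk N0 hh_gt0 hh0 hh.
have [Fl Fr] := density_cdf_strict hF hf1 hfz0 dl0.
have tail_lt : binomial_tail (F (z0 - dl)) (r v).*2.+1 (r v).+1 @[v --> \oo] --> 0.
  apply: (cvg_comp _ (fun l => binomial_tail (F (z0 - dl)) l.*2.+1 l.+1) r_oo).
  by apply: binomial_median_tail_lt; rewrite -hz0 Fl andbT; have /andP[] := F01 (z0 - dl).
have tail_gt : 1 - binomial_tail (F (z0 + dl)) (r v).*2.+1 (r v).+1 @[v --> \oo] --> 0.
  apply: (cvg_comp _ (fun l => 1 - binomial_tail (F (z0 + dl)) l.*2.+1 l.+1) r_oo).
  by apply: binomial_median_tail_gt; rewrite -hz0 Fr /=; have /andP[] := F01 (z0 + dl).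
have [l0 l1] := andP hlambda01.
(* Half the smaller limiting fraction, so that eventually both samples have
   at least [c * N] observations. *)
pose c := Num.min lambda (1 - lambda) / 2.
have min0 : 0 < Num.min lambda (1 - lambda) by rewrite lt_min l0 subr_gt0.
have c0 : 0 < c by rewrite divr_gt0.
have ml : Num.min lambda (1 - lambda) <= lambda by rewrite ge_min lexx.
have m1l : Num.min lambda (1 - lambda) <= 1 - lambda by rewrite ge_min lexx orbT.
have c1 : c <= 1 by rewrite /c; lra.
have balanced : \forall v \near \oo,
    c * (m v + n v)%:R <= (m v)%:R /\ c * (m v + n v)%:R <= (n v)%:R.
  move/cvgrPdist_le: hlambda => /(_ _ c0); apply: filterS => v.
  have t0 : 0 < (m v + n v)%:R :> R by rewrite ltr0n; exact: N0.
  have nE : (n v)%:R = (m v + n v)%:R - (m v)%:R :> R by rewrite natrD addrAC subrr add0r.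
  rewrite nE ler_norml => /andP[a1 a2].
  have b1 : c <= (m v)%:R / (m v + n v)%:R by move: a2 ml; rewrite /c; lra.
  have b2 : c <= 1 - (m v)%:R / (m v + n v)%:R by move: a1 m1l; rewrite /c; lra.
  split; first by rewrite -ler_pdivlMr.
  by rewrite -ler_pdivlMr // mulrBl divff ?gt_eqF.
(* A bound for every [x], eventually uniform, controls the supremum, which is
   thereby finite. *)
suff main e : 0 < e -> \forall v \near \oo, forall x,
    (`|P0 [set w | V1 R (m v) (n v) `^ (- (1 / 2)) *
        (smoothed_median X Y k (m v) (n v) (h v) w - E1 R (m v) (n v)) < x]%R
      - Phi x| <= e%:E)%E.
  move=> A [e /= e0 HA].
  have e20 : 0 < e / 2 by exact: divr_gt0.
  have := main _ e20; apply: filterS => v Hv /=.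
  set s := ereal_sup _.
  have s_le : (s <= (e / 2)%:E)%E by apply: ge_ereal_sup => _ [x _ <-]; exact: Hv.
  have s_ge : (0 <= s)%E.
    apply: le_ereal_sup_tmp; eexists; first by exists 0.
    exact: abse_ge0.
  have sfin : s \is a fin_num by rewrite ge0_fin_numE // (le_lt_trans s_le) // ltry.
  move: s_le s_ge; rewrite -(fineK sfin) !lee_fin => s_le s_ge.
  apply: HA; rewrite /= sub0r normrN ger0_norm //.
  by apply: le_lt_trans s_le _; rewrite ltr_pdivrMr // mulr_natr mulr2n ltrDl.
move=> e0.
have e40 : 0 < e / 4 by exact: divr_gt0.
have [N1 _ clt] := hypergeometric_clt c0 c1 e40.
have peak0 : 0 < normal_peak 1 :> R by exact: normal_peak_gt0.
(* The four errors of [smoothed_median_distance] are given [e / 4] each; this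
   is the threshold for the remainder in standard deviations. *)
pose e1 := e / 4 / normal_peak 1.
have e10 : 0 < e1 by exact: divr_gt0.
pose M := 4 / (e1 * c) ^+ 2.
have cheb : M * (gamma v + (N v)%:R * beta v ^+ 2) @[v --> \oo] --> 0.
  rewrite -[X in _ --> X](mulr0 M); apply: cvgMr.
  by rewrite -[X in _ --> X](addr0 0); exact: cvgD.
have tails : binomial_tail (F (z0 - dl)) (r v).*2.+1 (r v).+1 +
    (1 - binomial_tail (F (z0 + dl)) (r v).*2.+1 (r v).+1) @[v --> \oo] --> 0.
  by rewrite -[X in _ --> X](addr0 0); exact: cvgD.
near=> v => x.
have [cm cn] : c * (m v + n v)%:R <= (m v)%:R /\ c * (m v + n v)%:R <= (n v)%:R.
  by near: v.
have r1 : (1 < r v)%N by near: v; move/cvgnyPge: r_oo; apply.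
have NN1 : N1 <= (m v + n v)%:R.
  apply: le_trans (ltW (truncnS_gt N1)) _; rewrite ler_nat.
  by near: v; move/cvgnyPge: hN; apply.
have t0 : 0 < (m v + n v)%:R :> R by rewrite ltr0n; exact: N0.
have m0 : (0 < m v)%N by rewrite -(ltr0n R); apply: lt_le_trans cm; exact: mulr_gt0.
have n0 : (0 < n v)%N by rewrite -(ltr0n R); apply: lt_le_trans cn; exact: mulr_gt0.
have cheb_v : M * (gamma v + (N v)%:R * beta v ^+ 2) <= e / 4.
  apply: le_trans (ler_norm _) _; near: v.
  by move/cvgr0Pnorm_le: cheb; apply.
have tails_v : binomial_tail (F (z0 - dl)) (r v).*2.+1 (r v).+1 +
    (1 - binomial_tail (F (z0 + dl)) (r v).*2.+1 (r v).+1) <= e / 4.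
  apply: le_trans (ler_norm _) _; near: v.
  by move/cvgr0Pnorm_le: tails; apply.
have law := median_count_law indepW cdfW F_continuous (NE v) r1.
have QF i (y : R) : distribution P0 (pooled_family X Y i) `]-oo, y]%classic = (F y)%:E.
  exact: cdfW.
have Q0 i (y : R) : distribution P0 (pooled_family X Y i) [set y] = 0%E.
  exact: (prob_atom (cdfW i) F_continuous).
have := @smoothed_median_distance _ _ _ P0 X Y F k indepW cdfW hk _ _ _ _
  (NE v) r1 (hh_gt0 v) m0 n0 z0 dl e1 (beta v) (gamma v) (e / 4) dl0 e10 (g0 v)
  (clt _ _ _ _ (NE v) law cm cn NN1)
  (fun i a az => (rates _ v a (QF i) (Q0 i) az).1)
  (fun i a az => (rates _ v a (QF i) (Q0 i) az).2) x.
move=> H; apply: (le_trans H); rewrite lee_fin.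
have ch := chebyshev_ratio_le (beta v) c0 e10 (N0 v) (g0 v) cm cn.
have e1E : normal_peak 1 * e1 = e / 4 by rewrite /e1 mulrC divfK // gt_eqF.
rewrite e1E; move: (le_trans ch cheb_v) tails_v.
move: (_ / (e1 ^+ 2 * _)) (_ + (1 - _)) => u1 u2; lra.
Unshelve. all: by end_near.
Qed.
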